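(* Let $n\ge2$, $s\in(0,\frac12)$ and let $\{t_i\}_{i\in\mathbb N}\subset(0,1)$ with $t_i\to0^+$ as $i\to+\infty$. Then: (i) (Lower bound) Let $E\subset\mathbb R^n$ be Lebesgue measurable. For every sequence $\{E_i\}_{i\in\mathbb N}$ of Lebesgue measurable subsets of $\mathbb R^n$ with $\chi_{E_i}\to\chi_E$ strongly in $L^1(\mathbb R^n)$, $$C_{n,s}\,\mathrm P_{2s}(E)\le\liminf_{i\to+\infty}\frac{\mathcal E^s_{t_i}(E_i)}{g_s(t_i)}.$$ (ii) (Upper bound) For every Lebesgue measurable $E\subset\mathbb R^n$ there exists a sequence $\{E_i\}_{i\in\mathbb N}$ of Lebesgue measurable subsets of $\mathbb R^n$ such that $\chi_{E_i}\to\chi_E$ strongly in $L^1(\mathbb R^n)$ and $$C_{n,s}\,\mathrm P_{2s}(E)\ge\limsup_{i\to+\infty}\frac{\mathcal E^s_{t_i}(E_i)}{g_s(t_i)}.$$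
   Context: For $s\in(0,1)$ and $t>0$, $P^s(\cdot,t)$ is the fundamental solution of the fractional heat equation $\partial_t v+(-\Delta)^s v=0$ on $\mathbb R^n$, i.e. $P^s(z,t)=(2\pi)^{-n}\int_{\mathbb R^n}e^{-t|\xi|^{2s}}e^{i\langle z,\xi\rangle}\,d\xi$; it is positive and $\int_{\mathbb R^n}P^s(z,t)\,dz=1$. For measurable $E\subset\mathbb R^n$, with $E^c=\mathbb R^n\setminus E$, $$\mathcal E^s_t(E)=\int_E\int_{E^c}P^s(x-y,t)\,dy\,dx\in[0,+\infty],\qquad \mathrm P_{2s}(E)=\int_E\int_{E^c}\frac{1}{|x-y|^{n+2s}}\,dx\,dy\in[0,+\infty].$$ For $s\in(0,\frac12)$, $g_s(t)=t$. The constant is $C_{n,s}=\left(\int_{\mathbb R^n}\frac{1-\cos(h_1)}{|h|^{n+2s}}\,dh\right)^{-1}$, $h_1$ being the first coordinate of $h$. The convergence $\chi_{E_i}\to\chi_E$ in $L^1(\mathbb R^n)$ means $\|\chi_{E_i}-\chi_E\|_{L^1(\mathbb R^n)}\to0$. *)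

(* Defs.v *)
From HB Require Import structures.
From mathcomp Require Import all_boot all_order all_algebra.
From mathcomp Require Import all_classical all_reals all_analysis.
From mathcomp Require Import complex.

Set Implicit Arguments.
Unset Strict Implicit.
Unset Printing Implicit Defensive.

Import Order.TTheory GRing.Theory Num.Theory.
Import numFieldNormedType.Exports.

Local Open Scope classical_set_scope.
Local Open Scope ring_scope.

Definition measure_rV_display : measure_display.
Proof. exact: default_measure_display. Qed.

Section measurable_rV.
Context {R : realType} (n : nat).

Let coord (i : 'I_n) (v : 'rV[R]_n) : R := v ord0 i.

Let rV_set0 : g_sigma_preimage coord set0.
Proof. exact: sigma_algebra0. Qed.

Let rV_setC A : g_sigma_preimage coord A -> g_sigma_preimage coord (~` A).
Proof. exact: sigma_algebraC. Qed.

Let rV_bigcup (F : (set 'rV[R]_n)^nat) :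
  (forall i, g_sigma_preimage coord (F i)) ->
  g_sigma_preimage coord (\bigcup_i (F i)).
Proof. exact: sigma_algebra_bigcup. Qed.

(* The Borel sigma-algebra of R^n, generated by the coordinate maps. *)
HB.instance Definition _ := @isMeasurable.Build measure_rV_display
  'rV[R]_n (g_sigma_preimage coord) rV_set0 rV_setC rV_bigcup.

Lemma measurable_coord (i : 'I_n) :
  measurable_fun [set: 'rV[R]_n] (fun v => v ord0 i : R).
Proof.
move=> _ Y mY; rewrite setTI; apply: sub_sigma_algebra => /=.
rewrite -bigcup_seq/=; exists i => /=; first by rewrite mem_index_enum.
by exists Y => //; rewrite setTI.
Qed.

Lemma measurable_fun_rV d (T : measurableType d) (f : T -> 'rV[R]_n) :
  (forall i, measurable_fun [set: T] (fun x => f x ord0 i : R)) ->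
  measurable_fun [set: T] f.
Proof.
move=> mf.
have prefS : g_sigma_preimage (fun i => coord i \o f) `<=` measurable.
  apply: smallest_sub; first exact: sigma_algebra_measurable.
  rewrite -bigcup_seq; apply: bigcup_sub => i _ A [B mB <-].
  exact: mf.
move=> _ A mA; apply: prefS; rewrite g_sigma_preimage_comp.
by exists A.
Qed.

End measurable_rV.

Section lebesgue_cons.
Context {R : realType} (n : nat).

Definition consr (p : measurableTypeR R * 'rV[R]_n) : 'rV[R]_n.+1 :=
  \row_i if unlift ord0 i is Some j then p.2 ord0 j else p.1.

Definition unconsr (v : 'rV[R]_n.+1) : measurableTypeR R * 'rV[R]_n :=
  (v ord0 ord0, \row_j v ord0 (lift ord0 j)).

Lemma consrK : cancel consr unconsr.
Proof.
case=> x v; rewrite /consr /unconsr mxE unlift_none; congr pair.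
by apply/rowP => j; rewrite !mxE liftK.
Qed.

Lemma unconsrK : cancel unconsr consr.
Proof.
move=> v; apply/rowP => i; rewrite mxE.
by have [j ->|->] := unliftP ord0 i; rewrite ?mxE.
Qed.

Lemma measurable_consr : measurable_fun [set: measurableTypeR R * 'rV[R]_n] consr.
Proof.
apply: measurable_fun_rV => i.
have [j ->|->] := unliftP ord0 i.
  under eq_fun do rewrite mxE liftK.
  exact: (measurableT_comp (measurable_coord j) measurable_snd).
under eq_fun do rewrite mxE unlift_none.
exact: measurable_fst.
Qed.

Lemma measurable_unconsr : measurable_fun [set: 'rV[R]_n.+1] unconsr.
Proof.
apply: measurable_fun_pair => /=; first exact: measurable_coord.
apply: measurable_fun_rV => j; under eq_fun do rewrite mxE.
exact: measurable_coord.
Qed.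

HB.instance Definition _ :=
  isMeasurableFun.Build _ _ _ _ consr measurable_consr.

Variable mu : {sigma_finite_measure set 'rV[R]_n -> \bar R}.

Definition lebesgue_cons : set 'rV[R]_n.+1 -> \bar R :=
  pushforward (@lebesgue_measure R \x mu)%E consr.

Let lebesgue_cons0 : lebesgue_cons set0 = 0%E.
Proof. exact: measure0. Qed.

Let lebesgue_cons_ge0 A : (0 <= lebesgue_cons A)%E.
Proof. exact: measure_ge0. Qed.

Let lebesgue_cons_semi_sigma_additive : semi_sigma_additive lebesgue_cons.
Proof. exact: measure_semi_sigma_additive. Qed.

HB.instance Definition _ := isMeasure.Build _ _ _ lebesgue_cons
  lebesgue_cons0 lebesgue_cons_ge0 lebesgue_cons_semi_sigma_additive.

Let lebesgue_cons_sigma_finite : sigma_finite setT lebesgue_cons.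
Proof.
have /sigma_finiteP[F [FT ndF Foo]] := sigma_finiteT (@lebesgue_measure R).
have /sigma_finiteP[G [GT ndG Goo]] := sigma_finiteT mu.
exists (fun k => unconsr @^-1` (F k `*` G k)).
  apply/seteqP; split => // v _.
  have [i _ Fi] : (\bigcup_i F i) (unconsr v).1 by rewrite -FT.
  have [j _ Gj] : (\bigcup_i G i) (unconsr v).2 by rewrite -GT.
  exists (maxn i j) => //; split.
  - by move: Fi; exact/subsetPset/ndF/leq_maxl.
  - by move: Gj; exact/subsetPset/ndG/leq_maxr.
move=> k; have [mF Fk] := Foo k; have [mG Gk] := Goo k; split.
  rewrite -[X in measurable X]setTI.
  by apply: measurable_unconsr => //; exact: measurableX.
rewrite /lebesgue_cons /pushforward -comp_preimage.
rewrite (_ : unconsr \o consr = id) ?preimage_id; last first.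
  by apply/funext => p /=; rewrite consrK.
by rewrite product_measure1E// lte_mul_pinfty// ge0_fin_numE.
Qed.

HB.instance Definition _ :=
  Measure_isSigmaFinite.Build _ _ _ lebesgue_cons lebesgue_cons_sigma_finite.

End lebesgue_cons.

(* Lebesgue measure on the Borel sets of R^n: the n-fold product of the Lebesgue
   measure of R, R^n.+1 being identified with R * R^n. *)
Fixpoint borel_lebesgue {R : realType} (n : nat) :
    {sigma_finite_measure set 'rV[R]_n -> \bar R} :=
  match n with
  | 0 => \d_(0 : 'rV[R]_0)
  | k.+1 => lebesgue_cons (borel_lebesgue k)
  end.

(* The complete measure obtained from the previous one, on the Lebesgue
   measurable sets; same construction as completed_lebesgue_measure on R. *)
Definition lebesgue_rV (R : realType) (n : nat) : set _ -> \bar R :=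
  @completed_measure_extension _ _ R (@borel_lebesgue R n).

HB.instance Definition _ (R : realType) (n : nat) :=
  Measure.on (@lebesgue_rV R n).

Lemma lebesgue_rV_sigma_finite (R : realType) (n : nat) :
  sigma_finite setT (@lebesgue_rV R n).
Proof. exact/completed_measure_extension_sigma_finite/sigma_finiteT. Qed.

HB.instance Definition _ (R : realType) (n : nat) :=
  Measure_isSigmaFinite.Build _ _ _ (@lebesgue_rV R n)
    (@lebesgue_rV_sigma_finite R n).

Definition lebesgue_measurable {R : realType} {n : nat}
    (E : set 'rV[R]_n) : Prop :=
  (@borel_lebesgue R n)^*%mu.-cara.-measurable E.

Section fractional.
Context {R : realType} (n : nat).
Implicit Types (s t : R) (x y z xi h : 'rV[R]_n) (E : set 'rV[R]_n).

Definition dotr x y : R := \sum_(i < n) x ord0 i * y ord0 i.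

(* The canonical norm of 'rV[R]_n is the sup norm, hence this definition. *)
Definition enorm x : R := Num.sqrt (dotr x x).

Definition cexpi (theta : R) : R[i] := (cos theta +i* sin theta)%C.

Definition cintegral (f : 'rV[R]_n -> R[i]) : R[i] :=
  ((\int[@lebesgue_rV R n]_x complex.Re (f x))%R +i*
   (\int[@lebesgue_rV R n]_x complex.Im (f x))%R)%C.

Definition heat_kernelC s z t : R[i] :=
  (((2 * pi) ^- n)%:C *
   cintegral (fun xi =>
     (expR (- t * enorm xi `^ (2 * s)))%:C * cexpi (dotr z xi)))%C.

(* The imaginary part of heat_kernelC vanishes, by the symmetry xi |-> - xi. *)
Definition heat_kernel s z t : R := complex.Re (heat_kernelC s z t).

Definition heat_energy s t E : \bar R :=
  (\int[@lebesgue_rV R n]_(x in E) \int[@lebesgue_rV R n]_(y in ~` E)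
    (heat_kernel s (x - y) t)%:E)%E.

Definition frac_perimeter s E : \bar R :=
  (\int[@lebesgue_rV R n]_(y in E) \int[@lebesgue_rV R n]_(x in ~` E)
    ((enorm (x - y) `^ (n%:R + 2 * s))^-1)%:E)%E.

(* h_1, the first coordinate, has index 0. *)
Definition frac_const (n_gt0 : (0 < n)%N) s : R :=
  (\int[@lebesgue_rV R n]_h
    ((1 - cos (h ord0 (Ordinal n_gt0))) / enorm h `^ (n%:R + 2 * s)))%R^-1.

Definition L1_cvg (E_ : (set 'rV[R]_n)^nat) E : Prop :=
  'N[@lebesgue_rV R n]_1[EFin \o (\1_(E_ i) \- \1_E)%R]%E @[i --> \oo] --> 0%E.

End fractional.

(* The scaling factor in the range 0 < s < 1/2; it is different for s >= 1/2. *)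
Definition g_s {R : realType} (s t : R) : R := t.

(* Main.v *)
Require Import Defs.
From HB Require Import structures.
From mathcomp Require Import all_boot all_order all_algebra.
From mathcomp Require Import all_classical all_reals all_analysis.
From mathcomp Require Import measurable_realfun complex.
From mathcomp Require Import ring lra.
Set Implicit Arguments.
Unset Strict Implicit.
Unset Printing Implicit Defensive.
Import Order.TTheory GRing.Theory Num.Theory.
Import numFieldNormedType.Exports.
Local Open Scope classical_set_scope.
Local Open Scope ring_scope.

(** Write P_t for the heat kernel, N for the dimension, and
    nu(z) = C_{N,s} / |z|^(N+2s) for the kernel of C_{N,s} P_{2s}.  Everything
    follows from two facts, valid off the null hyperplane z_0 = 0:
      (a)  0 <= P_t(z) <= t nu(z) for every t > 0;
      (b)  P_t(z) / t --> nu(z) as t --> 0.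
    By (a), the energies of the constant sequence E_i = E, divided by t_i, are at
    most C_{N,s} P_{2s}(E), which is the upper bound.  By (b) and Fatou's lemma, used once in each
    variable along a subsequence on which the indicators of the E_i converge
    almost everywhere, the energy is lower semicontinuous, which is the lower
    bound ([interaction_lower_semicontinuous]).

    Both facts come from one integration by parts in the first frequency
    variable.  Let l = |v|^2 and k(v) = 2 z_0 v_0 sin<z,v>, so that |k| is at
    most a constant times l.  For a decaying radial profile g,
      int k g'(l) dv = - z_0^2 int g(l) cos<z,v> dv      ([coord_kernel_ibp]).
    With g = exp(- t l^s) this reads
      (2 pi)^N z_0^2 P_t(z) = t s K(t),
      K(t) = int k l^(s-1) exp(- t l^s) dv,
    so (a) and (b) are statements on K(t); the factor t has been extracted.
    With g = exp(- a l) it gives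
      int k exp(- a l) dv = z_0^2 gauss_hat(a) / a >= 0,
    where gauss_hat is the Fourier transform of the Gaussian.

    Positivity.  A bounded function f of l is called Gauss-positive when
    int k exp(- tau l) f >= 0 for all tau > 0.  The class is stable under bounded
    limits, positive combinations, and products with positive mixtures of the
    functions exp(- a l).  Truncating Bernstein's formula
      l^s = (s / G) int (1 - exp(- a l)) a^(-s-1) da
    at a > 1/m turns exp(- r l^s) into a constant times the exponential of such a
    mixture, a compound Poisson approximation.  Hence exp(- r l^s) is
    Gauss-positive ([stable_gauss_positive]).  Together with
      G l^(s-1) = int a^(-s) exp(- a l) da               ([laplace_powR])
    this yields K(t) >= 0.  Moreover
      l^(s-1) (1 - exp(- t l^s)) = int_0^t l^(2s-1) exp(- r l^s) dr,
    and since 2s < 1 the power l^(2s-1) is again a mixture of Gaussians: this is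
    where s < 1/2 enters, and it yields G K(t) <= z_0^2 I, with
      I = int a^(-s) gauss_hat(a) / a da = riesz_const / |z|^(N+2s).
    Fatou's lemma in the mixture representation of G K(t) gives
    z_0^2 I <= liminf G K(t) as t --> 0.  Finally, integrating the formula for I
    against 1 - cos h_1 and using Bernstein's formula once more identifies
    s riesz_const / ((2 pi)^N G) with C_{N,s} ([frac_constE]). *)

(** * Mixtures of nonnegative kernels *)
Section mixtures.
Context d1 d2 (X : measurableType d1) (Y : measurableType d2) (R : realType).
Variables (mu : {sigma_finite_measure set X -> \bar R})
  (nu : {sigma_finite_measure set Y -> \bar R}).

(** Fubini's theorem for a weight H which is a superposition of the functions
    h (., y).  Since h is nonnegative, integrability of k * H suffices to exchange
    the integrals although k changes sign. *)
Lemma integral_mixture (D : set Y) (k H : X -> R) (h : X * Y -> R) :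
  measurable D -> measurable_fun setT k -> measurable_fun setT h ->
  (forall x y, D y -> 0 <= h (x, y)) ->
  (forall x, k x != 0 -> (\int[nu]_(y in D) (h (x, y))%:E = (H x)%:E)%E) ->
  mu.-integrable setT (fun x => (k x * H x)%:E) ->
  (\int[mu]_x (k x * H x)%:E =
   \int[nu]_(y in D) \int[mu]_x (k x * h (x, y))%:E)%E.
Proof.
move=> mD mk mh h0 hH ikH.
pose f (z : X * Y) : \bar R := (k z.1 * (h z * \1_D z.2))%:E.
have mh1 : measurable_fun setT (fun z : X * Y => h z * \1_D z.2).
  by apply: measurable_funM => //; apply: measurableT_comp.
have mf : measurable_fun setT f.
  apply/measurable_EFinP; apply: measurable_funM => //.
  exact: measurableT_comp.
have hx (x : X) : (\int[nu]_y (h (x, y) * \1_D y)%:E =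
    \int[nu]_(y in D) (h (x, y))%:E)%E.
  rewrite [RHS]integral_mkcond; apply: eq_integral => y _.
  by rewrite patchE indicE; case: ifPn => _; rewrite ?mulr1// mulr0.
have h10 z : 0 <= h z * \1_D z.2.
  rewrite indicE; case: z => x y /=; have [/set_mem Dy|_] := boolP (y \in D).
    by rewrite mulr1 h0.
  by rewrite mulr0.
have mhx x : measurable_fun setT (fun y => (h (x, y) * \1_D y)%:E).
  apply/measurable_EFinP.
  exact: (measurableT_comp mh1 (pair1_measurable x)).
have fint : (mu \x nu)%E.-integrable setT f.
  apply/integrable12ltyP => //.
  have /integrableP[_] := ikH; apply: le_lt_trans.
  apply: ge0_le_integral => //.
  - by move=> x _; exact: integral_ge0.
  - apply: (@measurable_fun_fubini_tonelli_F _ _ _ _ _ nu (abse \o f)) => //.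
      exact: measurableT_comp.
    by move=> z /=.
  - by apply: measurableT_comp => //; case/integrableP : ikH.
  - move=> x _; rewrite /f /=.
    have [->|kx] := eqVneq (k x) 0.
      rewrite integral0_eq; first by rewrite mul0r normr0.
      by move=> y _; rewrite mul0r normr0.
    under eq_integral do rewrite normrM [X in (_ * X)%:E]ger0_norm// EFinM.
    rewrite ge0_integralZl_EFin//; last by move=> y _; rewrite lee_fin.
    rewrite hx hH// -EFinM lee_fin normrM ler_wpM2l//.
    exact: ler_norm.
rewrite [RHS]integral_mkcond.
transitivity (\int[mu]_x \int[nu]_y f (x, y))%E.
  apply: eq_integral => x _; rewrite /f /=.
  have [->|kx] := eqVneq (k x) 0.
    rewrite integral0_eq; first by rewrite mul0r.
    by move=> y _; rewrite mul0r.
  under eq_integral do rewrite EFinM.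
  rewrite integralZl//; last first.
    apply/integrableP; split => //.
    under eq_integral do rewrite gee0_abs ?lee_fin//.
    by rewrite hx hH// ltry.
  by rewrite hx hH// -EFinM.
rewrite (Fubini fint); apply: eq_integral => y _.
rewrite patchE /f /= indicE; case: ifPn => _.
  by under eq_integral do rewrite mulr1.
by rewrite integral0_eq// => x _; rewrite !mulr0.
Qed.

(** The device behind every positivity statement below: a sign-changing k which
    has nonnegative integral against each h (., y) keeps it against mixtures. *)
Lemma integral_mixture_ge0 (D : set Y) (k H : X -> R) (h : X * Y -> R) :
  measurable D -> measurable_fun setT k -> measurable_fun setT h ->
  (forall x y, D y -> 0 <= h (x, y)) ->
  (forall x, k x != 0 -> (\int[nu]_(y in D) (h (x, y))%:E = (H x)%:E)%E) ->
  mu.-integrable setT (fun x => (k x * H x)%:E) ->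
  (forall y, D y -> 0 <= \int[mu]_x (k x * h (x, y))%:E)%E ->
  (0 <= \int[mu]_x (k x * H x)%:E)%E.
Proof.
move=> mD mk mh h0 hH ikH kh0.
by rewrite (integral_mixture mD mk mh h0 hH ikH); exact: integral_ge0.
Qed.

Lemma ge0_integral_swap (D : set X) (E : set Y) (f : X -> Y -> R) :
  measurable D -> measurable E ->
  measurable_fun setT (fun z : X * Y => f z.1 z.2) ->
  (forall x y, D x -> E y -> 0 <= f x y) ->
  (\int[mu]_(x in D) \int[nu]_(y in E) (f x y)%:E =
   \int[nu]_(y in E) \int[mu]_(x in D) (f x y)%:E)%E.
Proof.
move=> mD mE mf f0.
pose g (z : X * Y) : \bar R := (f z.1 z.2 * (\1_D z.1 * \1_E z.2))%:E.
have mg : measurable_fun setT g.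
  apply/measurable_EFinP; apply: measurable_funM => //.
  by apply: measurable_funM; apply: measurableT_comp.
have g0 z : (0 <= g z)%E.
  rewrite /g !indicE; case: z => x y /=; rewrite lee_fin.
  have [/set_mem Dx|_] := boolP (x \in D); last by rewrite mul0r mulr0.
  have [/set_mem Ey|_] := boolP (y \in E); last by rewrite !mulr0.
  by rewrite !mulr1 f0.
rewrite [LHS]integral_mkcond [RHS]integral_mkcond.
transitivity (\int[mu]_x \int[nu]_y g (x, y))%E.
  apply: eq_integral => x _; rewrite patchE /g /= [\1_D x]indicE; case: ifPn => _.
    rewrite integral_mkcond; apply: eq_integral => y _.
    by rewrite patchE indicE; case: ifPn => _; rewrite ?mulr1// !mulr0.
  by rewrite integral0_eq// => y _; rewrite mul0r mulr0.
rewrite fubini_tonelli//; apply: eq_integral => y _.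
rewrite patchE /g /= [\1_E y]indicE; case: ifPn => _.
  rewrite [RHS]integral_mkcond; apply: eq_integral => x _.
  by rewrite patchE indicE; case: ifPn => _; rewrite ?mulr1// !(mul0r, mulr0).
by rewrite integral0_eq// => x _; rewrite !mulr0.
Qed.

End mixtures.

(** * Calculus on the half-line *)
Section halfline.
Context {R : realType}.
Local Notation mu := (@lebesgue_measure R).

(** Uniqueness of Lebesgue measure reduces the claim to half-open intervals. *)
Lemma lebesgue_measure_scale (l : R) (A : set R) : 0 < l -> measurable A ->
  pushforward mu ( *%R l : _ -> measurableTypeR R) A = (l^-1%:E * mu A)%E.
Proof.
move=> l0 mA.
have mphi : measurable_fun setT ( *%R l : measurableTypeR R -> measurableTypeR R).
  exact: mulrl_measurable.
pose phi := ( *%R l : measurableTypeR R -> measurableTypeR R).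
suff -> : mu A = mscale (NngNum (ltW l0)) (pushforward mu phi) A.
  by rewrite /mscale /= muleA -EFinM mulVf ?mul1e// gt_eqF.
move=> m; apply: lebesgue_measure_unique => //= _ [[a b]] _ <-.
rewrite /mscale/= /pushforward.
have -> : *%R l @^-1` [set` `]a, b]] = [set` `]l^-1 * a, l^-1 * b]].
  apply/seteqP; split => x /=; rewrite !in_itv/= ![l^-1 * _]mulrC ler_pdivlMr// ltr_pdivrMr// ![x * l]mulrC//.
rewrite !lebesgue_measure_itv/= !lte_fin ltr_pM2l ?invr_gt0//.
case: ifPn => _; last by rewrite mule0.
by rewrite -!EFinD -EFinM; congr EFin; field; rewrite gt_eqF.
Qed.

Lemma ge0_integral_scale (l : R) (f : R -> \bar R) : 0 < l ->
  measurable_fun setT f -> (forall x, 0 <= f x)%E ->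
  (\int[mu]_x f (l * x)%R = l^-1%:E * \int[mu]_x f x)%E.
Proof.
move=> l0 mf f0.
have mphi : measurable_fun setT ( *%R l : measurableTypeR R -> measurableTypeR R).
  exact: mulrl_measurable.
pose phi := ( *%R l : measurableTypeR R -> measurableTypeR R).
have := @ge0_integral_pushforward _ _ _ _ R phi mphi mu setT f measurableT mf.
rewrite preimage_setT => <-//.
have l'0 : 0 <= l^-1 by rewrite invr_ge0 ltW.
rewrite (@eq_measure_integral _ _ _ _ (mscale (NngNum l'0) mu)); last first.
  move=> A mA _.
  exact: lebesgue_measure_scale.
by rewrite ge0_integral_mscale.
Qed.

Lemma ge0_integral_scale_halfline (l : R) (f : R -> \bar R) : 0 < l ->
  measurable_fun setT f -> (forall x : R, (0 < x)%R -> (0 <= f x)%E) ->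
  (\int[mu]_(x in `]0%R, +oo[) f (l * x)%R =
   l^-1%:E * \int[mu]_(x in `]0%R, +oo[) f x)%E.
Proof.
move=> l0 mf f0.
rewrite integral_mkcond [in RHS]integral_mkcond -(@ge0_integral_scale l)//.
- apply: eq_integral => x _; rewrite !patchE !mem_setE !in_itv/= !andbT.
  by rewrite pmulr_rgt0.
- by apply/(measurable_restrictT _ _).1 => //; exact: measurable_funTS.
- move=> x; rewrite patchE mem_setE in_itv/= andbT; case: ifPn => //.
  exact: f0.
Qed.

Lemma integral_itv_derive (F f : R -> R) (a b : R) : a < b ->
  (forall x, a <= x <= b -> is_derive x 1 F (f x)) ->
  (forall x, a <= x <= b -> {for x, continuous f}) ->
  (\int[mu]_(x in `[a, b]) (f x)%:E = (F b - F a)%:E)%E.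
Proof.
move=> ab dF cf; rewrite EFinB; apply: continuous_FTC2 => //.
- rewrite continuous_subspace_in => x xab.
  apply: continuous_subspaceT_for; first exact: set_mem.
  by apply: cf; move: xab; rewrite inE/= in_itv.
- split.
  + by move=> x; rewrite in_itv/= => /andP[ax xb]; have [] := dF x _; rewrite // !ltW.
  + apply: cvg_at_right_filter; apply: differentiable_continuous.
    by apply/derivable1_diffP; have [] := dF a _; rewrite // lexx ltW.
  + apply: cvg_at_left_filter; apply: differentiable_continuous.
    by apply/derivable1_diffP; have [] := dF b _; rewrite // lexx ltW.
- move=> x; rewrite in_itv/= => /andP[ax xb]; rewrite derive1E.
  by apply: derive_val; apply: dF; rewrite !ltW.
Qed.

Lemma is_derive_powR (p v : R) : 0 < v ->
  is_derive v 1 (fun x => x `^ p) (p * v `^ (p - 1)).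
Proof.
move=> v0; have vi : v \in `]0, +oo[ by rewrite in_itv/= v0.
apply: DeriveDef; first exact: derivable_powR.
by rewrite -derive1E powR_derive1.
Qed.

Lemma continuous_powR (p v : R) : 0 < v -> {for v, continuous (fun x => x `^ p)}.
Proof.
move=> v0; apply: differentiable_continuous; apply/derivable1_diffP.
by have [] := is_derive_powR p v0.
Qed.

(** The integrand is unbounded at 0 when p < 1, hence the exhaustion of ]0, b] by
    the intervals [b / (i + 2), b]. *)
Lemma integral_powR0 (p b : R) : 0 < p -> 0 < b ->
  (\int[mu]_(v in `]0%R, b]) (v `^ (p - 1))%:E = (b `^ p / p)%:E)%E.
Proof.
move=> p0 b0.
pose a i : R := b / i.+2%:R.
have a0 i : 0 < a i by rewrite divr_gt0.
have ab i : a i < b by rewrite /a ltr_pdivrMr// ltr_pMr// ltr1n.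
have acvg : a @ \oo --> (0:R).
  rewrite /a -[X in _ --> X](mulr0 b); apply: cvgM; first exact: cvg_cst.
  by have := @cvg_harmonic R; rewrite -cvg_shiftS.
have nda i j : (i <= j)%N -> a j <= a i.
  by move=> ij; rewrite /a ler_pM2l// lef_pV2 ?posrE// ler_nat.
have UE : \bigcup_i [set` `[a i, b]] = [set` `]0, b]].
  apply/seteqP; split => x /=.
    by move=> [i _ /=]; rewrite !in_itv/= => /andP[ax ->]; rewrite (lt_le_trans _ ax).
  rewrite in_itv/= => /andP[x0 xb].
  have /cvgrPdist_lt/(_ _ x0)[N _ /(_ N (leqnn N))/=] := acvg.
  rewrite sub0r normrN gtr0_norm// => aN; exists N => //=.
  by rewrite in_itv/= xb ltW.
rewrite -UE.
have mp : measurable_fun setT (fun v : R => (v `^ (p - 1))%:E).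
  by apply/measurable_EFinP; exact: measurable_powR.
have h : (\int[mu]_(v in `[a i, b]) (v `^ (p - 1))%:E @[i --> \oo] -->
    \int[mu]_(v in \bigcup_i [set` `[a i, b]]) (v `^ (p - 1))%:E)%E.
  apply: ge0_nondecreasing_set_cvg_integral.
  - move=> i j ij; apply/subsetPset => x /=; rewrite !in_itv/= => /andP[+ ->].
    by rewrite andbT; apply: le_trans; exact: nda.
  - by [].
  - by move=> i; exact: measurable_funTS.
  - by move=> i x _; rewrite lee_fin powR_ge0.
move: h; rewrite (_ : (fun i => _) = (fun i => (b `^ p / p - a i `^ p / p)%:E)).
  move=> /cvg_lim <-//; apply/cvg_lim => //; apply: cvg_EFin; first exact: nearW.
  rewrite -[X in _ --> X]subr0; apply: cvgB; first exact: cvg_cst.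
  rewrite -[X in _ --> X](mul0r p^-1); apply: cvgM; last exact: cvg_cst.
  by have /cvg_at_rightP := powR_cvg0 p0; apply; split.
apply/funext => i; apply: (@integral_itv_derive (fun v => v `^ p / p)) => //.
  move=> x /andP[ax _].
  rewrite [X in is_derive _ _ _ X](_ : _ = p^-1 * (p * x `^ (p - 1))); last first.
    by rewrite mulrA mulVf ?mul1r// gt_eqF.
  rewrite (_ : (fun v => _) = p^-1 *: (fun v => v `^ p)); last first.
    by apply/funext => v /=; rewrite fctE mulrC.
  by apply: is_deriveZ; apply: is_derive_powR; exact: lt_le_trans ax.
by move=> x /andP[ax _]; apply: continuous_powR; exact: lt_le_trans ax.
Qed.

End halfline.


(** * Laplace and Bernstein representations of powers *)
Section measurable_elementary.
Context d (T : measurableType d) (R : realType).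
Implicit Types (D : set T) (f : T -> R).

Lemma measurable_fun_powR D f p : measurable_fun D f ->
  measurable_fun D (fun x => f x `^ p).
Proof. by move=> mf; exact: (measurableT_comp (@measurable_powR R p) mf). Qed.

Lemma measurable_fun_expR D f : measurable_fun D f ->
  measurable_fun D (fun x => expR (f x)).
Proof. by move=> mf; exact: (measurableT_comp (@measurable_expR R) mf). Qed.

Lemma measurable_fun_cos D f : measurable_fun D f ->
  measurable_fun D (fun x => cos (f x)).
Proof.
move=> mf; apply: (measurableT_comp _ mf).
by apply: continuous_measurable_fun; exact: continuous_cos.
Qed.

Lemma measurable_fun_sin D f : measurable_fun D f ->
  measurable_fun D (fun x => sin (f x)).
Proof.
move=> mf; apply: (measurableT_comp _ mf).
by apply: continuous_measurable_fun; exact: continuous_sin.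
Qed.

Lemma measurable_fun_opp D f : measurable_fun D f ->
  measurable_fun D (fun x => - f x).
Proof. by move=> mf; apply: measurableT_comp. Qed.

End measurable_elementary.

Section laplace.
Context {R : realType}.
Local Notation mu := (@lebesgue_measure R).

Lemma measurable_powR_expR (a l : R) :
  measurable_fun setT (fun x : R => x `^ a * expR (- (x * l))).
Proof.
apply: measurable_funM; first exact: measurable_powR.
apply: measurableT_comp; first exact: measurable_expR.
by apply: measurableT_comp => //; exact: mulrr_measurable.
Qed.

Lemma is_derive_expRN (l x : R) :
  is_derive x 1 (fun y => expR (- (y * l))) (- l * expR (- (x * l))).
Proof.
have h : is_derive x 1 (fun y : R => - (y * l)) (- l).
  rewrite (_ : (fun y : R => - (y * l)) = (- l) *: id); last first.
    by apply/funext => y; change (- (y * l) = - l * y); ring.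
  rewrite -[X in is_derive _ _ _ X]mulr1; exact: is_deriveZ.
rewrite mulrC; exact: is_derive1_comp.
Qed.

Lemma continuous_expRN (l : R) : continuous (fun x : R => expR (- (x * l))).
Proof.
move=> x; apply: differentiable_continuous; apply/derivable1_diffP.
by have [] := is_derive_expRN l x.
Qed.

Lemma measurable_expRN (l : R) : measurable_fun setT (fun x : R => expR (- (x * l))).
Proof. exact: continuous_measurable_fun (@continuous_expRN l). Qed.

Lemma integral_expRN (l : R) : 0 < l ->
  (\int[mu]_(x in `]0%R, +oo[) (expR (- (x * l)))%:E = (l^-1)%:E)%E.
Proof.
move=> l0.
have mf : measurable_fun setT (fun x : R => expR (- (x * l))).
  exact: continuous_measurable_fun (@continuous_expRN l).
rewrite integral_itv_obnd_cbnd; last first.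
  by apply/measurable_EFinP; exact: measurable_funTS.
have dF (x : R) : is_derive x 1 (fun y : R => - l^-1 * expR (- (y * l))) (expR (- (x * l))).
  rewrite [X in is_derive _ _ _ X](_ : _ = - l^-1 * (- l * expR (- (x * l)))).
    exact: (is_deriveZ (- l^-1) (is_derive_expRN l x)).
  by field; rewrite gt_eqF.
rewrite (@ge0_continuous_FTC2y _ _ (fun y : R => - l^-1 * expR (- (y * l))) 0 0)//.
- by rewrite mul0r oppr0 expR0 mulr1 sub0e EFinN oppeK.
- exact/continuous_subspaceT/continuous_expRN.
- rewrite -[X in _ --> X](mulr0 (- l^-1)); apply: cvgM; first exact: cvg_cst.
  apply: (@cvg_comp _ _ _ (fun x => x * l) (fun x => expR (- x)) _ +oo%R); last first.
    exact: cvgr_expR.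
  exact: gt0_cvgMly.
- apply: cvg_at_right_filter; apply: cvgM; first exact: cvg_cst.
  exact: continuous_expRN.
- by move=> x _; rewrite derive1E; apply: derive_val.
Qed.

(** Scaling x by l gives the power of l, where G = Gamma (1 - a) is the value
    at l = 1. *)
Lemma laplace_powR (a : R) : 0 < a < 1 ->
  exists2 G : R, 0 < G & forall l, 0 < l ->
  (\int[mu]_(x in `]0%R, +oo[) (x `^ (- a) * expR (- (x * l)))%:E
   = (G * l `^ (a - 1))%:E)%E.
Proof.
move=> /andP[a0 a1].
pose I := (\int[mu]_(x in `]0%R, +oo[) (x `^ (- a) * expR (- (x * 1)))%:E)%E.
have f0 x l : 0 <= x `^ (- a) * expR (- (x * l)).
  by rewrite mulr_ge0 ?powR_ge0 ?expR_ge0.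
have m1 : measurable_fun setT (fun x : R => (x `^ (- a) * \1_`]0, 1] x)%:E).
  apply/measurable_EFinP; apply: measurable_funM; first exact: measurable_powR.
  by apply: measurable_indic.
have m2 : measurable_fun setT (fun x : R => (expR (- (x * 1)))%:E).
  by apply/measurable_EFinP; exact: continuous_measurable_fun (@continuous_expRN 1).
have Ioo : (I < +oo)%E.
  apply: (@le_lt_trans _ _ (\int[mu]_(x in `]0%R, +oo[)
    ((x `^ (- a) * \1_`]0, 1] x)%:E + (expR (- (x * 1)))%:E)))%E.
    apply: ge0_le_integral => //.
    - by move=> x _; rewrite lee_fin.
    - by apply/measurable_EFinP/measurable_funTS; exact: measurable_powR_expR.
    - by apply: measurable_funTS; exact: emeasurable_funD.
    - move=> x; rewrite /= in_itv/= andbT => x0; rewrite -EFinD lee_fin indicE.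
      have [x1|x1] := boolP (x \in `]0, 1]%classic).
        rewrite !mulr1 (@le_trans _ _ (x `^ (- a)))//.
          by rewrite ler_piMr ?powR_ge0// -expR0 ler_expR oppr_le0 ltW.
        by rewrite lerDl expR_ge0.
      rewrite mulr0 add0r ler_piMl ?expR_ge0//.
      have : 1 <= x.
        by move: x1; rewrite mem_setE in_itv/= x0/= -ltNge => /ltW.
      move=> x1'; rewrite powRN invf_le1 ?powR_gt0//.
      by rewrite -(@powRr0 _ x) ler_powR// ltW.
  rewrite ge0_integralD//=; first last.
  - exact: measurable_funTS.
  - exact: measurable_funTS.
  - by move=> x _; rewrite lee_fin mulr_ge0 ?powR_ge0.
  rewrite integral_expRN// lte_add_pinfty ?ltry//.
  rewrite (_ : (\int[_]_(_ in _) _)%E =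
     \int[mu]_(x in `]0%R, 1%R]) (x `^ ((1 - a) - 1))%:E)%E; last first.
    rewrite integral_mkcond [RHS]integral_mkcond; apply: eq_integral => x _.
    rewrite !patchE !mem_setE !in_itv/= andbT indicE mem_setE in_itv/=.
    rewrite [1 - a]addrC addrK; case: (0 < x) => //=.
    by case: (x <= 1); rewrite ?mulr1// mulr0.
  by rewrite integral_powR0 ?ltry//; lra.
have I0 : (0 < I)%E.
  apply: (@lt_le_trans _ _ (\int[mu]_(x in `]0%R, 1%R]) (cst (expR (- 1))%:E x))%E).
    rewrite integral_cst//= lebesgue_measure_itv/= lte_fin ltr01.
    by rewrite oppr0 adde0 mule1 lte_fin expR_gt0.
  rewrite /I integral_mkcond [leRHS]integral_mkcond.
  apply: ge0_le_integral => //.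
  - by move=> x _; rewrite patchE; case: ifPn => //; rewrite lee_fin expR_ge0.
  - by apply/(measurable_restrictT _ _).1.
  - apply/(measurable_restrictT _ _).1 => //.
    by apply/measurable_EFinP/measurable_funTS; exact: measurable_powR_expR.
  - move=> x _; rewrite !patchE !mem_setE !in_itv/= andbT.
    have [x0|x0]/= := ltP 0 x; last by [].
    case: ifPn => [x1|_]; last by rewrite lee_fin.
    rewrite lee_fin -[leLHS]mul1r ler_pM ?ler01 ?expR_ge0//.
      rewrite powRN invf_ge1 ?powR_gt0//.
      rewrite -(@powRr0 _ x) ger_powR ?x0// ltW//.
    by rewrite ler_expR lerN2 mulr1.
have IE : I = (fine I)%:E by rewrite fineK// ge0_fin_numE// ltW.
exists (fine I) => [|l l0]; first by rewrite -lte_fin -IE.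
have := @ge0_integral_scale_halfline _ l (fun x => (x `^ (- a) * expR (- (x * 1)))%:E) l0.
rewrite -/I; move=> /(_ _ _) h.
rewrite (_ : (\int[_]_(_ in _) _)%E = ((l `^ a)%:E * \int[mu]_(x in `]0%R, +oo[)
   ((l * x)%R `^ (- a) * expR (- ((l * x) * 1)))%:E))%E; last first.
  rewrite -ge0_integralZl_EFin ?powR_ge0//.
  - apply: eq_integral => x; rewrite mem_setE in_itv/= andbT => x0.
    rewrite -EFinM; congr EFin; rewrite mulrA; congr (_ * _); last first.
      by rewrite mulr1 mulrC.
    rewrite powRM ?ltW// mulrA (powRN l) mulfV ?mul1r//.
    by rewrite gt_eqF// powR_gt0.
  - by move=> x _; rewrite lee_fin.
  - apply/measurable_EFinP/measurable_funTS.
    apply: (measurableT_comp (measurable_powR_expR (- a) 1)).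
    exact: mulrl_measurable.
rewrite h; last 2 first.
- by apply/measurable_EFinP; exact: measurable_powR_expR.
- by move=> x _; rewrite lee_fin.
rewrite IE -!EFinM; congr EFin.
(* the factor l^a comes from the power, the factor l^-1 from the change of
   variable *)
rewrite powRB ?(gt_eqF l0) ?implybT// powRr1 ?ltW//.
by rewrite /=; field; rewrite gt_eqF.
Qed.

(** Write (1 - exp (- x l)) / x as the integral of exp (- x v) over v in ]0, l],
    exchange the integrals, and apply the Laplace representation of v^(s-1). *)
Lemma bernstein_powR (s G : R) : 0 < s < 1 -> 0 < G ->
  (forall l, 0 < l ->
    (\int[mu]_(x in `]0%R, +oo[) (x `^ (- s) * expR (- (x * l)))%:E
      = (G * l `^ (s - 1))%:E)%E) ->
  forall l, 0 <= l ->
  (\int[mu]_(x in `]0%R, +oo[) ((1 - expR (- (x * l))) * x `^ (- s - 1))%:E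
    = (G / s * l `^ s)%:E)%E.
Proof.
move=> /andP[s0 s1] G0 HG l; rewrite le_eqVlt => /predU1P[<-|l0].
  rewrite integral0_eq; first by rewrite powR0 ?gt_eqF// mulr0.
  by move=> x _; rewrite mulr0 oppr0 expR0 subrr mul0r.
have inner (x : R) : 0 < x ->
  (((1 - expR (- (x * l))) * x `^ (- s - 1))%:E =
   \int[mu]_(v in `]0%R, l]) (x `^ (- s) * expR (- (v * x)))%:E)%E.
  move=> x0; rewrite integral_itv_obnd_cbnd; last first.
    apply/measurable_EFinP/measurable_funTS; apply: measurable_funM => //.
    exact: measurable_expRN.
  pose F (v : R) := - x `^ (- s - 1) * expR (- (v * x)).
  transitivity ((F l - F 0)%:E).
    by rewrite /F mul0r oppr0 expR0; congr EFin; rewrite [l * x]mulrC; ring.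
  apply/esym; apply: (@integral_itv_derive _ F) => //.
  - move=> v _; rewrite [X in is_derive _ _ _ X](_ : _ =
      - x `^ (- s - 1) * (- x * expR (- (v * x)))); last first.
      rewrite mulrA; congr (_ * _).
      rewrite mulrNN powRB ?(gt_eqF x0) ?implybT// powRr1 ?ltW//.
      by rewrite mulfVK ?gt_eqF.
    exact: (is_deriveZ (- x `^ (- s - 1)) (is_derive_expRN x v)).
  - move=> v _; apply: cvgM; first exact: cvg_cst.
    exact: continuous_expRN.
transitivity (\int[mu]_(x in `]0%R, +oo[) \int[mu]_(v in `]0%R, l])
    (x `^ (- s) * expR (- (v * x)))%:E)%E.
  by apply: eq_integral => x; rewrite inE/= in_itv/= andbT => x0; rewrite inner.
rewrite (@ge0_integral_swap _ _ _ _ _ mu mu _ _ (fun x v => x `^ (- s) * expR (- (v * x))))//.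
- transitivity (\int[mu]_(v in `]0%R, l]) (G%:E * (v `^ (s - 1))%:E))%E.
    apply: eq_integral => v; rewrite inE/= in_itv/= => /andP[v0 _].
    rewrite -EFinM -HG//; apply: eq_integral => x _.
    by rewrite mulrC [v * x]mulrC mulrC.
  rewrite ge0_integralZl_EFin ?(ltW G0)//.
  + by rewrite integral_powR0// -EFinM; congr EFin; ring.
  + by move=> x _; rewrite lee_fin powR_ge0.
  + by apply/measurable_EFinP/measurable_funTS; exact: measurable_powR.
- apply: measurable_funM.
    by apply: measurable_fun_powR; exact: measurable_fst.
  apply: measurable_fun_expR; apply: measurable_fun_opp.
  by apply: measurable_funM; [exact: measurable_snd|exact: measurable_fst].
- by move=> x y _ _; rewrite mulr_ge0 ?powR_ge0 ?expR_ge0.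
Qed.

End laplace.

(** * Gauss-positive functions *)
Section measurable_mixture.
Context d1 d2 (X : measurableType d1) (Y : measurableType d2) (R : realType).
Variable nu : {sigma_finite_measure set Y -> \bar R}.

Lemma measurable_mixture (D : set Y) (H : X -> R) (h : X * Y -> R) :
  measurable D -> measurable_fun setT h ->
  (forall x y, D y -> 0 <= h (x, y)) ->
  (forall x, (\int[nu]_(y in D) (h (x, y))%:E = (H x)%:E)%E) ->
  measurable_fun setT H.
Proof.
move=> mD mh h0 hH.
pose f (z : X * Y) : \bar R := (h z * \1_D z.2)%:E.
have mf : measurable_fun setT f.
  apply/measurable_EFinP; apply: measurable_funM => //.
  exact: measurableT_comp.
have f0 z : (0 <= f z)%E.
  rewrite /f indicE lee_fin; case: z => x y /=.
  have [/set_mem Dy|_] := boolP (y \in D); last by rewrite mulr0.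
  by rewrite mulr1 h0.
apply/measurable_EFinP.
rewrite (_ : EFin \o H = fubini_F nu f).
  exact: measurable_fun_fubini_tonelli_F.
apply/funext => x; rewrite /= -hH integral_mkcond; apply: eq_integral => y _.
by rewrite patchE /f /= indicE; case: ifPn => _; rewrite ?mulr1// mulr0.
Qed.

End measurable_mixture.

Section gauss_positive.
Context d (X : measurableType d) (R : realType).
Variable mu : {sigma_finite_measure set X -> \bar R}.
Variables lam k : X -> R.
Hypotheses (mlam : measurable_fun setT lam) (lam_ge0 : forall x, 0 <= lam x).
Hypothesis mk : measurable_fun setT k.
Hypothesis ik : forall tau, 0 < tau ->
  mu.-integrable setT (fun x => (k x * expR (- (tau * lam x)))%:E).
Hypothesis k_ge0 : forall tau, 0 < tau ->
  (0 <= \int[mu]_x (k x * expR (- (tau * lam x)))%:E)%E.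

(** The weights exp (- tau lam) are part of the definition, and not only their
    limit tau = 0, because multiplying by a mixture of the exp (- a lam) then stays
    inside the class: it merely shifts tau.  Boundedness makes every integral
    converge absolutely, k being integrable against each weight. *)
Definition gauss_positive (f : X -> R) := [/\ measurable_fun setT f,
  exists M, forall x, `|f x| <= M &
  forall tau, 0 < tau ->
    (0 <= \int[mu]_x (k x * expR (- (tau * lam x)) * f x)%:E)%E].

Lemma measurable_gauss_weight tau :
  measurable_fun setT (fun x => k x * expR (- (tau * lam x))).
Proof.
apply: measurable_funM => //; apply: measurable_fun_expR.
by apply: measurable_fun_opp; exact: measurable_funM.
Qed.

Lemma integrable_gauss_bounded (f : X -> R) (M tau : R) : 0 < tau ->
  measurable_fun setT f -> (forall x, `|f x| <= M) ->
  mu.-integrable setT (fun x => (k x * expR (- (tau * lam x)) * f x)%:E).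
Proof.
move=> tau0 mf fM.
apply: (@le_integrable _ _ _ mu setT measurableT _
  (fun x => M%:E * (k x * expR (- (tau * lam x)))%:E)%E).
- apply/measurable_EFinP; apply: measurable_funM => //.
  exact: measurable_gauss_weight.
- move=> x _; rewrite -EFinM !abse_EFin lee_fin [leLHS]normrM.
  by rewrite [leRHS]normrM [leRHS]mulrC ler_wpM2l// (le_trans (fM x))// ler_norm.
- exact/integrableZl/ik.
Qed.

Lemma gauss_positive1 : gauss_positive (cst 1).
Proof.
split => //; first by exists 1 => x; rewrite /cst normr1.
by move=> tau /k_ge0; under [in X in X -> _]eq_integral do rewrite -[_ * _]mulr1.
Qed.

Lemma gauss_positiveD f g :
  gauss_positive f -> gauss_positive g -> gauss_positive (f \+ g).
Proof.
move=> [mf [M fM] f0] [mg [N gN] g0]; split.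
- exact: measurable_funD.
- by exists (M + N) => x; rewrite (le_trans (ler_normD _ _))// lerD.
- move=> tau tau0; under eq_integral do rewrite mulrDr EFinD.
  rewrite integralD//; first by apply: adde_ge0; [exact: f0|exact: g0].
    exact: integrable_gauss_bounded fM.
  exact: integrable_gauss_bounded gN.
Qed.

Lemma gauss_positiveZ (a : R) f :
  0 <= a -> gauss_positive f -> gauss_positive (fun x => a * f x).
Proof.
move=> a0 [mf [M fM] f0]; split.
- exact: measurable_funM.
- by exists (a * M) => x; rewrite normrM ger0_norm// ler_wpM2l.
- move=> tau tau0; under eq_integral do rewrite mulrCA EFinM.
  rewrite integralZl//; first by rewrite mule_ge0// f0.
  exact: integrable_gauss_bounded fM.
Qed.

Lemma gauss_positive_lim (f_ : nat -> X -> R) (f : X -> R) (M : R) :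
  (forall n, gauss_positive (f_ n)) -> (forall n x, `|f_ n x| <= M) ->
  (forall x, f_ n x @[n --> \oo] --> f x) -> gauss_positive f.
Proof.
move=> gpf fM fcvg.
have mf : measurable_fun setT f.
  apply: (@measurable_fun_cvg _ _ _ _ f_) => //.
  by move=> n; have [] := gpf n.
have fM' x : `|f x| <= M.
  have h : `|f_ n x| @[n --> \oo] --> `|f x| by apply: cvg_norm; exact: fcvg.
  rewrite -(cvg_lim _ h)//; apply: limr_le; first exact: cvgP h.
  exact: nearW.
split => //; first by exists M.
move=> tau tau0.
have hc : (\int[mu]_x (k x * expR (- (tau * lam x)) * f_ n x)%:E
    @[n --> \oo] --> \int[mu]_x (k x * expR (- (tau * lam x)) * f x)%:E)%E.
  apply: (@dominated_cvg _ _ _ mu setT measurableT _ _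
    (fun x => `|M%:E * (k x * expR (- (tau * lam x)))%:E|%E)).
  - move=> n; apply/measurable_EFinP; apply: measurable_funM.
      exact: measurable_gauss_weight.
    by have [] := gpf n.
  - move=> x _; apply: cvg_EFin; first exact: nearW.
    by apply: cvgM; [exact: cvg_cst|exact: fcvg].
  - by [].
  - exact/integrable_abse/integrableZl/ik.
  - move=> n x _; rewrite -EFinM !abse_EFin lee_fin [leLHS]normrM.
    rewrite [leRHS]normrM [leRHS]mulrC ler_wpM2l//.
    by rewrite (le_trans (fM n x))// ler_norm.
rewrite -(cvg_lim _ hc)//; apply: lime_ge; first exact: cvgP hc.
by apply: nearW => n; have [_ _] := gpf n; apply.
Qed.

(** For fixed a, the weight exp (- a lam) is absorbed into exp (- tau lam); the
    integral over a of nonnegative quantities is nonnegative. *)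
Lemma gauss_positive_mixture (D : set R) (w : R -> R) (U f : X -> R) (C : R) :
  measurable D -> measurable_fun setT w -> (forall a, D a -> 0 <= a) ->
  (forall a, D a -> 0 <= w a) ->
  (forall x, (\int[lebesgue_measure]_(a in D) (w a * expR (- (a * lam x)))%:E =
     (U x)%:E)%E) ->
  (forall x, `|U x| <= C) ->
  gauss_positive f -> gauss_positive (fun x => U x * f x).
Proof.
move=> mD mw D0 w0 UE UC [mf [M fM] f0].
pose h (z : X * measurableTypeR R) := w z.2 * expR (- (z.2 * lam z.1)).
have mh : measurable_fun setT h.
  apply: measurable_funM; first by apply: (measurableT_comp mw); exact: measurable_snd.
  apply: measurable_fun_expR; apply: measurable_fun_opp; apply: measurable_funM.
    exact: measurable_snd.
  exact: measurableT_comp.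
have h0 x y : D y -> 0 <= h (x, y).
  by move=> Dy; rewrite mulr_ge0 ?w0 ?expR_ge0.
have mU : measurable_fun setT U.
  exact: (measurable_mixture (nu := lebesgue_measure) mD mh h0 UE).
have bUf x : `|U x * f x| <= C * M by rewrite normrM ler_pM.
split; first exact: measurable_funM.
  by exists (C * M).
move=> tau tau0.
under eq_integral do rewrite [U _ * _]mulrC mulrA.
apply: (@integral_mixture_ge0 _ _ X (measurableTypeR R) R mu lebesgue_measure D
  (fun x => k x * expR (- (tau * lam x)) * f x) U h) => //.
- by apply: measurable_funM => //; exact: measurable_gauss_weight.
- by move=> x _; rewrite -UE.
- have := integrable_gauss_bounded tau0 (measurable_funM mU mf) bUf.
  by apply: eq_integrable => // x _; congr EFin => /=; ring.
- move=> a Da; rewrite /h /=.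
  under eq_integral => x _.
    rewrite (_ : _ * _ = w a * (k x * expR (- ((tau + a) * lam x)) * f x)); last first.
      rewrite mulrDl opprD expRD; ring.
    rewrite EFinM; over.
  have ta : 0 < tau + a by rewrite ltr_wpDr// D0.
  rewrite integralZl//; last exact: integrable_gauss_bounded fM.
  by rewrite mule_ge0 ?lee_fin ?w0// f0.
Qed.

(** The partial sums of the exponential series of U lie in the class, by stability
    under products with U, and they increase to expR U, which bounds them. *)
Lemma gauss_positive_expR (U : X -> R) (C : R) :
  (forall x, 0 <= U x <= C) ->
  (forall f, gauss_positive f -> gauss_positive (fun x => U x * f x)) ->
  gauss_positive (fun x => expR (U x)).
Proof.
move=> U0C gpU.
have gpX n : gauss_positive (fun x => U x ^+ n).
  elim: n => [|n IH]; first exact: gauss_positive1.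
  under eq_fun do rewrite exprS; exact: gpU.
have gpS n : gauss_positive (fun x => series (exp_coeff (U x)) n).
  elim: n => [|n IH].
    rewrite (_ : (fun _ => _) = fun x => 0 * (cst 1 : X -> R) x); last first.
      by apply/funext => x; rewrite mul0r /series/= big_geq.
    exact/gauss_positiveZ/gauss_positive1.
  rewrite (_ : (fun _ => _) = (fun x => series (exp_coeff (U x)) n) \+
     (fun x => n`!%:R^-1 * U x ^+ n)); last first.
    by apply/funext => x /=; rewrite /series /= big_nat_recr//= /exp_coeff/= mulrC.
  by apply: gauss_positiveD => //; apply: gauss_positiveZ.
have ndS x : nondecreasing_seq (series (exp_coeff (U x))).
  apply/nondecreasing_seqP => n; rewrite /series/= big_nat_recr//= lerDl.
  by rewrite /exp_coeff/= divr_ge0 ?exprn_ge0//; have /andP[] := U0C x.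
apply: (@gauss_positive_lim _ _ (expR C) gpS) => [n x|x].
  rewrite ger0_norm; last first.
    rewrite /series/= sumr_ge0// => i _; rewrite /exp_coeff/=.
    by rewrite divr_ge0 ?exprn_ge0//; have /andP[] := U0C x.
  have /andP[_ UC] := U0C x; rewrite (@le_trans _ _ (expR (U x))) ?ler_expR//.
  apply: nondecreasing_cvgn_le => //; exact: is_cvg_series_exp_coeff.
exact: is_cvg_series_exp_coeff.
Qed.

(** Compound Poisson approximation of the one-sided stable law.  Restricting the
    Levy measure w(a) da = a^(-s-1) da to a > 1/(m+1) makes its mass L finite, and
    exp (- q phi) = exp (- q L) exp (q (L - phi)), where L - phi is the Laplace
    transform of the restricted measure, a mixture of the exp (- a lam). *)
Lemma stable_gauss_positive (s t : R) : 0 < s < 1 -> 0 <= t ->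
  gauss_positive (fun x => expR (- (t * lam x `^ s))).
Proof.
move=> s01 t0; have [s0 s1] := andP s01.
have [G G0 HG] := laplace_powR s01.
have HB := bernstein_powR s01 G0 HG.
have B0 : 0 < G / s by rewrite divr_gt0.
pose w (a : R) := a `^ (- s - 1).
have mw : measurable_fun setT w by exact: measurable_fun_powR.
pose D m : set R := [set` `]m.+1%:R^-1, +oo[].
have mD m : measurable (D m : set (measurableTypeR R)) by exact: measurable_itv.
have D_gt0 m a : D m a -> 0 < a.
  by rewrite /D/= in_itv/= andbT; apply: lt_trans; rewrite invr_gt0.
have UD : \bigcup_m D m = [set` `]0%R, +oo[].
  apply/seteqP; split => a /=.
    by move=> [m _ /D_gt0]; rewrite in_itv/= andbT.
  rewrite in_itv/= andbT => a0.
  have [m] := ltr_add_invr a0; rewrite add0r => ma.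
  by exists m => //; rewrite /D/= in_itv/= andbT.
have ndD : nondecreasing_seq D.
  move=> m n mn; apply/subsetPset => a; rewrite /D/= !in_itv/= !andbT.
  by apply: le_lt_trans; rewrite lef_pV2 ?posrE// ler_nat.
have mb l : measurable_fun setT (fun a : R => ((1 - expR (- (a * l))) * w a)%:E).
  apply/measurable_EFinP; apply: measurable_funM => //.
  by apply: measurable_funB => //; exact: measurable_expRN.
have b0 l a : 0 <= l -> 0 < a -> 0 <= (1 - expR (- (a * l))) * w a.
  move=> l0 a0; rewrite mulr_ge0 ?powR_ge0// subr_ge0 -expR0 ler_expR oppr_le0.
  by rewrite mulr_ge0// ltW.
have phi_cvg l : 0 <= l ->
    (\int[lebesgue_measure]_(a in D m) ((1 - expR (- (a * l))) * w a)%:E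
      @[m --> \oo] --> (G / s * l `^ s)%:E)%E.
  move=> l0; rewrite -HB// -UD; apply: ge0_nondecreasing_set_cvg_integral => //.
  - by move=> m; apply: measurable_funTS; exact: mb.
  - by move=> m a /D_gt0 a0; rewrite lee_fin b0.
pose phi m l := fine (\int[lebesgue_measure]_(a in D m)
  ((1 - expR (- (a * l))) * w a)%:E)%E.
have phiE m l : 0 <= l -> (\int[lebesgue_measure]_(a in D m)
    ((1 - expR (- (a * l))) * w a)%:E = (phi m l)%:E)%E.
  move=> l0; rewrite /phi fineK// ge0_fin_numE; last first.
    by apply: integral_ge0 => a /D_gt0 a0; rewrite lee_fin b0.
  apply: le_lt_trans (ltry (G / s * l `^ s)); rewrite -HB//.
  apply: ge0_subset_integral => //.
  - apply: measurable_funTS; exact: mb.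
  - by move=> a; rewrite /= in_itv/= andbT => a0; rewrite lee_fin b0.
  - by move=> a /D_gt0; rewrite /= in_itv/= andbT.
(* on D m the factor 1 - exp (- a) is bounded below, so the mass of the
   truncated Levy measure is controlled by its Bernstein integral at 1 *)
have Lfin m : (\int[lebesgue_measure]_(a in D m) (w a)%:E < +oo)%E.
  pose c : R := (1 - expR (- (m.+1%:R^-1 * 1)))^-1.
  have c0 : 0 < c by rewrite invr_gt0 subr_gt0 -[ltRHS]expR0 ltr_expR mulr1 oppr_lt0 invr_gt0.
  apply: (@le_lt_trans _ _ (\int[lebesgue_measure]_(a in D m)
      (c%:E * ((1 - expR (- (a * 1))) * w a)%:E))%E).
    apply: ge0_le_integral => //.
    - by move=> a _; rewrite lee_fin powR_ge0.
    - by apply/measurable_EFinP/measurable_funTS.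
    - by apply: measurable_funeM; apply: measurable_funTS; exact: mb.
    - move=> a Da; rewrite -EFinM lee_fin mulrA ler_peMl ?powR_ge0//.
      move: c0; rewrite /c invr_gt0 => d0.
      rewrite mulrC ler_pdivlMr// mul1r lerD2l lerN2 ler_expR lerN2.
      by rewrite !mulr1; move: Da; rewrite /D/= in_itv/= andbT => /ltW.
  rewrite ge0_integralZl_EFin ?(ltW c0)//.
  - by rewrite phiE// -EFinM ltry.
  - by move=> a /D_gt0 a0; rewrite lee_fin b0.
  - apply: measurable_funTS; exact: mb.
pose L m := fine (\int[lebesgue_measure]_(a in D m) (w a)%:E)%E.
have LE m : (\int[lebesgue_measure]_(a in D m) (w a)%:E = (L m)%:E)%E.
  rewrite /L fineK// ge0_fin_numE//.
  by apply: integral_ge0 => a _; rewrite lee_fin powR_ge0.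
have UE m l : 0 <= l -> (\int[lebesgue_measure]_(a in D m)
    (w a * expR (- (a * l)))%:E = (L m - phi m l)%:E)%E.
  move=> l0; rewrite EFinB -LE -phiE// -integralB//.
  - by apply: eq_integral => a _; rewrite -EFinB; congr EFin; ring.
  - apply/integrableP; split; first by apply/measurable_EFinP/measurable_funTS.
    by under eq_integral do rewrite gee0_abs ?lee_fin ?powR_ge0//.
  - apply/integrableP; split.
    by apply: measurable_funTS; exact: mb.
    under eq_integral => a /set_mem /D_gt0 a0 do
      rewrite gee0_abs ?lee_fin ?b0//.
    by rewrite phiE// ltry.
have U0 m l : 0 <= l -> 0 <= L m - phi m l.
  move=> l0; rewrite -lee_fin -UE//; apply: integral_ge0 => a _.
  by rewrite lee_fin mulr_ge0 ?powR_ge0 ?expR_ge0.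
have phi0 m l : 0 <= l -> 0 <= phi m l.
  move=> l0; rewrite -lee_fin -phiE//; apply: integral_ge0 => a /D_gt0 a0.
  by rewrite lee_fin b0.
(* q normalises Bernstein's formula: t l^s = q (G / s * l^s) *)
pose q := t / (G / s).
have q0 : 0 <= q by rewrite divr_ge0 ?(ltW B0).
apply: (@gauss_positive_lim (fun m x => expR (- (q * phi m (lam x)))) _ 1).
- move=> m.
  rewrite (_ : (fun _ => _) = (fun x => expR (- (q * L m)) *
      expR (q * (L m - phi m (lam x))))); last first.
    by apply/funext => x; rewrite -expRD; congr expR; ring.
  apply: gauss_positiveZ; first exact: expR_ge0.
  apply: (@gauss_positive_expR _ (q * L m)).
    move=> x; rewrite mulr_ge0 ?U0//= ler_wpM2l// gerBl.
    exact: phi0.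
  move=> f gpf.
  rewrite (_ : (fun _ => _) = (fun x => q * ((L m - phi m (lam x)) * f x))); last first.
    by apply/funext => x; rewrite mulrA.
  apply: gauss_positiveZ => //.
  apply: (@gauss_positive_mixture (D m) w _ _ (L m)) => //.
  + exact: mD.
  + by move=> a /D_gt0 /ltW.
  + by move=> a _; exact: powR_ge0.
  + by move=> x; rewrite UE.
  + by move=> x; rewrite ger0_norm ?U0// gerBl phi0.
- by move=> m x; rewrite ger0_norm ?expR_ge0// -expR0 ler_expR oppr_le0 mulr_ge0 ?phi0.
- move=> x; apply: continuous_cvg; first exact: continuous_expR.
  apply: cvgN; rewrite (_ : t * _ = q * (G / s * lam x `^ s)); last first.
    by rewrite /q; field; rewrite !gt_eqF.
  apply: cvgM; first exact: cvg_cst.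
  by have := phi_cvg _ (lam_ge0 x) => /fine_cvg.
Qed.

End gauss_positive.

(** * Integration over R^n *)
Section lebesgue_rV_theory.
Context {R : realType}.
Local Notation leb := (@lebesgue_measure R).
Local Notation B n := (@borel_lebesgue R n).

(** The identity, viewed as a map from R^n with its Lebesgue measurable sets to R^n
    with its Borel sets; it carries measurability and integrals of Borel functions
    across the two structures. *)
Definition to_borel n : caratheodory_type (B n)^*%mu -> 'rV[R]_n := id.

Lemma measurable_to_borel n : measurable_fun setT (@to_borel n).
Proof.
move=> _ A mA; rewrite setTI.
by apply: sub_caratheodory; apply: sub_sigma_algebra.
Qed.

Lemma ge0_integral_lebesgue_rV n (f : 'rV[R]_n -> \bar R) :
  measurable_fun setT f -> (forall x, 0 <= f x)%E ->
  (\int[@lebesgue_rV R n]_x f x = \int[B n]_x f x)%E.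
Proof.
move=> mf f0.
have := @ge0_integral_pushforward _ _ _ _ R (@to_borel n) (@measurable_to_borel n)
  (@lebesgue_rV R n) setT f measurableT mf.
rewrite preimage_setT => <- //.
apply: eq_measure_integral => [|m A mA _]; first exact: measurable_to_borel.
exact: measurable_mu_extE.
Qed.

Lemma integral_lebesgue_rV n (f : 'rV[R]_n -> \bar R) :
  measurable_fun setT f ->
  (\int[@lebesgue_rV R n]_x f x = \int[B n]_x f x)%E.
Proof.
move=> mf; rewrite integralE [RHS]integralE.
congr (_ - _)%E; apply: ge0_integral_lebesgue_rV => //.
- exact: measurable_funepos.
- exact: measurable_funeneg.
Qed.

Lemma consr0 n (x : R) (v : 'rV[R]_n) : consr (x, v) ord0 ord0 = x.
Proof. by rewrite mxE unlift_none. Qed.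

Lemma consr_lift n (x : R) (v : 'rV[R]_n) j :
  consr (x, v) ord0 (lift ord0 j) = v ord0 j.
Proof. by rewrite mxE liftK. Qed.

Lemma dotr_consr n (x y : R) (v w : 'rV[R]_n) :
  dotr (consr (x, v)) (consr (y, w)) = x * y + dotr v w.
Proof.
rewrite /dotr big_ord_recl !consr0; congr (_ + _).
by apply: eq_bigr => i _; rewrite !consr_lift.
Qed.

Lemma dotr_rV0 (v w : 'rV[R]_0) : dotr v w = 0.
Proof. by rewrite /dotr big_ord0. Qed.

Lemma dotr_ge0 n (v : 'rV[R]_n) : 0 <= dotr v v.
Proof. by apply: sumr_ge0 => i _; rewrite -expr2 sqr_ge0. Qed.

Lemma measurable_fun_dotr n d (T : measurableType d) (f g : T -> 'rV[R]_n) :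
  measurable_fun setT f -> measurable_fun setT g ->
  measurable_fun setT (fun x => dotr (f x) (g x)).
Proof.
move=> mf mg; apply: measurable_sum => i; apply: measurable_funM.
  exact: (measurableT_comp (@measurable_coord R n i) mf).
exact: (measurableT_comp (@measurable_coord R n i) mg).
Qed.

Lemma ge0_integral_cons n (f : 'rV[R]_n.+1 -> \bar R) :
  measurable_fun setT f -> (forall x, 0 <= f x)%E ->
  (\int[B n.+1]_x f x = \int[B n]_v \int[leb]_x f (consr (x, v)))%E.
Proof.
move=> mf f0.
have := @ge0_integral_pushforward _ _ _ _ R (@consr R n) (@measurable_consr R n)
  (leb \x B n)%E setT f measurableT mf.
rewrite preimage_setT /= => -> //.
rewrite (fubini_tonelli2 (f \o @consr R n))//.
  exact: (measurableT_comp mf (@measurable_consr R n)).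
by move=> p /=.
Qed.

Lemma integrable_cons n (f : 'rV[R]_n.+1 -> \bar R) :
  (B n.+1).-integrable setT f ->
  (leb \x B n)%E.-integrable setT (f \o @consr R n).
Proof.
move=> /integrableP[mf fi]; apply/integrableP; split.
  exact: (measurableT_comp mf (@measurable_consr R n)).
apply: le_lt_trans fi.
have := @ge0_integral_pushforward _ _ _ _ R (@consr R n) (@measurable_consr R n)
  (leb \x B n)%E setT (abse \o f) measurableT.
rewrite preimage_setT /= => <- //.
exact: measurableT_comp.
Qed.

Lemma integral_cons n (f : 'rV[R]_n.+1 -> \bar R) :
  (B n.+1).-integrable setT f ->
  (\int[B n.+1]_x f x = \int[B n]_v \int[leb]_x f (consr (x, v)))%E.
Proof.
move=> fi; have fci := integrable_cons fi.
have mf := measurable_int _ fi.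
have := @integral_pushforward _ _ _ _ R (@consr R n) (@measurable_consr R n)
  (leb \x B n)%E setT f mf.
rewrite preimage_setT /= => -> //.
by rewrite -(integral21_prod_meas1 fci).
Qed.

Lemma ge0_integral_tensor n (f : R -> R) (g : 'rV[R]_n -> R) :
  measurable_fun setT f -> measurable_fun setT g ->
  (forall x, 0 <= f x) -> (forall v, 0 <= g v) ->
  (\int[B n.+1]_z (f (z ord0 ord0) * g (unconsr z).2)%:E =
   (\int[leb]_x (f x)%:E) * \int[B n]_v (g v)%:E)%E.
Proof.
move=> mf mg f0 g0; rewrite ge0_integral_cons//; first last.
- by move=> z; rewrite lee_fin mulr_ge0.
- apply/measurable_EFinP; apply: measurable_funM.
    exact: (measurableT_comp mf (@measurable_coord R n.+1 ord0)).
  apply: (measurableT_comp mg).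
  exact: (measurableT_comp measurable_snd (@measurable_unconsr R n)).
rewrite -ge0_integralZl//.
- apply: eq_integral => v _; rewrite -ge0_integralZr//.
  + by apply: eq_integral => x _; rewrite consrK consr0 /= EFinM.
  + exact/measurable_EFinP.
  + by move=> x _; rewrite lee_fin.
  + by rewrite lee_fin.
- exact/measurable_EFinP.
- by move=> x _; rewrite lee_fin.
- by apply: integral_ge0 => x _; rewrite lee_fin.
Qed.

(** A product of one-dimensional integrable functions that dominates all the
    radial profiles in use, which spares the use of polar coordinates. *)
Definition cauchy_prod n (v : 'rV[R]_n) : R :=
  \prod_(i < n) (1 + v ord0 i ^+ 2)^-1.

Lemma cauchy_prod_ge0 n (v : 'rV[R]_n) : 0 <= cauchy_prod v.
Proof.
by apply: prodr_ge0 => i _; rewrite invr_ge0 addr_ge0// sqr_ge0.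
Qed.

Lemma measurable_cauchy_prod n : measurable_fun setT (@cauchy_prod n).
Proof.
apply: measurable_prod => i _.
apply: (measurableT_comp (f := fun x : R => (1 + x ^+ 2)^-1)).
  apply: continuous_measurable_fun; exact: (@continuous_oneDsqrV R).
exact: measurable_coord.
Qed.

Lemma integral_cauchy : (\int[leb]_x ((1 + x ^+ 2)^-1)%:E < +oo)%E.
Proof.
rewrite ge0_symfun_integralT.
- rewrite (_ : [set x | _] = `[0, +oo[%classic); last first.
    by apply/seteqP; split => x/=; rewrite in_itv/= andbT.
  by have := @integral0y_oneDsqr R; rewrite /oneDsqr => ->; rewrite -EFinM ltry.
- by move=> x; rewrite invr_ge0 addr_ge0// sqr_ge0.
- exact: (@continuous_oneDsqrV R).
- by move=> x /=; rewrite sqrrN.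
Qed.

Lemma integral_cauchy_prod n : (\int[B n]_v (cauchy_prod v)%:E < +oo)%E.
Proof.
elim: n => [|n IH].
  rewrite /= (_ : (fun v => _) = cst 1%E); last first.
    by apply/funext => v; rewrite /cauchy_prod big_ord0.
  rewrite integral_cst//= mul1e diracE; by case: (_ \in _); rewrite ltry.
pose f (x : R) := (1 + x ^+ 2)^-1.
have mf : measurable_fun setT f.
  by apply: continuous_measurable_fun; exact: (@continuous_oneDsqrV R).
have f0 x : 0 <= f x by rewrite invr_ge0 addr_ge0// sqr_ge0.
have := ge0_integral_tensor mf (@measurable_cauchy_prod n) f0 (@cauchy_prod_ge0 n).
rewrite (eq_integral (fun v => (cauchy_prod v)%:E)); last first.
  move=> v _; congr EFin; rewrite /cauchy_prod big_ord_recl; congr (_ * _).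
  by apply: eq_bigr => i _; rewrite mxE.
have If0 : (0 <= \int[leb]_x (f x)%:E)%E.
  by apply: integral_ge0 => x _; rewrite lee_fin.
move=> ->; apply: lte_mul_pinfty => //.
by rewrite ge0_fin_numE// integral_cauchy.
Qed.

Lemma integrable_cauchy_prod n : (B n).-integrable setT (EFin \o @cauchy_prod n).
Proof.
apply/integrableP; split.
  by apply/measurable_EFinP; exact: measurable_cauchy_prod.
under eq_integral do rewrite gee0_abs ?lee_fin ?cauchy_prod_ge0//.
exact: integral_cauchy_prod.
Qed.

End lebesgue_rV_theory.

(** * Integrals over the line *)
Section line_integrals.
Context {R : realType}.
Local Notation leb := (@lebesgue_measure R).

(** Only the limits along integers are assumed: integrability of f makes the
    integrals over [-n, n] converge to the full one. *)
Lemma integral_derive_line (F f : R -> R) :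
  (forall x : R, is_derive x 1 F (f x)) -> continuous f ->
  leb.-integrable setT (EFin \o f) ->
  F n%:R @[n --> \oo] --> (0 : R) -> F (- n%:R) @[n --> \oo] --> (0 : R) ->
  (\int[leb]_x (f x)%:E = 0)%E.
Proof.
move=> dF cf fi F1 F2.
pose f_ (n : nat) x : \bar R := (f x * \1_[set` `[- n.+1%:R, n.+1%:R]] x)%:E.
have mf : measurable_fun setT f by exact: continuous_measurable_fun.
have h1 : (\int[leb]_x f_ n x @[n --> \oo] --> \int[leb]_x (f x)%:E)%E.
  apply: (@dominated_cvg _ _ _ leb setT measurableT f_ _ (fun x => `|(f x)%:E|%E)).
  - by move=> n; apply/measurable_EFinP; apply: measurable_funM.
  - move=> x _; apply/cvg_EFin; first exact: nearW.
    rewrite -[X in _ --> X]mulr1; apply: cvgM; first exact: cvg_cst.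
    apply: cvg_near_cst; near=> n; rewrite indicE mem_set//= in_itv/= -ler_norml.
    rewrite (@le_trans _ _ n%:R) ?ler_nat//.
    near: n; exact: nbhs_infty_ger.
  - by [].
  - exact: integrable_abse.
  - move=> n x _; rewrite /f_ abse_EFin lee_fin normrM ler_piMr//.
    by rewrite indicE ger0_norm ?ler0n// lern1 leq_b1.
have h2 n : (\int[leb]_x f_ n x = (F n.+1%:R - F (- n.+1%:R))%:E)%E.
  rewrite -(@integral_itv_derive _ F f) => //.
  - rewrite [RHS]integral_mkcond; apply: eq_integral => x _.
    by rewrite /f_ patchE indicE; case: ifPn => _; rewrite ?mulr1// mulr0.
  - by rewrite (@lt_trans _ _ 0)// oppr_lt0.
  - by move=> x _; exact: cf.
have h3 : (\int[leb]_x f_ n x @[n --> \oo] --> 0)%E.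
  under eq_fun do rewrite h2.
  apply: cvg_EFin; first exact: nearW.
  rewrite -[X in _ --> X](subr0 0); apply: cvgB.
    by move: F1; rewrite -cvg_shiftS.
  by move: F2; rewrite -cvg_shiftS.
exact: (cvg_unique _ h1 h3).
Unshelve. all: by end_near. Qed.

Lemma expRN_le_inv1D (y : R) : 0 <= y -> expR (- y) <= (1 + y)^-1.
Proof.
move=> y0; rewrite expRN lef_pV2 ?posrE ?expR_gt0 ?expR_ge1Dx//.
by rewrite ltr_pwDl.
Qed.

Lemma integrable_gauss1 (a : R) : 0 < a ->
  leb.-integrable setT (fun x => (expR (- (a * x ^+ 2)))%:E).
Proof.
move=> a0; pose c := Num.max 1 a^-1.
have c0 : 0 < c by rewrite /c lt_max ltr01.
apply: (@le_integrable _ _ _ leb setT measurableT _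
  (fun x => c%:E * ((1 + x ^+ 2)^-1)%:E)%E).
- apply/measurable_EFinP; apply: measurable_fun_expR; apply: measurable_fun_opp.
  by apply: measurable_funM => //; exact: measurable_funX.
- move=> x _; rewrite -EFinM !abse_EFin lee_fin ger0_norm ?expR_ge0//.
  rewrite ger0_norm; last first.
    by rewrite mulr_ge0 ?(ltW c0)// invr_ge0 addr_ge0// sqr_ge0.
  have x2 : 0 <= x ^+ 2 by exact: sqr_ge0.
  have ax : 0 <= a * x ^+ 2 by apply: mulr_ge0 => //; exact: ltW.
  apply: (le_trans (expRN_le_inv1D ax)).
  have p1 : 0 < 1 + x ^+ 2 by rewrite ltr_pwDl.
  have p2 : 0 < 1 + a * x ^+ 2 by rewrite ltr_pwDl.
  rewrite ler_pdivlMr// mulrC ler_pdivrMr//.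
  rewrite mulrDr mulr1 mulrA lerD//; first by rewrite /c le_max lexx.
  apply: ler_peMl => //; rewrite -(@mulVf _ a) ?gt_eqF// ler_wpM2r ?(ltW a0)//.
  by rewrite le_max lexx orbT.
- apply/integrableZl => //; apply/integrableP; split.
    apply/measurable_EFinP; apply: continuous_measurable_fun.
    exact: (@continuous_oneDsqrV R).
  under eq_integral => x _ do rewrite gee0_abs ?lee_fin ?invr_ge0 ?addr_ge0 ?sqr_ge0//.
  exact: integral_cauchy.
Qed.

Lemma integral_gauss1 (a : R) : 0 < a ->
  (\int[leb]_x (expR (- (a * x ^+ 2)))%:E = (Num.sqrt (pi / a))%:E)%E.
Proof.
move=> a0; pose l := Num.sqrt a.
have l0 : 0 < l by rewrite sqrtr_gt0.
have := @ge0_integral_scale _ l (EFin \o gauss_fun) l0.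
rewrite integralT_gauss => h.
transitivity (\int[leb]_x (EFin \o gauss_fun) (l * x)%R)%E.
  by apply: eq_integral => x _; rewrite /= /gauss_fun exprMn sqr_sqrtr// ltW.
rewrite h.
- by rewrite -EFinM sqrtrM ?pi_ge0// sqrtrV ?(ltW a0)// mulrC.
- by apply/measurable_EFinP; exact: measurable_gauss_fun.
- by move=> x; rewrite lee_fin gauss_fun_ge0.
Qed.

(** Half of the Gaussian exponent absorbs the factor |x|. *)
Lemma gauss1_moment_le (a x : R) : 0 < a ->
  `|x| * expR (- (a * x ^+ 2)) <= (1 + a^-1) * expR (- (a / 2 * x ^+ 2)).
Proof.
move=> a0.
have -> : - (a * x ^+ 2) = - (a / 2 * x ^+ 2) + - (a / 2 * x ^+ 2).
  by field.
rewrite expRD mulrA ler_wpM2r ?expR_ge0//.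
rewrite expRN ler_pdivrMr ?expR_gt0//.
have h := expR_ge1Dx (a / 2 * x ^+ 2).
have a'0 : 0 < a^-1 by rewrite invr_gt0.
rewrite (@le_trans _ _ ((1 + a^-1) * (1 + a / 2 * x ^+ 2)))//; last first.
  by rewrite ler_wpM2l// addr_ge0// ltW.
have -> : (1 + a^-1) * (1 + a / 2 * x ^+ 2) =
    1 + a^-1 + a / 2 * x ^+ 2 + 2^-1 * x ^+ 2 by field; rewrite gt_eqF.
have : 0 <= a / 2 * x ^+ 2 by rewrite mulr_ge0 ?sqr_ge0 ?divr_ge0 ?(ltW a0).
have : 2 * `|x| <= 1 + x ^+ 2.
  rewrite -[x ^+ 2](real_normK (num_real x)).
  by have := sqr_ge0 (1 - `|x|); rewrite sqrrB; nra.
lra.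
Qed.

End line_integrals.

(** * Fourier transform of the Gaussian *)
Section gauss_fourier1.
Context {R : realType}.
Local Notation leb := (@lebesgue_measure R).
Variables (a b : R).
Hypothesis a0 : 0 < a.

Let f (z x : R) : R := expR (- (a * x ^+ 2)) * cos (z * x + b).
Let df (z x : R) : R := - (x * expR (- (a * x ^+ 2)) * sin (z * x + b)).

Lemma is_derive_affine (p q x : R) : is_derive x 1 (fun y : R => y * p + q) p.
Proof.
have h : is_derive x 1 (fun y : R => y * p) p.
  rewrite (_ : (fun y => y * p) = p *: id); last first.
    by apply/funext => y; change (y * p = p * y); rewrite mulrC.
  by rewrite -[X in is_derive _ _ _ X]mulr1; exact: is_deriveZ.
by rewrite -[X in is_derive _ _ _ X]addr0; exact: is_deriveD.
Qed.

Lemma is_derive_sqr (c x : R) :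
  is_derive x 1 (fun y : R => c * y ^+ 2) (2 * c * x).
Proof.
have h : is_derive x 1 (fun y : R => y ^+ 2) (2 * x).
  have h1 : is_derive x 1 ((id : R -> R) ^+ 2) ((2%:R * id x ^+ 1) *: 1) by exact: is_deriveX.
  rewrite (_ : 2 * x = (2%:R * id x ^+ 1) *: 1); last first.
    by rewrite /GRing.scale/= mulr1 expr1.
  by rewrite (_ : (fun y : R => y ^+ 2) = (id : R -> R) ^+ 2).
rewrite (_ : 2 * c * x = c * (2 * x)); last by ring.
exact: (is_deriveZ c h).
Qed.

Lemma is_derive_expR_sqr (c x : R) :
  is_derive x 1 (fun y : R => expR (c * y ^+ 2))
    (2 * c * x * expR (c * x ^+ 2)).
Proof.
by have h := is_derive_sqr c x; rewrite mulrC; exact: is_derive1_comp.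
Qed.

Lemma continuous_expR_sqr (c : R) : continuous (fun y : R => expR (- (c * y ^+ 2))).
Proof.
move=> x; apply: differentiable_continuous; apply/derivable1_diffP.
rewrite (_ : (fun y => _) = (fun y : R => expR (- c * y ^+ 2))); last first.
  by apply/funext => y; rewrite mulNr.
by have [] := is_derive_expR_sqr (- c) x.
Qed.

Lemma continuous_comp_affine (g : R -> R) (p q : R) :
  continuous g -> continuous (fun y : R => g (p * y + q)).
Proof.
move=> cg x; apply: continuous_comp; last exact: cg.
apply: cvgD; last exact: cvg_cst.
by apply: cvgM; [exact: cvg_cst|exact: cvg_id].
Qed.

Let dfE (z x : R) : is_derive z 1 (fun y : R => f y x) (df z x).
Proof.
have h1 := is_derive_affine x b z.
have h2 : is_derive z 1 (fun y : R => cos (y * x + b)) (- sin (z * x + b) * x).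
  exact: is_derive1_comp.
rewrite (_ : df z x = expR (- (a * x ^+ 2)) * (- sin (z * x + b) * x)); last first.
  by rewrite /df; ring.
exact: (is_deriveZ (expR (- (a * x ^+ 2))) h2).
Qed.

Let mf z : measurable_fun setT (f z).
Proof.
apply: measurable_funM.
  apply: measurable_fun_expR; apply: measurable_fun_opp.
  by apply: measurable_funM => //; exact: measurable_funX.
by apply: measurable_fun_cos; apply: measurable_funD => //; apply: measurable_funM.
Qed.

Let integrable_f z : leb.-integrable setT (EFin \o f z).
Proof.
apply: (@le_integrable _ _ _ leb setT measurableT _ _ _ _ (integrable_gauss1 a0)).
- by apply/measurable_EFinP; exact: mf.
- move=> x _; rewrite !abse_EFin lee_fin normrM ler_piMr//.
  by rewrite ler_norml cos_geN1 cos_le1.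
Qed.

Let mdf z : measurable_fun setT (df z).
Proof.
apply: measurable_fun_opp; apply: measurable_funM.
  apply: measurable_funM => //.
  apply: measurable_fun_expR; apply: measurable_fun_opp.
  by apply: measurable_funM => //; exact: measurable_funX.
by apply: measurable_fun_sin; apply: measurable_funD => //; apply: measurable_funM.
Qed.

Let G (x : R) : R := (1 + a^-1) * expR (- (a / 2 * x ^+ 2)).

Let integrable_G : leb.-integrable setT (EFin \o G).
Proof.
rewrite (_ : EFin \o G = (fun x => (1 + a^-1)%:E * (expR (- (a / 2 * x ^+ 2)))%:E)%E)//.
by apply: integrableZl => //; apply: integrable_gauss1; rewrite divr_gt0.
Qed.

Let df_le z x : `|df z x| <= G x.
Proof.
rewrite normrN 2!normrM -[leRHS]mulr1 ler_pM ?mulr_ge0//.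
  by rewrite [`|expR _|]ger0_norm ?expR_ge0//; exact: gauss1_moment_le.
by rewrite ler_norml sin_geN1 sin_le1.
Qed.

Let integrable_df z : leb.-integrable setT (EFin \o df z).
Proof.
apply: (@le_integrable _ _ _ leb setT measurableT _ _ _ _ integrable_G).
- by apply/measurable_EFinP; exact: mdf.
- move=> x _; rewrite !abse_EFin lee_fin (le_trans (df_le z x))// ler_norm//.
Qed.

Let K z := \int[leb]_x f z x.

Let K_derive (z : R) : is_derive z 1 K (\int[leb]_x df z x).
Proof.
have zI : `]z - 1, z + 1[%classic z by rewrite /= in_itv/= gtrBl ltrDl ltr01.
have G0 x : 0 <= G x by rewrite mulr_ge0 ?expR_ge0 ?addr_ge0 ?invr_ge0 ?(ltW a0).
have dE (x y : R) : partial1of2 f x y = df x y.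
  by rewrite partial1of2E; apply: derive_val; exact: dfE.
apply: DeriveDef.
  apply: (@derivable_under_integral R _ _ leb f setT measurableT z (z - 1) (z + 1) zI _ _ G) => //.
  by move=> x y _ _; rewrite dE.
rewrite -derive1E.
rewrite (@differentiation_under_integral R _ _ leb f setT measurableT z (z - 1) (z + 1) zI _ _ G) => //.
- by apply: eq_Rintegral => y _; rewrite dE.
- by move=> x y _ _; rewrite dE.
Qed.

Let cvg_gauss0 : expR (- (a * n%:R ^+ 2)) @[n --> \oo] --> (0 : R).
Proof.
apply: (@cvg_comp _ _ _ (fun n : nat => a * n%:R ^+ 2) (fun x : R => expR (- x)) _ +oo%R); last first.
  exact: cvgr_expR.
have /cvgryPge h := @cvgr_idn R.
apply/cvgryPge => A; apply: filterS (h (A / a)) => n.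
rewrite ler_pdivrMr// => /le_trans; apply; rewrite mulrC ler_wpM2l ?(ltW a0)//.
by rewrite -natrX ler_nat; case: n => // n; rewrite expnS expn1 leq_pmulr.
Qed.

Let K_ode z : \int[leb]_x df z x = - (z / (2 * a)) * K z.
Proof.
pose F (x : R) := expR (- (a * x ^+ 2)) * sin (z * x + b).
(* h is the derivative of F, so its integral vanishes *)
pose h (x : R) := 2 * a * df z x + z * f z x.
have dF (x : R) : is_derive x 1 F (h x).
  have h1 := is_derive_affine z b x.
  have h2 : is_derive x 1 (fun y : R => sin (y * z + b)) (cos (x * z + b) * z).
    exact: is_derive1_comp.
  have h3 := is_deriveM (is_derive_expR_sqr (- a) x) h2.
  rewrite (_ : F = (fun y => expR (- (a * y ^+ 2))) * (fun y : R => sin (y * z + b))); last first.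
    by apply/funext => y; rewrite /F mulrC [z * y]mulrC mulrC.
  apply: is_derive_eq; rewrite /h /df /f /GRing.scale/=.
  by rewrite [x * z]mulrC; ring.
have ch : continuous h.
  move=> x; apply: cvgD; apply: cvgM; try exact: cvg_cst.
  - apply: cvgN; apply: cvgM; last by apply: continuous_comp_affine; exact: continuous_sin.
    apply: cvgM; first exact: cvg_id.
    exact: continuous_expR_sqr.
  - apply: cvgM; first exact: continuous_expR_sqr.
    by apply: continuous_comp_affine; exact: continuous_cos.
have ih : leb.-integrable setT (EFin \o h).
  rewrite (_ : EFin \o h = (fun x => (2 * a)%:E * (EFin \o df z) x) \+ (fun x => z%:E * (EFin \o f z) x))%E//.
  by apply: integrableD => //; apply: integrableZl.
have hF (e : nat -> R) : (forall n, e n ^+ 2 = n%:R ^+ 2) -> F (e n) @[n --> \oo] --> (0 : R).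
  move=> eE; apply: norm_cvg0.
  apply: (squeeze_cvgr (f := cst 0) (h := fun n => expR (- (a * n%:R ^+ 2)))); last 2 first.
  - exact: cvg_cst.
  - exact: cvg_gauss0.
  apply: nearW => n; rewrite normr_ge0/= /F eE normrM ger0_norm ?expR_ge0//.
  by rewrite ler_piMr ?expR_ge0// ler_norml sin_geN1 sin_le1.
have := integral_derive_line dF ch ih (hF _ (fun n => erefl)) (hF _ (fun n => sqrrN _)).
rewrite (_ : (\int[leb]_x (h x)%:E)%E =
  \int[leb]_x ((2 * a)%:E * (EFin \o df z) x + z%:E * (EFin \o f z) x))%E//.
rewrite integralD//; [|exact: integrableZl|exact: integrableZl].
rewrite !integralZl//.
rewrite -(fineK (integrable_fin_num measurableT (integrable_f z))).
rewrite -(fineK (integrable_fin_num measurableT (integrable_df z))).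
rewrite -!EFinM -EFinD => -[]; rewrite -/(Rintegral leb setT (df z)) -/(Rintegral leb setT (f z)) -/(K z).
set I := (X in 2 * a * X + _) => hI.
rewrite -/I; have -> : I = - (z * K z) / (2 * a).
  apply: (@mulfI _ (2 * a)); first by rewrite mulf_neq0// gt_eqF.
  rewrite mulrCA mulfV ?mulr1; last by rewrite mulf_neq0// gt_eqF.
  by apply/eqP; rewrite -addr_eq0 hI.
by field; rewrite gt_eqF.
Qed.

Lemma integrable_gauss1_cos z :
  leb.-integrable setT (fun x => (expR (- (a * x ^+ 2)) * cos (z * x + b))%:E).
Proof. exact: integrable_f. Qed.

(** As a function of z, the integral satisfies K' = - z / (2 a) K, by
    differentiation under the integral and integration by parts, so that
    K(z) exp (z^2 / (4 a)) is constant.  The phase b is carried along to make the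
    induction on the dimension go through. *)
Lemma gauss_fourier1 z : (\int[leb]_x (f z x)%:E =
  (Num.sqrt (pi / a) * expR (- (z ^+ 2 / (4 * a))) * cos b)%:E)%E.
Proof.
pose M z := K z * expR (z ^+ 2 / (4 * a)).
have K0 : K 0 = Num.sqrt (pi / a) * cos b.
  rewrite /K /Rintegral.
  under eq_integral do rewrite /f mul0r add0r mulrC EFinM.
  rewrite integralZl//; last exact: integrable_gauss1.
  by rewrite integral_gauss1// -EFinM mulrC.
have dM (x : R) : is_derive x 1 M 0.
  have h : is_derive x 1 (fun y : R => expR (y ^+ 2 / (4 * a))) (x / (2 * a) * expR (x ^+ 2 / (4 * a))).
    have := is_derive_expR_sqr (4 * a)^-1 x.
    rewrite (_ : (fun y => _) = (fun y : R => expR (y ^+ 2 / (4 * a)))); last first.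
      by apply/funext => y; rewrite mulrC.
    move=> h'; apply: is_derive_eq; rewrite [_^-1 * _]mulrC.
    by congr (_ * _); field; rewrite gt_eqF.
  have := is_deriveM (K_derive x) h.
  rewrite K_ode => h'; apply: is_derive_eq.
  by rewrite /GRing.scale/=; ring.
have := is_derive_0_is_cst z 0 dM.
rewrite /M K0 expr0n /= mul0r expR0 mulr1 => h.
rewrite -(fineK (integrable_fin_num measurableT (integrable_f z))).
congr EFin; rewrite -/(Rintegral leb setT (f z)) -/(K z).
rewrite mulrAC -h expRN mulfK//.
by rewrite gt_eqF// expR_gt0.
Qed.

End gauss_fourier1.

(** * Radial integrands on R^n *)
Section rV_integrals.
Context {R : realType}.
Local Notation leb := (@lebesgue_measure R).
Local Notation B n := (@borel_lebesgue R n).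

Lemma pow_expR_le (m : nat) (t x : R) : 0 < t -> 0 <= x ->
  (1 + x ^+ m) * expR (- (t * x)) <= 1 + m`!%:R / t ^+ m.
Proof.
move=> t0 x0; rewrite mulrDl mul1r lerD//.
  by rewrite -[leRHS]expR0 ler_expR oppr_le0 mulr_ge0 ?(ltW t0).
have tx0 : 0 <= t * x by rewrite mulr_ge0 ?(ltW t0).
have h : (t * x) ^+ m / m`!%:R <= expR (t * x).
  case: m => [|m]; first by rewrite expr0 fact0 divr1 -expR0 ler_expR.
  by rewrite (le_trans _ (expR_ge1Dxn m tx0))// lerDr.
rewrite expRN ler_pdivlMr ?exprn_gt0// mulrAC ler_pdivrMr ?expR_gt0//.
move: h; rewrite ler_pdivrMr ?ltr0n ?fact_gt0// exprMn.
by rewrite mulrC [leRHS]mulrC.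
Qed.

(** With l = |v|^2, the product of the 1 + v_i^2 is at most (1 + l)^n, which the
    power m of l^s dominates as soon as s m >= n; the exponential absorbs that
    power. *)
Lemma stretched_exp_le n (s t : R) : 0 < s -> 0 < t ->
  exists C : R, forall v : 'rV[R]_n,
    expR (- (t * dotr v v `^ s)) <= C * cauchy_prod v.
Proof.
move=> s0 t0.
pose m := (Num.truncn (n%:R / s)).+1.
have nm : n%:R <= s * m%:R.
  by rewrite mulrC -ler_pdivrMr// ltW// truncnS_gt.
exists (2 ^+ n * (1 + m`!%:R / t ^+ m)) => v.
set l := dotr v v; have l0 : 0 <= l by exact: dotr_ge0.
have p0 : 0 < \prod_(i < n) (1 + v ord0 i ^+ 2).
  by apply: prodr_gt0 => i _; rewrite ltr_pwDl// sqr_ge0.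
rewrite /cauchy_prod prodfV ler_pdivlMr//.
have pl : \prod_(i < n) (1 + v ord0 i ^+ 2) <= (1 + l) ^+ n.
  rewrite -[X in (1 + l) ^+ X]card_ord -prodr_const.
  apply: ler_prod => i _; rewrite addr_ge0 ?sqr_ge0//= lerD2l.
  rewrite /l /dotr (bigD1 i)//= expr2 lerDl; apply: sumr_ge0 => j _.
  by rewrite -expr2 sqr_ge0.
apply: (@le_trans _ _ (expR (- (t * l `^ s)) * (1 + l) ^+ n)).
  by rewrite ler_wpM2l ?expR_ge0.
have h : (1 + l) ^+ n <= 2 ^+ n * (1 + (l `^ s) ^+ m).
  have [l1|l1] := leP l 1.
    rewrite (@le_trans _ _ (2 ^+ n))//.
      by rewrite lerXn2r ?nnegrE ?addr_ge0//; lra.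
    by rewrite ler_peMr ?exprn_ge0// lerDl exprn_ge0// powR_ge0.
  rewrite (@le_trans _ _ ((2 * l) ^+ n))//.
    by rewrite lerXn2r ?nnegrE ?addr_ge0 ?mulr_ge0//; lra.
  rewrite exprMn ler_wpM2l ?exprn_ge0//.
  rewrite (@le_trans _ _ ((l `^ s) ^+ m)) ?lerDr//.
  by rewrite -!powR_mulrn ?powR_ge0// -powRrM ler_powR// ltW.
rewrite mulrC (le_trans (ler_wpM2r _ h)) ?expR_ge0//.
by rewrite -mulrA ler_wpM2l ?exprn_ge0// pow_expR_le// powR_ge0.
Qed.

Lemma measurable_fun_sqnorm n : measurable_fun setT (fun v : 'rV[R]_n => dotr v v).
Proof. by apply: measurable_fun_dotr; exact: measurable_id. Qed.

Lemma measurable_stretched n (s t : R) :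
  measurable_fun setT (fun v : 'rV[R]_n => expR (- (t * dotr v v `^ s))).
Proof.
apply: measurable_fun_expR; apply: measurable_fun_opp; apply: measurable_funM => //.
by apply: measurable_fun_powR; exact: measurable_fun_sqnorm.
Qed.

Lemma integrable_stretched n (s t : R) : 0 < s -> 0 < t ->
  (B n).-integrable setT (fun v => (expR (- (t * dotr v v `^ s)))%:E).
Proof.
move=> s0 t0; have [C hC] := stretched_exp_le n s0 t0.
apply: (@le_integrable _ _ _ (B n) setT measurableT _
  (fun v => C%:E * (cauchy_prod v)%:E)%E).
- by apply/measurable_EFinP; exact: measurable_stretched.
- move=> v _; rewrite -EFinM !abse_EFin lee_fin ger0_norm ?expR_ge0//.
  exact: le_trans (hC v) (ler_norm _).
- by apply: integrableZl => //; exact: integrable_cauchy_prod.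
Qed.

Lemma integrable_gauss n (a : R) : 0 < a ->
  (B n).-integrable setT (fun v => (expR (- (a * dotr v v)))%:E).
Proof.
move=> a0; have := integrable_stretched n ltr01 a0.
by apply: eq_integrable => // v _; rewrite powRr1 ?dotr_ge0.
Qed.

Lemma measurable_gauss n (a : R) :
  measurable_fun setT (fun v : 'rV[R]_n => expR (- (a * dotr v v))).
Proof.
apply: measurable_fun_expR; apply: measurable_fun_opp; apply: measurable_funM => //.
exact: measurable_fun_sqnorm.
Qed.

Lemma measurable_phase n (z : 'rV[R]_n) (b : R) :
  measurable_fun setT (fun v : 'rV[R]_n => dotr z v + b).
Proof.
by apply: measurable_funD => //; apply: measurable_fun_dotr => //; exact: measurable_id.
Qed.

Lemma integrable_gauss_cos n (a b : R) (z : 'rV[R]_n) : 0 < a ->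
  (B n).-integrable setT
    (fun v => (expR (- (a * dotr v v)) * cos (dotr z v + b))%:E).
Proof.
move=> a0; apply: (@le_integrable _ _ _ (B n) setT measurableT _ _ _ _ (integrable_gauss n a0)).
- apply/measurable_EFinP; apply: measurable_funM; first exact: measurable_gauss.
  by apply: measurable_fun_cos; exact: measurable_phase.
- move=> v _; rewrite !abse_EFin lee_fin normrM ler_piMr//.
  by rewrite ler_norml cos_geN1 cos_le1.
Qed.

(** One coordinate at a time: the other coordinates enter the inner integral only
    through the phase of the cosine. *)
Lemma gauss_fourier n (a b : R) (z : 'rV[R]_n) : 0 < a ->
  (\int[B n]_v (expR (- (a * dotr v v)) * cos (dotr z v + b))%:E =
   (Num.sqrt (pi / a) ^+ n * expR (- (dotr z z / (4 * a))) * cos b)%:E)%E.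
Proof.
move=> a0; elim: n z b => [|n IH] z b.
  have mf := measurable_int _ (integrable_gauss_cos b z a0).
  rewrite [LHS](integral_dirac _ _ mf)// diracE in_setT mul1e.
  by rewrite !dotr_rV0 mul0r mulr0 oppr0 expR0 add0r expr0 !mul1r.
rewrite integral_cons; last exact: integrable_gauss_cos.
rewrite -(unconsrK z); case: (unconsr z) => z0 z' {z}.
pose c := Num.sqrt (pi / a) * expR (- (z0 ^+ 2 / (4 * a))).
transitivity (\int[B n]_v (c%:E * (expR (- (a * dotr v v)) * cos (dotr z' v + b))%:E))%E.
  apply: eq_integral => v _.
  under eq_integral => x _.
    rewrite !dotr_consr -expr2 mulrDr opprD expRD.
    rewrite [expR _ * expR _]mulrC -mulrA -addrA EFinM; over.
  rewrite integralZl//; last exact: integrable_gauss1_cos.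
  rewrite gauss_fourier1// -!EFinM; congr EFin; rewrite /c; ring.
rewrite integralZl//; last exact: integrable_gauss_cos.
rewrite IH -EFinM dotr_consr -expr2; congr EFin.
rewrite [_ ^+ n.+1]exprS (mulrDl (z0 ^+ 2)) (opprD (z0 ^+ 2 / _)) expRD /c.
ring.
Qed.

End rV_integrals.

(** * Integration by parts in the first coordinate *)
Section radial_ibp.
Context {R : realType}.
Local Notation leb := (@lebesgue_measure R).
Local Notation B n := (@borel_lebesgue R n).

Lemma borel_lebesgue_hyperplane n (c : R) :
  B n.+1 [set v | v ord0 ord0 = c] = 0%E.
Proof.
rewrite /= /lebesgue_cons /pushforward.
have -> : @consr R n @^-1` [set v | v ord0 ord0 = c] = [set c] `*` setT.
  apply/seteqP; split => -[x v] /=; first by rewrite consr0.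
  by move=> [-> _]; rewrite consr0.
have -> := @product_measure1E _ _ _ _ R leb (B n) [set c] setT.
- transitivity (0%:E * B n setT)%E; last exact: mul0e.
  by congr (_ * _)%E; exact: lebesgue_measure_set1.
- exact: measurable_set1.
- exact: measurableT.
Qed.

Lemma measurable_hyperplane n (c : R) :
  measurable [set v : 'rV[R]_n.+1 | v ord0 ord0 = c].
Proof.
have := @measurable_coord R n.+1 ord0 measurableT [set c] (measurable_set1 c).
by rewrite setTI.
Qed.

Lemma sqnorm_eq0 n (v : 'rV[R]_n.+1) : dotr v v = 0 -> v ord0 ord0 = 0.
Proof.
rewrite /dotr big_ord_recl => /eqP; rewrite paddr_eq0.
- by rewrite mulf_eq0 orbb => /andP[/eqP].
- by rewrite -expr2 sqr_ge0.
- by apply: sumr_ge0 => i _; rewrite -expr2 sqr_ge0.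
Qed.

Lemma ae_sqnorm_gt0 n : {ae B n.+1, forall v, 0 < dotr v v}.
Proof.
exists [set v : 'rV[R]_n.+1 | v ord0 ord0 = 0]; split.
- exact: measurable_hyperplane.
- exact: borel_lebesgue_hyperplane.
- move=> v /= /negP; rewrite -leNgt => v0; apply: sqnorm_eq0.
  by apply/eqP; rewrite eq_le v0 dotr_ge0.
Qed.

(** On almost every line parallel to the first axis, the integrand is the
    derivative of x |-> g (x^2 + b) sin (z_0 x + c).  The lines avoid the origin for
    almost every b, which is why g need only be differentiable on ]0, +oo[; this is
    the reason for taking dimension at least two. *)
Lemma radial_ibp n (g dg : R -> R) (z : 'rV[R]_n.+2) :
  (forall l : R, 0 < l -> is_derive l 1 g (dg l)) ->
  (forall l, 0 < l -> {for l, continuous dg}) ->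
  g l @[l --> +oo%R] --> (0 : R) ->
  (B n.+2).-integrable setT
    (fun v => (z ord0 ord0 * (g (dotr v v) * cos (dotr z v)) +
       2 * (v ord0 ord0 * dg (dotr v v) * sin (dotr z v)))%:E) ->
  (\int[B n.+2]_v (z ord0 ord0 * (g (dotr v v) * cos (dotr z v)) +
       2 * (v ord0 ord0 * dg (dotr v v) * sin (dotr z v)))%:E = 0)%E.
Proof.
move=> gdg cdg g0; set H := (fun v => _%:E) => iH.
have mH := measurable_int _ iH.
have iHc := integrable_cons iH.
rewrite -/(integral _ _ H) (integral_cons iH).
rewrite (ae_eq_integral (cst 0%E))//; first by rewrite integral0.
  exact: (measurable_fubini_G iHc).
have := ae_integrable2 iHc; have := ae_sqnorm_gt0 n; apply: filterS2.
move=> v v0 /= iHv _.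
pose z0 := z ord0 ord0; pose z' := (unconsr z).2.
have dz x : dotr z (consr (x, v)) = z0 * x + dotr z' v.
  rewrite -[in LHS](unconsrK z) (_ : unconsr z = (z0, z'))//.
  exact: dotr_consr.
pose b := dotr v v; pose c := dotr z' v.
pose h x := z0 * (g (x ^+ 2 + b) * cos (z0 * x + c)) +
   2 * (x * dg (x ^+ 2 + b) * sin (z0 * x + c)).
have hE x : H (consr (x, v)) = (h x)%:E.
  by rewrite /H dz dotr_consr consr0 -expr2.
pose F x := g (x ^+ 2 + b) * sin (z0 * x + c).
have xb x : 0 < x ^+ 2 + b by rewrite ltr_wpDl// sqr_ge0.
have dsq (x : R) : is_derive x 1 (fun y : R => y ^+ 2 + b) (2 * x).
  have := is_derive_sqr 1 x; rewrite mulr1.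
  rewrite (_ : (fun y : R => 1 * y ^+ 2) = (fun y : R => y ^+ 2)); last first.
    by apply/funext => y; rewrite mul1r.
  by move=> h1; rewrite -[X in is_derive _ _ _ X]addr0; exact: is_deriveD.
have dgx (x : R) : is_derive x 1 (fun y : R => g (y ^+ 2 + b)) (dg (x ^+ 2 + b) * (2 * x)).
  have h1 := gdg _ (xb x); have h2 := dsq x.
  exact: is_derive1_comp.
have dF (x : R) : is_derive x 1 F (h x).
  have h1 := is_derive_affine z0 c x.
  have h2 : is_derive x 1 (fun y : R => sin (y * z0 + c)) (cos (x * z0 + c) * z0).
    exact: is_derive1_comp.
  have h3 := is_deriveM (dgx x) h2.
  rewrite (_ : F = (fun y => g (y ^+ 2 + b)) * (fun y : R => sin (y * z0 + c))); last first.
    by apply/funext => y; rewrite /F [z0 * y]mulrC.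
  apply: is_derive_eq; rewrite /h /GRing.scale/= [x * z0]mulrC; ring.
have csq : continuous (fun x : R => x ^+ 2 + b).
  by move=> x; apply: differentiable_continuous; apply/derivable1_diffP; have [] := dsq x.
have ch : continuous h.
  move=> x; apply: cvgD; apply: cvgM; try exact: cvg_cst; apply: cvgM.
  - by apply: differentiable_continuous; apply/derivable1_diffP; have [] := dgx x.
  - by apply: continuous_comp_affine; exact: continuous_cos.
  - apply: cvgM; first exact: cvg_id.
    apply: (continuous_comp (f := fun x : R => x ^+ 2 + b)); first exact: csq.
    exact: cdg.
  - by apply: continuous_comp_affine; exact: continuous_sin.
have ih : leb.-integrable setT (EFin \o h).
  by apply: eq_integrable iHv => // x _; rewrite /= hE.
have ginf : g (n%:R ^+ 2 + b) @[n --> \oo] --> (0 : R).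
  apply: (@cvg_comp _ _ _ (fun n : nat => n%:R ^+ 2 + b) g _ +oo%R) => //.
  have /cvgryPge hA := @cvgr_idn R.
  apply/cvgryPge => A; apply: filterS (hA A) => m /le_trans; apply.
  rewrite (@le_trans _ _ (m%:R ^+ 2))//; last by rewrite lerDl dotr_ge0.
  by rewrite -natrX ler_nat; case: m => // m; rewrite expnS expn1 leq_pmulr.
have hF (e : nat -> R) : (forall n, e n ^+ 2 = n%:R ^+ 2) -> F (e n) @[n --> \oo] --> (0 : R).
  move=> eE; apply: norm_cvg0.
  apply: (squeeze_cvgr (f := cst 0) (h := fun n => `|g (n%:R ^+ 2 + b)|)); last 2 first.
  - exact: cvg_cst.
  - by rewrite -[X in _ --> X](normr0 R); apply: cvg_norm.
  apply: nearW => m; rewrite normr_ge0/= /F eE normrM.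
  by rewrite ler_piMr// ler_norml sin_geN1 sin_le1.
have := integral_derive_line dF ch ih (hF _ (fun n => erefl)) (hF _ (fun n => sqrrN _)).
by move=> <-; apply: eq_integral => x _; rewrite hE.
Qed.

End radial_ibp.

(** * The sign-changing weight and its integrals *)
Section tilted_kernel.
Context {R : realType}.
Local Notation leb := (@lebesgue_measure R).
Local Notation B n := (@borel_lebesgue R n).

Lemma sin_abs_le (x : R) : `|sin x| <= `|x|.
Proof.
wlog x0 : x / 0 <= x.
  move=> h; have [/h//|/ltW x0] := leP 0 x.
  by rewrite -normrN -sinN -[leRHS]normrN h// oppr_ge0.
have [|c _] := @MVT_segment R sin cos 0 x x0.
  by apply: continuous_subspaceT; exact: continuous_sin.
rewrite sin0 !subr0 => ->; rewrite normrM ler_piMl//.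
by rewrite ler_norml cos_geN1 cos_le1.
Qed.

(** The weight produced by integration by parts in the first variable.  It
    vanishes at the origin to second order, which compensates for the singular
    factor l^(s-1), l = |v|^2, that differentiating exp (- t l^s) creates. *)
Definition coord_kernel n (z v : 'rV[R]_n.+1) : R :=
  2 * (z ord0 ord0 * v ord0 ord0) * sin (dotr z v).

Definition coord_bound n (z : 'rV[R]_n.+1) : R :=
  2 * `|z ord0 ord0| * \sum_(i < n.+1) `|z ord0 i|.

Lemma coord_bound_ge0 n (z : 'rV[R]_n.+1) : 0 <= coord_bound z.
Proof. by rewrite mulr_ge0 ?mulr_ge0// sumr_ge0. Qed.

Lemma sqr_coord_le n (v : 'rV[R]_n) i : v ord0 i ^+ 2 <= dotr v v.
Proof.
rewrite /dotr (bigD1 i)//= expr2 lerDl; apply: sumr_ge0 => j _.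
by rewrite -expr2 sqr_ge0.
Qed.

Lemma abs_coord_le n (v : 'rV[R]_n) i : `|v ord0 i| <= Num.sqrt (dotr v v).
Proof. by rewrite -sqrtr_sqr ler_wsqrtr// sqr_coord_le. Qed.

Lemma coord_kernel_le n (z v : 'rV[R]_n.+1) :
  `|coord_kernel z v| <= coord_bound z * dotr v v.
Proof.
rewrite /coord_kernel /coord_bound !normrM ger0_norm//.
rewrite -[X in _ <= _ * X](sqr_sqrtr (dotr_ge0 v)) expr2.
rewrite -!mulrA ler_wpM2l// ler_wpM2l// [leRHS]mulrCA ler_pM//.
  exact: abs_coord_le.
apply: (le_trans (sin_abs_le _)); rewrite /dotr mulr_suml.
apply: (le_trans (ler_norm_sum _ _ _)); apply: ler_sum => i _.
by rewrite normrM ler_wpM2l// abs_coord_le.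
Qed.

Lemma measurable_coord_kernel n (z : 'rV[R]_n.+1) :
  measurable_fun setT (coord_kernel z).
Proof.
apply: measurable_funM.
  apply: measurable_funM => //; apply: measurable_funM => //.
  exact: measurable_coord.
by apply: measurable_fun_sin; apply: measurable_fun_dotr => //; exact: measurable_id.
Qed.

(** Powers l^p with p < 0 are only meaningful for l > 0; this lets the origin be
    ignored in all integrals against the weight. *)
Lemma coord_kernel_neq0_sqnorm n (z v : 'rV[R]_n.+1) :
  coord_kernel z v != 0 -> 0 < dotr v v.
Proof.
rewrite lt_def dotr_ge0 andbT; apply: contra_neq => v0.
by rewrite /coord_kernel (sqnorm_eq0 v0) mulr0 mulr0 mul0r.
Qed.

Lemma expR_absorb (a x : R) : 0 < a -> 0 <= x ->
  x * expR (- (a * x)) <= 2 / a * expR (- (a / 2 * x)).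
Proof.
move=> a0 x0; have -> : - (a * x) = - (a / 2 * x) + - (a / 2 * x) by field.
rewrite expRD mulrA ler_wpM2r ?expR_ge0// expRN ler_pdivrMr ?expR_gt0//.
have h := expR_ge1Dx (a / 2 * x).
rewrite (@le_trans _ _ (2 / a * (a / 2 * x)))//.
  by rewrite le_eqVlt; apply/orP; left; apply/eqP; field; rewrite gt_eqF.
by rewrite ler_wpM2l ?divr_ge0 ?(ltW a0)//; lra.
Qed.

Lemma integrable_coord_kernel n (z : 'rV[R]_n.+1) (w u : 'rV[R]_n.+1 -> R) :
  measurable_fun setT w -> (forall v, 0 < dotr v v -> 0 <= w v) ->
  (B n.+1).-integrable setT (EFin \o u) ->
  (forall v, 0 < dotr v v -> dotr v v * w v <= u v) ->
  (B n.+1).-integrable setT (fun v => (coord_kernel z v * w v)%:E).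
Proof.
move=> mw w0 iu wu.
apply: (@le_integrable _ _ _ (B n.+1) setT measurableT _
  (fun v => (coord_bound z)%:E * (u v)%:E)%E).
- apply/measurable_EFinP; apply: measurable_funM => //.
  exact: measurable_coord_kernel.
- move=> v _; rewrite -EFinM !abse_EFin lee_fin.
  have [->|/coord_kernel_neq0_sqnorm v0] := eqVneq (coord_kernel z v) 0.
    by rewrite mul0r normr0.
  rewrite [leLHS]normrM (ger0_norm (w0 v v0)).
  rewrite (@le_trans _ _ (coord_bound z * (dotr v v * w v)))//.
    by rewrite mulrA ler_wpM2r ?w0// coord_kernel_le.
  rewrite (le_trans _ (ler_norm _))// ler_wpM2l ?coord_bound_ge0//.
  exact: wu.
- exact: integrableZl.
Qed.

Lemma integrable_coord_kernel_gauss n (z : 'rV[R]_n.+1) (a : R) : 0 < a ->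
  (B n.+1).-integrable setT
    (fun v => (coord_kernel z v * expR (- (a * dotr v v)))%:E).
Proof.
move=> a0; apply: (@integrable_coord_kernel _ _ _
    (fun v => 2 / a * expR (- (a / 2 * dotr v v)))).
- exact: measurable_gauss.
- by move=> v _; exact: expR_ge0.
- rewrite (_ : EFin \o _ = (fun v => (2 / a)%:E * (expR (- (a / 2 * dotr v v)))%:E)%E)//.
  by apply: integrableZl => //; apply: integrable_gauss; rewrite divr_gt0.
- by move=> v _; apply: expR_absorb => //; exact: dotr_ge0.
Qed.

Lemma mul_powRB1 (l s : R) : 0 < l -> l * l `^ (s - 1) = l `^ s.
Proof.
move=> l0; rewrite -[X in X * _](@powRr1 _ l) ?ltW// -powRD ?(gt_eqF l0) ?implybT//.
by rewrite addrC subrK.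
Qed.

Lemma integrable_coord_kernel_stretched n (z : 'rV[R]_n.+1) (s t : R) :
  0 < s -> 0 < t ->
  (B n.+1).-integrable setT
    (fun v => (coord_kernel z v *
      (dotr v v `^ (s - 1) * expR (- (t * dotr v v `^ s))))%:E).
Proof.
move=> s0 t0; apply: (@integrable_coord_kernel _ _ _
    (fun v => 2 / t * expR (- (t / 2 * dotr v v `^ s)))).
- apply: measurable_funM; last exact: measurable_stretched.
  by apply: measurable_fun_powR; exact: measurable_fun_sqnorm.
- by move=> v _; rewrite mulr_ge0 ?powR_ge0 ?expR_ge0.
- rewrite (_ : EFin \o _ = (fun v => (2 / t)%:E * (expR (- (t / 2 * dotr v v `^ s)))%:E)%E)//.
  by apply: integrableZl => //; apply: integrable_stretched; rewrite ?divr_gt0.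
- move=> v v0; rewrite mulrA mul_powRB1//.
  by apply: expR_absorb => //; exact: powR_ge0.
Qed.

(** The Fourier transform of v |-> exp (- a |v|^2) on R^N at a frequency z such
    that b = |z|^2 / 4. *)
Definition gauss_hat N (b a : R) : R := Num.sqrt (pi / a) ^+ N * expR (- (b / a)).

Lemma coord_kernel_ibp n (g dg : R -> R) (z : 'rV[R]_n.+2) :
  (forall l : R, 0 < l -> is_derive l 1 g (dg l)) ->
  (forall l, 0 < l -> {for l, continuous dg}) ->
  g l @[l --> +oo%R] --> (0 : R) ->
  (B n.+2).-integrable setT (fun v => (g (dotr v v) * cos (dotr z v))%:E) ->
  (B n.+2).-integrable setT (fun v => (coord_kernel z v * dg (dotr v v))%:E) ->
  (\int[B n.+2]_v (coord_kernel z v * dg (dotr v v))%:E =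
   - ((z ord0 ord0 ^+ 2)%:E *
      \int[B n.+2]_v (g (dotr v v) * cos (dotr z v))%:E))%E.
Proof.
move=> gdg cdg g0 iC iK.
have vE v : (z ord0 ord0 * (z ord0 ord0 * (g (dotr v v) * cos (dotr z v)) +
    2 * (v ord0 ord0 * dg (dotr v v) * sin (dotr z v))))%:E =
  ((z ord0 ord0 ^+ 2)%:E * (g (dotr v v) * cos (dotr z v))%:E +
   (coord_kernel z v * dg (dotr v v))%:E)%E.
  rewrite -!EFinM -EFinD; congr EFin; rewrite /coord_kernel; ring.
have [z0|z0] := eqVneq (z ord0 ord0) 0.
  rewrite z0 expr0n mul0e oppe0 integral0_eq// => v _.
  by rewrite /coord_kernel z0 mul0r mulr0 mul0r mul0r.
have iH : (B n.+2).-integrable setT (fun v =>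
    (z ord0 ord0 * (g (dotr v v) * cos (dotr z v)) +
       2 * (v ord0 ord0 * dg (dotr v v) * sin (dotr z v)))%:E).
  have : (B n.+2).-integrable setT (fun v => (z ord0 ord0)^-1%:E *
   ((z ord0 ord0 ^+ 2)%:E * (g (dotr v v) * cos (dotr z v))%:E +
   (coord_kernel z v * dg (dotr v v))%:E))%E.
    by apply: integrableZl => //; apply: integrableD => //; apply: integrableZl.
  by apply: eq_integrable => // v _; rewrite -vE -EFinM mulKf.
have /(congr1 (fun x => (z ord0 ord0)%:E * x)%E) := radial_ibp gdg cdg g0 iH.
rewrite mule0 -integralZl//.
under eq_integral do rewrite -EFinM vE.
rewrite integralD//; last exact: integrableZl.
rewrite integralZl//.
have fK := integrable_fin_num measurableT iK.
have fC := integrable_fin_num measurableT iC.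
rewrite -(fineK fK) -(fineK fC) -!EFinM -EFinD => -[] /eqP.
by rewrite addr_eq0 => /eqP ->; rewrite EFinN oppeK.
Qed.

Lemma coord_kernel_gauss n (z : 'rV[R]_n.+2) (a : R) : 0 < a ->
  (\int[B n.+2]_v (coord_kernel z v * expR (- (a * dotr v v)))%:E =
   (z ord0 ord0 ^+ 2 * (gauss_hat n.+2 (dotr z z / 4) a / a))%:E)%E.
Proof.
move=> a0.
pose g l : R := expR (- (a * l)); pose dg l : R := - a * expR (- (a * l)).
have iK := integrable_coord_kernel_gauss z a0.
have gE : g = fun l => expR (- (l * a)) by apply/funext => l; rewrite /g mulrC.
have dgE : (fun v => (coord_kernel z v * dg (dotr v v))%:E) =
    (fun v => (- a)%:E * (coord_kernel z v * expR (- (a * dotr v v)))%:E)%E.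
  by apply/funext => v; rewrite -EFinM mulrCA.
have gdg (l : R) : 0 < l -> is_derive l 1 g (dg l).
  by move=> _; rewrite gE /dg [a * l]mulrC; exact: is_derive_expRN.
have cg : continuous g by rewrite gE; exact: continuous_expRN.
have cdg (l : R) : 0 < l -> {for l, continuous dg}.
  by move=> _; apply: cvgM; [exact: cvg_cst|exact: cg].
have g0 : g l @[l --> +oo%R] --> (0 : R).
  apply: (@cvg_comp _ _ _ (fun x => a * x) (fun x => expR (- x)) _ +oo%R); last first.
    exact: cvgr_expR.
  exact: gt0_cvgMry.
have iC : (B n.+2).-integrable setT (fun v => (g (dotr v v) * cos (dotr z v))%:E).
  by apply: eq_integrable (integrable_gauss_cos 0 z a0) => // v _; rewrite addr0.
have := coord_kernel_ibp gdg cdg g0 iC.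
rewrite dgE; move=> /(_ (integrableZl measurableT _ iK)).
rewrite integralZl//.
rewrite (_ : (\int[B n.+2]_v (g (dotr v v) * cos (dotr z v))%:E)%E =
   (gauss_hat n.+2 (dotr z z / 4) a)%:E); last first.
  have := gauss_fourier 0 z a0; rewrite cos0 mulr1 /gauss_hat.
  rewrite (_ : dotr z z / 4 / a = dotr z z / (4 * a)); last by rewrite invfM mulrA.
  by move=> <-; apply: eq_integral => v _; rewrite addr0.
have fK := integrable_fin_num measurableT iK.
rewrite -(fineK fK) -!EFinM -EFinN => -[].
rewrite mulNr => /oppr_inj hI; congr EFin.
apply: (@mulfI _ a); first by rewrite gt_eqF.
by rewrite hI; field; rewrite gt_eqF.
Qed.

(** The left-hand side is, up to constants, z_0^2 times the heat kernel: its
    vanishing as t --> 0 has become an explicit factor t. *)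
Lemma coord_kernel_stretched n (z : 'rV[R]_n.+2) (s t : R) : 0 < s -> 0 < t ->
  ((z ord0 ord0 ^+ 2)%:E *
     \int[B n.+2]_v (expR (- (t * dotr v v `^ s)) * cos (dotr z v))%:E =
   (t * s)%:E * \int[B n.+2]_v (coord_kernel z v *
      (dotr v v `^ (s - 1) * expR (- (t * dotr v v `^ s))))%:E)%E.
Proof.
move=> s0 t0.
pose g l : R := expR (- (t * l `^ s)).
pose dg l : R := - (t * s) * (l `^ (s - 1) * expR (- (t * l `^ s))).
have iK := integrable_coord_kernel_stretched z s0 t0.
have dgE : (fun v => (coord_kernel z v * dg (dotr v v))%:E) =
    (fun v => (- (t * s))%:E * (coord_kernel z v *
      (dotr v v `^ (s - 1) * expR (- (t * dotr v v `^ s))))%:E)%E.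
  by apply/funext => v; rewrite -EFinM mulrCA.
have gdg (l : R) : 0 < l -> is_derive l 1 g (dg l).
  move=> l0; have h := is_derive_powR s l0.
  have h1 : is_derive (l `^ s) 1 (fun y => expR (- (y * t))) (- t * expR (- (l `^ s * t))).
    exact: is_derive_expRN.
  have h2 : is_derive l 1 ((fun y => expR (- (y * t))) \o (fun x => x `^ s))
     ((- t * expR (- (l `^ s * t))) * (s * l `^ (s - 1))) by exact: is_derive1_comp.
  rewrite (_ : g = (fun y => expR (- (y * t))) \o (fun x => x `^ s)); last first.
    by apply/funext => x; rewrite /g /= mulrC.
  apply: is_derive_eq; rewrite /dg [_ * t]mulrC; ring.
have cg (l : R) : 0 < l -> {for l, continuous g}.
  move=> l0; apply: differentiable_continuous; apply/derivable1_diffP.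
  by have [] := gdg l l0.
have cdg (l : R) : 0 < l -> {for l, continuous dg}.
  move=> l0; apply: cvgM; first exact: cvg_cst.
  by apply: cvgM; [exact: continuous_powR|exact: cg].
have g0 : g l @[l --> +oo%R] --> (0 : R).
  apply: (@cvg_comp _ _ _ (fun x => t * x `^ s) (fun x => expR (- x)) _ +oo%R); last first.
    exact: cvgr_expR.
  apply: gt0_cvgMry => //.
  apply/cvgryPge => A.
  pose M := Num.max A 0.
  have M0 : 0 <= M by rewrite le_max lexx orbT.
  apply: filterS (nbhs_pinfty_ge (num_real (M `^ s^-1))) => x Mx.
  rewrite (@le_trans _ _ ((M `^ s^-1) `^ s))//.
    by rewrite -powRrM mulVf ?gt_eqF// powRr1// le_max lexx.
  by rewrite ge0_ler_powR ?(ltW s0) ?nnegrE ?powR_ge0// (le_trans _ Mx)// powR_ge0.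
have iC : (B n.+2).-integrable setT (fun v => (g (dotr v v) * cos (dotr z v))%:E).
  apply: (@le_integrable _ _ _ (B n.+2) setT measurableT _ _ _ _ (integrable_stretched _ s0 t0)).
  - apply/measurable_EFinP; apply: measurable_funM; first exact: measurable_stretched.
    by apply: measurable_fun_cos; apply: measurable_fun_dotr => //; exact: measurable_id.
  - move=> v _; rewrite !abse_EFin lee_fin normrM ler_piMr//.
    by rewrite ler_norml cos_geN1 cos_le1.
have := coord_kernel_ibp gdg cdg g0 iC.
rewrite dgE; move=> /(_ (integrableZl measurableT _ iK)).
rewrite integralZl// -/g.
have fK := integrable_fin_num measurableT iK.
have fC := integrable_fin_num measurableT iC.
rewrite -(fineK fK) -(fineK fC) -!EFinM -EFinN => -[].
by rewrite mulNr => /oppr_inj ->.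
Qed.

End tilted_kernel.

(** * The subordination integral of the Riesz kernel *)
Section gauss_hat_theory.
Context {R : realType}.
Local Notation leb := (@lebesgue_measure R).
Local Notation B n := (@borel_lebesgue R n).

Lemma measurable_fun_inv d (T : measurableType d) (D : set T) (f : T -> R) :
  measurable_fun D f -> measurable_fun D (fun x => (f x)^-1).
Proof.
move=> mf.
(* holds also where f vanishes, both sides being 0 there *)
rewrite (_ : (fun x => (f x)^-1) = (fun x => f x * (f x ^+ 2) `^ (-1))).
  apply: measurable_funM => //; apply: measurable_fun_powR.
  exact: measurable_funX.
apply/funext => x; rewrite powR_inv1 ?sqr_ge0//.
have [->|fx] := eqVneq (f x) 0; first by rewrite invr0 mul0r.
by rewrite expr2 invfM mulrA mulfV// mul1r.
Qed.

Lemma measurable_gauss_hat N (b : R) : measurable_fun setT (gauss_hat N b).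
Proof.
apply: measurable_funM.
  apply: measurable_funX; apply: (measurableT_comp (f := @Num.sqrt R)).
    by apply: continuous_measurable_fun; exact: sqrt_continuous.
  by apply: measurable_funM => //; apply: measurable_fun_inv; exact: measurable_id.
apply: measurable_fun_expR; apply: measurable_fun_opp; apply: measurable_funM => //.
by apply: measurable_fun_inv; exact: measurable_id.
Qed.

Lemma gauss_hat_ge0 N (b a : R) : 0 <= gauss_hat N b a.
Proof. by rewrite mulr_ge0 ?expR_ge0// exprn_ge0// sqrtr_ge0. Qed.

Lemma continuous_gauss_hat N (b a : R) : 0 < a -> {for a, continuous (gauss_hat N b)}.
Proof.
move=> a0; have cV : x^-1 @[x --> a] --> a^-1 by apply: cvgV; [rewrite gt_eqF|exact: cvg_id].
apply: cvgM.
  apply: (@cvg_comp _ _ _ (fun x => Num.sqrt (pi / x)) (fun y => y ^+ N) _ (nbhs (Num.sqrt (pi / a)))); last exact: exprn_continuous.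
  apply: (@cvg_comp _ _ _ (fun x => pi / x) (@Num.sqrt R) _ (nbhs (pi / a))); last exact: sqrt_continuous.
  by apply: cvgM; [exact: cvg_cst|exact: cV].
apply: (@cvg_comp _ _ _ (fun x => - (b / x)) expR _ (nbhs (- (b / a)))); last exact: continuous_expR.
by apply: cvgN; apply: cvgM; [exact: cvg_cst|exact: cV].
Qed.

Lemma sqrtr_le1D (y : R) : 0 <= y -> Num.sqrt y <= 1 + y.
Proof.
move=> y0; have p : 0 <= 1 + y by rewrite addr_ge0.
rewrite -[leRHS]ger0_norm// -sqrtr_sqr ler_wsqrtr// sqrrD expr1n mul1r.
have := sqr_ge0 y; lra.
Qed.

(** Near a = 0 the exponential exp (- b / a) beats every power of 1 / a; the bound
    is uniform enough to dominate the shifted integrands below. *)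
Lemma gauss_hat_div_le N (b : R) : 0 < b ->
  exists2 C : R, 0 <= C & forall a, 0 < a -> gauss_hat N b a / a <= C / (1 + a).
Proof.
move=> b0.
have [q [q1 qpi]] : exists q : R, 1 <= q /\ pi <= q.
  by exists (1 + pi); rewrite lerDl lerDr pi_ge0.
have q0 : 0 <= q by exact: le_trans q1.
have q10 : 0 <= 1 + q by rewrite addr_ge0.
exists ((1 + q) ^+ N.+1 * (1 + N.+1`!%:R / b ^+ N.+1)).
  apply: mulr_ge0; first by rewrite exprn_ge0.
  by rewrite addr_ge0// divr_ge0// exprn_ge0// ltW.
move=> a a0; pose x := a^-1.
have x0 : 0 < x by rewrite invr_gt0.
have qx0 : 0 <= q * x by rewrite mulr_ge0// ltW.
have px0 : 0 <= pi * x by rewrite mulr_ge0 ?pi_ge0// ltW.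
have xN : 0 <= x ^+ N.+1 by rewrite exprn_ge0// ltW.
have qN : 0 <= (1 + q) ^+ N.+1 by rewrite exprn_ge0.
rewrite ler_pdivlMr ?ltr_pwDl ?(ltW a0)//.
have -> : gauss_hat N b a / a * (1 + a) = (1 + x) * Num.sqrt (pi * x) ^+ N * expR (- (b * x)).
  by rewrite /gauss_hat /x; field; rewrite gt_eqF.
have h1 : (1 + x) * Num.sqrt (pi * x) ^+ N <= (1 + q * x) ^+ N.+1.
  rewrite exprS; apply: ler_pM.
  - by rewrite addr_ge0// ltW.
  - by rewrite exprn_ge0// sqrtr_ge0.
  - by rewrite lerD2l ler_peMl// ltW.
  - apply: lerXn2r; rewrite ?nnegrE ?sqrtr_ge0 ?addr_ge0//.
    rewrite (le_trans (sqrtr_le1D px0))// lerD2l ler_wpM2r// ltW//.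
have h2 : (1 + q * x) ^+ N.+1 <= (1 + q) ^+ N.+1 * (1 + x ^+ N.+1).
  have [x1|x1] := leP x 1.
    apply: (@le_trans _ _ ((1 + q) ^+ N.+1)); last by rewrite ler_peMr// lerDl.
    by apply: lerXn2r; rewrite ?nnegrE ?addr_ge0// lerD2l ler_piMr.
  apply: (@le_trans _ _ (((1 + q) * x) ^+ N.+1)).
    apply: lerXn2r; rewrite ?nnegrE ?addr_ge0 ?mulr_ge0// ?(ltW x0)//.
    by rewrite mulrDl mul1r lerD2r ltW.
  by rewrite exprMn ler_wpM2l// lerDr.
apply: (le_trans (ler_wpM2r _ (le_trans h1 h2))); first exact: expR_ge0.
by rewrite -mulrA ler_wpM2l// pow_expR_le// ltW.
Qed.

(** Comparison with the integrand of Bernstein's formula, through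
    a / (1 + a) <= 1 - exp (- a). *)
Lemma integrable_powR_majorant (s : R) : 0 < s < 1 ->
  leb.-integrable `]0, +oo[ (fun a => (a `^ (- s) / (1 + a))%:E).
Proof.
move=> s01; have [G G0 HG] := laplace_powR s01.
have HB := bernstein_powR s01 G0 HG ler01.
have mb : measurable_fun setT (fun a : R => ((1 - expR (- (a * 1))) * a `^ (- s - 1))%:E).
  apply/measurable_EFinP; apply: measurable_funM; last exact: measurable_fun_powR.
  by apply: measurable_funB => //; exact: measurable_expRN.
have b0 (a : R) : 0 < a -> 0 <= (1 - expR (- (a * 1))) * a `^ (- s - 1).
  move=> a0; rewrite mulr_ge0 ?powR_ge0// subr_ge0 -[leRHS]expR0 ler_expR.
  by rewrite oppr_le0 mulr1 ltW.
apply: (@le_integrable _ _ _ leb [set` `]0, +oo[] _ _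
  (fun a => ((1 - expR (- (a * 1))) * a `^ (- s - 1))%:E)) => //.
- apply/measurable_EFinP; apply: measurable_funTS; apply: measurable_funM.
    exact: measurable_fun_powR.
  by apply: measurable_fun_inv; apply: measurable_funD.
- move=> a; rewrite /= in_itv/= andbT => a0.
  rewrite lee_fin !ger0_norm ?b0 ?divr_ge0 ?powR_ge0 ?addr_ge0 ?(ltW a0)//.
  rewrite (_ : a `^ (- s) = a * a `^ (- s - 1)); last by rewrite mul_powRB1.
  rewrite mulrAC ler_wpM2r ?powR_ge0// mulr1.
  have -> : a / (1 + a) = 1 - (1 + a)^-1.
    by field; rewrite gt_eqF// ltr_pwDl// ltW.
  by rewrite lerD2l lerN2 expRN_le_inv1D// ltW.
- apply/integrableP; split; first exact: measurable_funTS.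
  under eq_integral => a aD.
    rewrite gee0_abs ?lee_fin ?b0//; last by move: aD; rewrite inE/= in_itv/= andbT.
    over.
  by rewrite HB ltry.
Qed.

(** Its integral over a > 0 is a multiple of b^(-N/2-s): this is the Riesz kernel
    written as a superposition of Gaussians. *)
Definition riesz_integrand N (s b a : R) : R := a `^ (- s) * (gauss_hat N b a / a).

Lemma riesz_integrand_ge0 N s b (a : R) : 0 < a -> 0 <= riesz_integrand N s b a.
Proof. by move=> a0; rewrite mulr_ge0 ?powR_ge0// divr_ge0 ?gauss_hat_ge0// ltW. Qed.

Lemma measurable_riesz_integrand N s b : measurable_fun setT (riesz_integrand N s b).
Proof.
apply: measurable_funM; first exact: measurable_fun_powR.
apply: measurable_funM; first exact: measurable_gauss_hat.
by apply: measurable_fun_inv; exact: measurable_id.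
Qed.

Lemma integrable_riesz_integrand N (s b : R) : 0 < s < 1 -> 0 < b ->
  leb.-integrable `]0, +oo[ (fun a => (riesz_integrand N s b a)%:E).
Proof.
move=> s01 b0; have [C C0 hC] := gauss_hat_div_le N b0.
apply: (@le_integrable _ _ _ leb [set` `]0, +oo[] _ _
  (fun a => C%:E * (a `^ (- s) / (1 + a))%:E)%E) => //.
- by apply/measurable_EFinP/measurable_funTS; exact: measurable_riesz_integrand.
- move=> a; rewrite /= in_itv/= andbT => a0; rewrite lee_fin.
  rewrite ger0_norm ?riesz_integrand_ge0// (le_trans _ (ler_norm _))//.
  by rewrite mulrCA ler_wpM2l ?powR_ge0// hC.
- by apply: integrableZl => //; exact: integrable_powR_majorant.
Qed.

(** The shift of a is the trace of the damping factor exp (- l / (m + 1)). *)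
Lemma cvg_riesz_shift N (s b : R) : 0 < s < 1 -> 0 < b ->
  (\int[leb]_(a in `]0%R, +oo[)
     (a `^ (- s) * (gauss_hat N b (a + m.+1%:R^-1) / (a + m.+1%:R^-1)))%:E
   @[m --> \oo] --> \int[leb]_(a in `]0%R, +oo[) (riesz_integrand N s b a)%:E)%E.
Proof.
move=> s01 b0; have [C C0 hC] := gauss_hat_div_le N b0.
have p0 m (a : R) : 0 < a -> 0 < a + m.+1%:R^-1 by move=> a0; rewrite addr_gt0 ?invr_gt0.
apply: (@dominated_cvg _ _ _ leb [set` `]0, +oo[] _ _ _
  (fun a => C%:E * (a `^ (- s) / (1 + a))%:E)%E) => //.
- move=> m; apply/measurable_EFinP/measurable_funTS.
  apply: measurable_funM; first exact: measurable_fun_powR.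
  have ma : measurable_fun setT (fun a : R => a + m.+1%:R^-1) by exact: measurable_funD.
  apply: measurable_funM; last exact: measurable_fun_inv.
  exact: (measurableT_comp (measurable_gauss_hat N b) ma).
- move=> a; rewrite /= in_itv/= andbT => a0; apply: cvg_EFin; first exact: nearW.
  apply: cvgM; first exact: cvg_cst.
  have ca : a + m.+1%:R^-1 @[m --> \oo] --> a.
    rewrite -[X in _ --> X]addr0; apply: cvgD; first exact: cvg_cst.
    exact: cvg_harmonic.
  apply: cvgM; last by apply: cvgV => //; rewrite gt_eqF.
  by apply: (@cvg_comp _ _ _ _ (gauss_hat N b) _ _ _ ca); exact: continuous_gauss_hat.
- by apply: integrableZl => //; exact: integrable_powR_majorant.
- move=> m a; rewrite /= in_itv/= andbT => a0; rewrite lee_fin.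
  rewrite ger0_norm; last first.
    by rewrite mulr_ge0 ?powR_ge0 ?divr_ge0 ?gauss_hat_ge0// ltW// p0.
  rewrite [leRHS]mulrCA ler_wpM2l ?powR_ge0// (le_trans (hC _ (p0 m a a0)))//.
  rewrite ler_wpM2l// lef_pV2 ?posrE ?ltr_pwDl ?(ltW a0) ?(ltW (p0 m a a0))//.
  by rewrite lerD2l lerDl invr_ge0.
Qed.

End gauss_hat_theory.

(** * Bounds and limit of the singular integral *)
Section measurable_param_integral.
Context d1 d2 (X : measurableType d1) (Y : measurableType d2) (R : realType).
Variable mu : {sigma_finite_measure set X -> \bar R}.

(** The integral is the difference of those of the positive and negative parts,
    whatever their values, so Tonelli's theorem suffices. *)
Lemma measurable_param_integral (h : X * Y -> R) : measurable_fun setT h ->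
  measurable_fun setT (fun y => \int[mu]_x (h (x, y))%:E)%E.
Proof.
move=> mh; have mH : measurable_fun setT (EFin \o h) by exact/measurable_EFinP.
rewrite (_ : (fun y => _) = (fubini_G mu (EFin \o h)^\+ \- fubini_G mu (EFin \o h)^\-)%E).
  apply: emeasurable_funB; apply: measurable_fun_fubini_tonelli_G => //.
  - exact: measurable_funepos.
  - exact: measurable_funeneg.
apply/funext => y; rewrite [LHS]integralE.
rewrite /fubini_G; congr (_ - _)%E; apply: eq_integral => x _.
  by rewrite !funeposE.
by rewrite !funenegE.
Qed.

End measurable_param_integral.

Section small_time_integrals.
Context {R : realType}.
Local Notation leb := (@lebesgue_measure R).
Local Notation B n := (@borel_lebesgue R n).
Variables (n : nat) (z : 'rV[R]_n.+2) (s : R).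
Hypotheses (s0 : 0 < s) (s12 : s < 2^-1).
Hypothesis z0 : z ord0 ord0 != 0.

Let lam (v : 'rV[R]_n.+2) : R := dotr v v.
Let k := coord_kernel z.
Let mlam : measurable_fun setT lam. Proof. exact: measurable_fun_sqnorm. Qed.
Let mk : measurable_fun setT k. Proof. exact: measurable_coord_kernel. Qed.
Let lam0 v : 0 <= lam v. Proof. exact: dotr_ge0. Qed.
Let s01 : 0 < s < 1.
Proof. by rewrite s0 (lt_trans s12)// invf_lt1// ltr1n. Qed.
Let s201 : 0 < 2 * s < 1.
Proof. by rewrite mulr_gt0//= mulrC -ltr_pdivlMr// mul1r. Qed.

Lemma sqnorm_gt0 : 0 < dotr z z.
Proof.
rewrite lt_def dotr_ge0 andbT; apply: contra z0 => /eqP zz.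
by rewrite (sqnorm_eq0 zz).
Qed.

Let kx_gt0 v x : k v * x != 0 -> 0 < lam v.
Proof.
rewrite mulf_eq0 negb_or => /andP[kv _].
exact: coord_kernel_neq0_sqnorm kv.
Qed.

Let b0 : 0 < dotr z z / 4. Proof. by rewrite divr_gt0// sqnorm_gt0. Qed.

Let mexp t a : measurable_fun setT (fun v => expR (- (t * lam v `^ a))).
Proof. exact: measurable_stretched. Qed.

Let mpow a : measurable_fun setT (fun v => lam v `^ a).
Proof. exact: measurable_fun_powR. Qed.

Let mgauss a : measurable_fun setT (fun v => expR (- (a * lam v))).
Proof. exact: measurable_gauss. Qed.

Lemma coord_kernel_gauss_ge0 a : 0 < a ->
  (0 <= \int[B n.+2]_v (k v * expR (- (a * lam v)))%:E)%E.
Proof.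
move=> a0; rewrite coord_kernel_gauss// lee_fin mulr_ge0 ?sqr_ge0//.
by rewrite divr_ge0 ?gauss_hat_ge0// ltW.
Qed.

Lemma coord_kernel_stable_ge0 a r : 0 < a -> 0 <= r ->
  (0 <= \int[B n.+2]_v (k v * expR (- (a * lam v)) * expR (- (r * lam v `^ s)))%:E)%E.
Proof.
move=> a0 r0.
have ik tau : 0 < tau ->
    (B n.+2).-integrable setT (fun v => (k v * expR (- (tau * lam v)))%:E).
  by move=> tau0; exact: integrable_coord_kernel_gauss.
have [_ _] := stable_gauss_positive mlam lam0 mk ik coord_kernel_gauss_ge0 s01 r0.
exact.
Qed.

Let expR_le1 (x : R) : 0 <= x -> expR (- x) <= 1.
Proof. by move=> x0; rewrite -expR0 ler_expR oppr_le0. Qed.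

Let integrable_damped (p d : R) (f : 'rV[R]_n.+2 -> R) : 0 <= p <= 1 -> 0 < d ->
  measurable_fun setT f -> (forall v, 0 <= f v <= 1) ->
  (B n.+2).-integrable setT
    (fun v => (k v * (expR (- (d * lam v)) * (f v * lam v `^ (p - 1))))%:E).
Proof.
move=> /andP[p0 p1] d0 mf f01.
apply: (@integrable_coord_kernel _ _ _ _
    (fun v => (1 + 2 / d) * expR (- (d / 2 * lam v)))).
- apply: measurable_funM => //; exact: measurable_funM.
- move=> v _; have /andP[f0 _] := f01 v.
  by rewrite !mulr_ge0 ?expR_ge0 ?powR_ge0.
- rewrite (_ : EFin \o _ = (fun v => (1 + 2 / d)%:E * (expR (- (d / 2 * lam v)))%:E)%E)//.
  by apply: integrableZl => //; apply: integrable_gauss; rewrite divr_gt0.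
- move=> v v0; have /andP[f0 f1] := f01 v; rewrite -/(lam v) in v0 *.
  have -> : lam v * (expR (- (d * lam v)) * (f v * lam v `^ (p - 1))) =
     f v * ((lam v `^ p) * expR (- (d * lam v))).
    by rewrite -(mul_powRB1 p v0); ring.
  apply: (@le_trans _ _ ((lam v `^ p) * expR (- (d * lam v)))).
    by rewrite ler_piMl// mulr_ge0 ?powR_ge0 ?expR_ge0.
  apply: (@le_trans _ _ ((1 + lam v) * expR (- (d * lam v)))).
    rewrite ler_wpM2r ?expR_ge0//.
    have [l1|l1] := leP (lam v) 1.
      rewrite (@le_trans _ _ 1)// ?lerDl//.
      rewrite (@le_trans _ _ (1 `^ p))//; last by rewrite powR1.
      by rewrite ge0_ler_powR ?nnegrE.
    rewrite (@le_trans _ _ (lam v)) ?lerDr// -[leRHS]powRr1// ler_powR// ltW//.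
  rewrite mulrDl mul1r mulrDl mul1r lerD//; last exact: expR_absorb.
  rewrite ler_expR lerN2 ler_wpM2r// ler_pdivrMr// ler_peMr ?(ltW d0)//.
  by rewrite ler1n.
Qed.

Let expr01 r v : 0 <= r -> 0 <= expR (- (r * lam v `^ s)) <= 1.
Proof. by move=> r0; rewrite expR_ge0 expR_le1// mulr_ge0// powR_ge0. Qed.

(** Here 2s < 1 is used: it makes l^(2s-1) a mixture of Gaussian weights. *)
Let weighted_ge0 (G : R) d r :
  (forall l, 0 < l ->
    (\int[leb]_(x in `]0%R, +oo[) (x `^ (- (2 * s)) * expR (- (x * l)))%:E
      = (G * l `^ (2 * s - 1))%:E)%E) ->
  0 < d -> 0 <= r ->
  (0 <= \int[B n.+2]_v (k v * expR (- (d * lam v)) *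
     (G * lam v `^ (2 * s - 1) * expR (- (r * lam v `^ s))))%:E)%E.
Proof.
move=> HG d0 r0.
under eq_integral => v _.
  rewrite (_ : _ * _ = k v * expR (- (d * lam v)) * expR (- (r * lam v `^ s)) *
    (G * lam v `^ (2 * s - 1))); last by ring.
  over.
apply: (@integral_mixture_ge0 _ _ _ (measurableTypeR R) R (B n.+2) leb [set` `]0, +oo[]
  (fun v => k v * expR (- (d * lam v)) * expR (- (r * lam v `^ s)))
  (fun v => G * lam v `^ (2 * s - 1))
  (fun p => p.2 `^ (- (2 * s)) * expR (- (p.2 * lam p.1)))).
- exact: measurable_itv.
- by apply: measurable_funM => //; exact: measurable_funM.
- apply: measurable_funM; first by apply: measurable_fun_powR; exact: measurable_snd.
  apply: measurable_fun_expR; apply: measurable_fun_opp; apply: measurable_funM.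
    exact: measurable_snd.
  exact: (measurableT_comp mlam measurable_fst).
- by move=> v a _; rewrite mulr_ge0 ?powR_ge0 ?expR_ge0.
- move=> v kv; rewrite /= HG//.
  by move: kv; rewrite -mulrA => /kx_gt0.
- have := @integrable_damped (2 * s) d (fun v => expR (- (r * lam v `^ s))) _ d0 _ _.
  have /andP[s2 s2'] := s201; rewrite (ltW s2) (ltW s2') => /(_ isT (mexp _ _) (fun v => expr01 v r0)).
  move=> /(integrableZl measurableT G); apply: eq_integrable => // v _.
  by rewrite -EFinM; congr EFin; ring.
- move=> a; rewrite /= in_itv/= andbT => a0.
  under eq_integral => v _.
    rewrite (_ : _ * _ = a `^ (- (2 * s)) *
      (k v * expR (- ((d + a) * lam v)) * expR (- (r * lam v `^ s)))); last first.
      by rewrite (mulrDl d a) (opprD (d * _)) (expRD (- (d * _))); ring.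
    rewrite EFinM; over.
  have da : 0 < d + a by rewrite addr_gt0.
  rewrite integralZl//; first by rewrite mule_ge0 ?lee_fin ?powR_ge0// coord_kernel_stable_ge0.
  have := @integrable_damped 1 (d + a) (fun v => expR (- (r * lam v `^ s))) _ da _ _.
  rewrite ler01 lexx => /(_ isT (mexp _ _) (fun v => expr01 v r0)).
  apply: eq_integrable => // v _.
  rewrite subrr powRr0; congr EFin; ring.
Qed.

(** The derivative in r of - l^(s-1) exp (- r l^s) is l^(2s-1) exp (- r l^s), whose
    integrals are nonnegative; integrate over r in [0, t].  The damping
    exp (- d l) is needed since l^(s-1) alone is not integrable against the weight. *)
Lemma coord_kernel_defect_ge0 d t : 0 < d -> 0 < t ->
  (0 <= \int[B n.+2]_v (k v * (expR (- (d * lam v)) *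
     ((1 - expR (- (t * lam v `^ s))) * lam v `^ (s - 1))))%:E)%E.
Proof.
move=> d0 t0; have [G G0 HG] := laplace_powR s201.
rewrite -(@pmule_rge0 _ G%:E) ?lte_fin//.
have f01 v : 0 <= 1 - expR (- (t * lam v `^ s)) <= 1.
  have /andP[e0 e1] := expr01 v (ltW t0).
  by rewrite subr_ge0 e1 gerBl.
have mf : measurable_fun setT (fun v => 1 - expR (- (t * lam v `^ s))).
  exact: measurable_funB.
have /andP[_ s1] := s01.
have iD : (B n.+2).-integrable setT (fun v => (k v * (expR (- (d * lam v)) *
     ((1 - expR (- (t * lam v `^ s))) * lam v `^ (s - 1))))%:E).
  by apply: integrable_damped => //; rewrite (ltW s0) ltW.
rewrite -integralZl//.
have E v : (G%:E * (k v * (expR (- (d * lam v)) *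
     ((1 - expR (- (t * lam v `^ s))) * lam v `^ (s - 1))))%:E)%E =
  (k v * expR (- (d * lam v)) *
    (G * ((1 - expR (- (t * lam v `^ s))) * lam v `^ (s - 1))))%:E.
  by rewrite -EFinM; congr EFin; ring.
under eq_integral do rewrite E.
apply: (@integral_mixture_ge0 _ _ _ (measurableTypeR R) R (B n.+2) leb [set` `[0, t]]
  (fun v => k v * expR (- (d * lam v)))
  (fun v => G * ((1 - expR (- (t * lam v `^ s))) * lam v `^ (s - 1)))
  (fun p => G * lam p.1 `^ (2 * s - 1) * expR (- (p.2 * lam p.1 `^ s)))).
- exact: measurable_itv.
- exact: measurable_funM.
- apply: measurable_funM.
    apply: measurable_funM => //; exact: (measurableT_comp (mpow _) measurable_fst).
  apply: measurable_fun_expR; apply: measurable_fun_opp; apply: measurable_funM.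
    exact: measurable_snd.
  exact: (measurableT_comp (mpow s) measurable_fst).
- by move=> v a _; rewrite !mulr_ge0 ?powR_ge0 ?expR_ge0// ltW.
- move=> v /kx_gt0 v0 /=.
  rewrite -/(lam v) in v0 *.
  pose F (r : R) := - (G * lam v `^ (s - 1)) * expR (- (r * lam v `^ s)).
  transitivity (F t - F 0)%:E; last first.
    by rewrite /F mul0r oppr0 expR0; congr EFin; ring.
  apply: (@integral_itv_derive _ F) => //.
  + move=> r _; rewrite [X in is_derive _ _ _ X](_ : _ =
      - (G * lam v `^ (s - 1)) * (- lam v `^ s * expR (- (r * lam v `^ s)))); last first.
      have -> : lam v `^ (2 * s - 1) = lam v `^ (s - 1) * lam v `^ s.
        by rewrite -powRD ?(gt_eqF v0) ?implybT//; congr (_ `^ _); ring.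
      ring.
    exact: (is_deriveZ (- (G * lam v `^ (s - 1))) (is_derive_expRN (lam v `^ s) r)).
  + by move=> r _; apply: cvgM; [exact: cvg_cst|exact: continuous_expRN].
- by apply: eq_integrable (integrableZl measurableT G iD) => // v _; rewrite E.
- move=> r; rewrite /= in_itv/= => /andP[r0 _]; exact: weighted_ge0.
Qed.

(** K 0 does not converge absolutely, so the comparison K t <= K 0 is carried
    out on damped integrals. *)
Let K t := (\int[B n.+2]_v (k v * (lam v `^ (s - 1) * expR (- (t * lam v `^ s))))%:E)%E.

Variable G : R.
Hypothesis G0 : 0 < G.
Hypothesis HG : forall l, 0 < l ->
  (\int[leb]_(x in `]0%R, +oo[) (x `^ (- s) * expR (- (x * l)))%:E
      = (G * l `^ (s - 1))%:E)%E.

Let I := (\int[leb]_(a in `]0%R, +oo[) (riesz_integrand n.+2 s (dotr z z / 4) a)%:E)%E.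

Let mixture_laplace (f : 'rV[R]_n.+2 -> R) :
  measurable_fun setT f ->
  (B n.+2).-integrable setT (fun v => (k v * (f v * lam v `^ (s - 1)))%:E) ->
  (G%:E * \int[B n.+2]_v (k v * (f v * lam v `^ (s - 1)))%:E =
   \int[leb]_(a in `]0%R, +oo[) \int[B n.+2]_v
      (k v * f v * (a `^ (- s) * expR (- (a * lam v))))%:E)%E.
Proof.
move=> mf ikf; rewrite -integralZl//.
have E v : (G%:E * (k v * (f v * lam v `^ (s - 1)))%:E)%E =
    (k v * f v * (G * lam v `^ (s - 1)))%:E.
  by rewrite -EFinM; congr EFin; ring.
under eq_integral do rewrite E.
apply: (@integral_mixture _ _ _ (measurableTypeR R) R (B n.+2) leb [set` `]0, +oo[]
  (fun v => k v * f v) (fun v => G * lam v `^ (s - 1))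
  (fun p => p.2 `^ (- s) * expR (- (p.2 * lam p.1)))).
- exact: measurable_itv.
- exact: measurable_funM.
- apply: measurable_funM; first by apply: measurable_fun_powR; exact: measurable_snd.
  apply: measurable_fun_expR; apply: measurable_fun_opp; apply: measurable_funM.
    exact: measurable_snd.
  exact: (measurableT_comp mlam measurable_fst).
- by move=> v a _; rewrite mulr_ge0 ?powR_ge0 ?expR_ge0.
- move=> v /kx_gt0 v0 /=.
  exact: HG.
- by apply: eq_integrable (integrableZl measurableT G ikf) => // v _; rewrite E.
Qed.

(** Under the mixture, the damping shifts the Gaussian parameter from a to a + d. *)
Lemma coord_kernel_riesz_damped d : 0 < d ->
  (G%:E * \int[B n.+2]_v (k v * (expR (- (d * lam v)) * lam v `^ (s - 1)))%:E =
   (z ord0 ord0 ^+ 2)%:E * \int[leb]_(a in `]0%R, +oo[)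
     (a `^ (- s) * (gauss_hat n.+2 (dotr z z / 4) (a + d) / (a + d)))%:E)%E.
Proof.
move=> d0; have /andP[_ s1] := s01; rewrite mixture_laplace//; last first.
  have := @integrable_damped s d (fun=> 1) _ d0 _ _.
  rewrite (ltW s0) (ltW s1) => /(_ isT (measurable_cst _)) h.
  apply: eq_integrable (h _) => // v; first by rewrite mul1r.
  by rewrite ler01 lexx.
rewrite -ge0_integralZl_EFin ?sqr_ge0//; last 2 first.
- move=> a; rewrite /= in_itv/= andbT => a0; rewrite lee_fin.
  by rewrite mulr_ge0 ?powR_ge0// divr_ge0 ?gauss_hat_ge0// addr_ge0// ltW.
- apply/measurable_EFinP/measurable_funTS.
  apply: measurable_funM; first exact: measurable_fun_powR.
  have ma : measurable_fun setT (fun a : R => a + d) by exact: measurable_funD.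
  apply: measurable_funM; last exact: measurable_fun_inv.
  exact: (measurableT_comp (measurable_gauss_hat _ _) ma).
apply: eq_integral => a; rewrite inE/= in_itv/= andbT => a0.
under eq_integral => v _.
  rewrite (_ : _ * _ = a `^ (- s) * (k v * expR (- ((a + d) * lam v)))); last first.
    by rewrite (mulrDl a d) (opprD (a * _)) (expRD (- (a * _))); ring.
  rewrite EFinM; over.
have ad : 0 < a + d by rewrite addr_gt0.
rewrite integralZl//; last exact: integrable_coord_kernel_gauss.
by rewrite coord_kernel_gauss// -!EFinM; congr EFin; ring.
Qed.

(** The damped integral at time t is at most the damped integral at time 0, by
    [coord_kernel_defect_ge0]; let the damping tend to 0 on both sides. *)
Lemma coord_kernel_stretched_upper t : 0 < t ->
  (G%:E * K t <= (z ord0 ord0 ^+ 2)%:E * I)%E.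
Proof.
move=> t0; have /andP[_ s1] := s01.
pose A m := (\int[B n.+2]_v (k v * (expR (- (m.+1%:R^-1 * lam v)) *
  (expR (- (t * lam v `^ s)) * lam v `^ (s - 1))))%:E)%E.
pose C m := (\int[B n.+2]_v (k v * (expR (- (m.+1%:R^-1 * lam v)) * lam v `^ (s - 1)))%:E)%E.
have d0 m : 0 < m.+1%:R^-1 :> R by rewrite invr_gt0.
have iA m : (B n.+2).-integrable setT (fun v => (k v * (expR (- (m.+1%:R^-1 * lam v)) *
  (expR (- (t * lam v `^ s)) * lam v `^ (s - 1))))%:E).
  apply: integrable_damped => //; first by rewrite (ltW s0) ltW.
  by move=> v; exact/expr01/ltW.
have iC m : (B n.+2).-integrable setT
    (fun v => (k v * (expR (- (m.+1%:R^-1 * lam v)) * lam v `^ (s - 1)))%:E).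
  have := @integrable_damped s _ (fun=> 1) _ (d0 m) _ _.
  rewrite (ltW s0) (ltW s1) => /(_ isT (measurable_cst _)) h.
  apply: eq_integrable (h _) => // v; first by rewrite mul1r.
  by rewrite ler01 lexx.
have AC m : (A m <= C m)%E.
  rewrite -sube_ge0; last first.
    by rewrite (integrable_fin_num measurableT (iA m)).
  rewrite -integralB//.
  have := coord_kernel_defect_ge0 (d0 m) t0; congr (_ <= _)%E.
  by apply: eq_integral => v _; rewrite -EFinB; congr EFin; ring.
have cA : (A m @[m --> \oo] --> K t)%E.
  have iK := integrable_coord_kernel_stretched z s0 t0.
  apply: (@dominated_cvg _ _ _ (B n.+2) setT measurableT _ _
    (fun v => `|(k v * (lam v `^ (s - 1) * expR (- (t * lam v `^ s))))%:E|%E)).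
  - by move=> m; case/integrableP : (iA m).
  - move=> v _; apply: cvg_EFin; first exact: nearW.
    apply: cvgM; first exact: cvg_cst.
    have -> : lam v `^ (s - 1) * expR (- (t * lam v `^ s)) =
      1 * (expR (- (t * lam v `^ s)) * lam v `^ (s - 1)) by ring.
    apply: cvgM; last exact: cvg_cst.
    rewrite -[X in _ --> X]expR0; apply: continuous_cvg; first exact: continuous_expR.
    rewrite -oppr0 -[X in _ --> - X](mul0r (lam v)).
    apply: cvgN; apply: cvgM; last exact: cvg_cst.
    exact: cvg_harmonic.
  - by [].
  - exact: integrable_abse.
  - move=> m v _; rewrite !abse_EFin lee_fin !normrM ler_wpM2l//.
    rewrite [X in _ <= X]mulrC ler_piMl ?mulr_ge0//.
    by rewrite ger0_norm ?expR_ge0// expR_le1// mulr_ge0// ltW.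
have cC : ((G%:E * C m) @[m --> \oo] --> (z ord0 ord0 ^+ 2)%:E * I)%E.
  rewrite /C; under eq_fun do rewrite coord_kernel_riesz_damped//.
  by apply: cvgeZl => //; exact: cvg_riesz_shift.
have cA' : ((G%:E * A m) @[m --> \oo] --> G%:E * K t)%E by exact: cvgeZl.
rewrite -(cvg_lim _ cA')// -(cvg_lim _ cC)//.
apply: lee_lim; [exact: cvgP cA'|exact: cvgP cC|].
by apply: nearW => m; rewrite lee_pmul2l ?lte_fin.
Qed.

Let W t a := (\int[B n.+2]_v
  (k v * expR (- (a * lam v)) * expR (- (t * lam v `^ s)))%:E)%E.

Let integrable_W t a : 0 <= t -> 0 < a -> (B n.+2).-integrable setT (fun v =>
  (k v * expR (- (a * lam v)) * expR (- (t * lam v `^ s)))%:E).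
Proof.
move=> t0 a0; apply: (@integrable_gauss_bounded _ _ R (B n.+2) lam k mlam mk _ _ 1) => //.
- by move=> tau tau0; exact: integrable_coord_kernel_gauss.
- by move=> v; have /andP[e0 e1] := expr01 v t0; rewrite ger0_norm.
Qed.

(** For fixed a the inner integral is nonnegative and converges as t --> 0, the two
    properties that Fatou's lemma needs. *)
Lemma coord_kernel_stretched_mixture t : 0 < t ->
  (G%:E * K t = \int[leb]_(a in `]0%R, +oo[) ((a `^ (- s))%:E * W t a))%E.
Proof.
move=> t0; have iK := integrable_coord_kernel_stretched z s0 t0.
have E v : k v * (lam v `^ (s - 1) * expR (- (t * lam v `^ s))) =
   k v * (expR (- (t * lam v `^ s)) * lam v `^ (s - 1)) by ring.
rewrite /K; under eq_integral do rewrite E.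
rewrite mixture_laplace//; last by apply: eq_integrable iK => // v _; rewrite -E.
apply: eq_integral => a; rewrite inE/= in_itv/= andbT => a0.
rewrite -integralZl//; last by apply: integrable_W => //; exact: ltW.
by apply: eq_integral => v _; rewrite -EFinM; congr EFin; ring.
Qed.

Lemma coord_kernel_stretched_ge0 t : 0 < t -> (0 <= K t)%E.
Proof.
move=> t0; rewrite -(@pmule_rge0 _ G%:E) ?lte_fin// coord_kernel_stretched_mixture//.
apply: integral_ge0 => a; rewrite /= in_itv/= andbT => a0.
by rewrite mule_ge0 ?lee_fin ?powR_ge0// coord_kernel_stable_ge0// ltW.
Qed.

Lemma coord_kernel_stretched_lower (t : nat -> R) : (forall i, 0 < t i) ->
  t i @[i --> \oo] --> (0 : R) ->
  ((z ord0 ord0 ^+ 2)%:E * I <= limn_einf (fun i => G%:E * K (t i)))%E.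
Proof.
move=> t0 tcvg.
under [in leRHS]eq_fun do rewrite coord_kernel_stretched_mixture//.
pose f i a := ((a `^ (- s))%:E * W (t i) a)%E.
have f0 i (a : R) : 0 < a -> (0 <= f i a)%E.
  move=> a0; rewrite mule_ge0 ?lee_fin ?powR_ge0//.
  by rewrite coord_kernel_stable_ge0// ltW.
have mW r : measurable_fun setT (W r : measurableTypeR R -> \bar R).
  apply: (@measurable_param_integral _ _ _ (measurableTypeR R) R (B n.+2) (fun p =>
    k p.1 * expR (- (p.2 * lam p.1)) * expR (- (r * lam p.1 `^ s)))).
  apply: measurable_funM; last exact: (measurableT_comp (mexp r s) measurable_fst).
  apply: measurable_funM; first exact: (measurableT_comp mk measurable_fst).
  apply: measurable_fun_expR; apply: measurable_fun_opp; apply: measurable_funM.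
    exact: measurable_snd.
  exact: (measurableT_comp mlam measurable_fst).
pose D : set (measurableTypeR R) := [set` `]0%R, +oo[].
have mD : measurable D by exact: measurable_itv.
have mf i : measurable_fun D (f i).
  apply: measurable_funTS; apply: emeasurable_funM; last exact: mW.
  by apply/measurable_EFinP; exact: measurable_fun_powR.
have fcvg (a : R) : 0 < a -> (f i a @[i --> \oo] -->
    (z ord0 ord0 ^+ 2 * riesz_integrand n.+2 s (dotr z z / 4) a)%:E)%E.
  move=> a0.
  have -> : (z ord0 ord0 ^+ 2 * riesz_integrand n.+2 s (dotr z z / 4) a)%:E =
     ((a `^ (- s))%:E * \int[B n.+2]_v (k v * expR (- (a * lam v)))%:E)%E.
    by rewrite coord_kernel_gauss// -EFinM; congr EFin; rewrite /riesz_integrand; ring.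
  apply: cvgeZl => //.
  have ik := integrable_coord_kernel_gauss z a0.
  apply: (@dominated_cvg _ _ _ (B n.+2) setT measurableT _ _
    (fun v => `|(k v * expR (- (a * lam v)))%:E|%E)) => //.
  - by move=> i; case/integrableP : (integrable_W (ltW (t0 i)) a0).
  - move=> v _; apply: cvg_EFin; first exact: nearW.
    rewrite -[X in _ --> X]mulr1; apply: cvgM; first exact: cvg_cst.
    rewrite -[X in _ --> X]expR0; apply: continuous_cvg; first exact: continuous_expR.
    rewrite -oppr0 -[X in _ --> - X](mul0r (lam v `^ s)).
    by apply: cvgN; apply: cvgM; last exact: cvg_cst.
  - exact: integrable_abse.
  - move=> i v _; rewrite !abse_EFin lee_fin normrM ler_piMr//.
    by have /andP[e0 e1] := expr01 v (ltW (t0 i)); rewrite ger0_norm.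
have := @fatou _ _ R leb D mD f mf.
have D0 (a : R) : D a -> 0 < a by rewrite /D /= in_itv/= andbT.
move=> /(_ (fun i a Da => f0 i a (D0 a Da))); apply: le_trans.
rewrite -ge0_integralZl_EFin ?sqr_ge0//; last 2 first.
- by move=> a /D0 a0; rewrite lee_fin riesz_integrand_ge0.
- by apply/measurable_EFinP/measurable_funTS; exact: measurable_riesz_integrand.
rewrite le_eqVlt; apply/orP; left; apply/eqP.
apply: eq_integral => a /set_mem /D0 a0.
by rewrite (cvg_limn_einf_sup (fcvg a a0)).1.
Qed.

End small_time_integrals.

(** * The heat kernel and the normalising constant *)
Section heat_kernel_bounds.
Context {R : realType}.
Local Notation leb := (@lebesgue_measure R).
Local Notation B n := (@borel_lebesgue R n).

Lemma enorm_ge0 n (v : 'rV[R]_n) : 0 <= enorm v.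
Proof. exact: sqrtr_ge0. Qed.

Lemma powR_enorm n (v : 'rV[R]_n) (s : R) : enorm v `^ (2 * s) = dotr v v `^ s.
Proof. by rewrite powRrM powR_mulrn ?enorm_ge0// sqr_sqrtr// dotr_ge0. Qed.

Lemma heat_kernelE n (s : R) (z : 'rV[R]_n) (t : R) :
  heat_kernel s z t = (2 * pi) ^- n *
   fine (\int[B n]_v (expR (- (t * dotr v v `^ s)) * cos (dotr z v))%:E)%E.
Proof.
rewrite /heat_kernel /heat_kernelC /cintegral.
rewrite /= mul0r subr0; congr (_ * _); rewrite /Rintegral.
under eq_integral => v _ do rewrite /= mul0r subr0 powR_enorm mulNr.
rewrite integral_lebesgue_rV//; apply/measurable_EFinP.
apply: measurable_funM; first exact: measurable_stretched.
by apply: measurable_fun_cos; apply: measurable_fun_dotr => //; exact: measurable_id.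
Qed.

Definition riesz_const N (s : R) : R :=
  fine (\int[leb]_(a in `]0%R, +oo[) (riesz_integrand N s 4^-1 a)%:E)%E.

Lemma riesz_constE N (s : R) : 0 < s < 1 ->
  (\int[leb]_(a in `]0%R, +oo[) (riesz_integrand N s 4^-1 a)%:E =
   (riesz_const N s)%:E)%E.
Proof.
move=> s01; rewrite /riesz_const fineK//; apply: integrable_fin_num => //.
by apply: integrable_riesz_integrand.
Qed.

(** Substituting a = q a' with q = |v|^2 extracts q^(-N/2-s). *)
Lemma riesz_integral N (s : R) (v : 'rV[R]_N) : 0 < s < 1 -> 0 < dotr v v ->
  (\int[leb]_(a in `]0%R, +oo[) (riesz_integrand N s (dotr v v / 4) a)%:E =
   (riesz_const N s / enorm v `^ (N%:R + 2 * s))%:E)%E.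
Proof.
move=> s01; set q := dotr v v => q0.
have sq0 : 0 < Num.sqrt q by rewrite sqrtr_gt0.
have e0 : enorm v != 0 by rewrite /enorm -/q gt_eqF.
have eE : enorm v `^ (N%:R + 2 * s) = Num.sqrt q ^+ N * q `^ s.
  rewrite powRD ?e0 ?implybT// powR_enorm powR_mulrn ?enorm_ge0//.
pose f a : \bar R := (riesz_integrand N s (q / 4) a)%:E.
have mf : measurable_fun setT f.
  by apply/measurable_EFinP; exact: measurable_riesz_integrand.
have f0 (a : R) : 0 < a -> (0 <= f a)%E.
  by move=> a0; rewrite lee_fin riesz_integrand_ge0.
have := ge0_integral_scale_halfline q0 mf f0.
rewrite -/f => h.
have -> : (\int[leb]_(a in `]0%R, +oo[) f a =
    q%:E * \int[leb]_(a in `]0%R, +oo[) f (q * a)%R)%E.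
  by rewrite h muleA -EFinM mulfV ?mul1e// gt_eqF.
pose c := (q * (Num.sqrt q ^+ N * q `^ s))^-1.
have c0 : 0 <= c.
  by rewrite invr_ge0 !mulr_ge0 ?powR_ge0 ?exprn_ge0 ?sqrtr_ge0// ltW.
have -> : (\int[leb]_(a in `]0%R, +oo[) f (q * a)%R =
    \int[leb]_(a in `]0%R, +oo[) (c%:E * (riesz_integrand N s 4^-1 a)%:E))%E.
  apply: eq_integral => a; rewrite inE/= in_itv/= andbT => a0.
  rewrite /f -EFinM; congr EFin; rewrite /riesz_integrand /gauss_hat /c.
  have -> : q / 4 / (q * a) = 4^-1 / a by field; rewrite !gt_eqF.
  have -> : pi / (q * a) = q^-1 * (pi / a) by field; rewrite !gt_eqF.
  rewrite sqrtrM ?invr_ge0 ?(ltW q0)// sqrtrV ?(ltW q0)// exprMn.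
  rewrite powRM ?(ltW q0) ?(ltW a0)// (powRN q) exprVn.
  field; rewrite ?gt_eqF ?powR_gt0 ?exprn_gt0//.
rewrite ge0_integralZl_EFin//; last 2 first.
- by move=> a; rewrite /= in_itv/= andbT => a0; rewrite lee_fin riesz_integrand_ge0.
- by apply/measurable_EFinP/measurable_funTS; exact: measurable_riesz_integrand.
rewrite riesz_constE// -!EFinM eE; congr EFin; rewrite /c.
by field; rewrite ?gt_eqF ?powR_gt0 ?exprn_gt0.
Qed.

Lemma measurable_enorm n : measurable_fun setT (@enorm R n).
Proof.
apply: (measurableT_comp (f := @Num.sqrt R)).
  by apply: continuous_measurable_fun; exact: sqrt_continuous.
exact: measurable_fun_sqnorm.
Qed.

(** Fourier inversion for the Gaussian, at the frequencies 0 and e_0: integrating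
    gauss_hat against cos <e_0, h> returns (2 pi)^N exp (- a |e_0|^2). *)
Lemma gauss_defect n (a : R) : 0 < a ->
  (\int[B n.+1]_h ((1 - cos (h ord0 ord0)) * gauss_hat n.+1 (dotr h h / 4) a)%:E =
   ((2 * pi) ^+ n.+1 * (1 - expR (- a)))%:E)%E.
Proof.
move=> a0; pose e : 'rV[R]_n.+1 := consr (1, 0).
have dz0 (v : 'rV[R]_n) : dotr 0 v = 0.
  by rewrite /dotr big1// => i _; rewrite mxE mul0r.
have dz1 (v : 'rV[R]_n.+1) : dotr 0 v = 0.
  by rewrite /dotr big1// => i _; rewrite mxE mul0r.
have de (h : 'rV[R]_n.+1) : dotr e h = h ord0 ord0.
  by rewrite -[in LHS](unconsrK h) dotr_consr mul1r dz0 addr0.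
have ee : dotr e e = 1 by rewrite de consr0.
pose b := (4 * a)^-1; have b0 : 0 < b by rewrite invr_gt0 mulr_gt0.
pose c := Num.sqrt (pi / a) ^+ n.+1.
have E (h : 'rV[R]_n.+1) : ((1 - cos (h ord0 ord0)) * gauss_hat n.+1 (dotr h h / 4) a)%:E =
   (c%:E * (expR (- (b * dotr h h)) * cos (dotr 0 h + 0))%:E -
    c%:E * (expR (- (b * dotr h h)) * cos (dotr e h + 0))%:E)%E.
  rewrite -!EFinM -EFinB; congr EFin; rewrite dz1 de !addr0 cos0 /gauss_hat.
  rewrite (_ : dotr h h / 4 / a = b * dotr h h); last by rewrite /b; field; rewrite gt_eqF.
  by rewrite -/c; ring.
under eq_integral do rewrite E.
rewrite integralB//; [|apply: integrableZl => //; exact: integrable_gauss_cos..].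
rewrite !integralZl//; [|exact: integrable_gauss_cos..].
rewrite !gauss_fourier// ee dz1 mul0r oppr0 expR0 cos0 !mulr1 -!EFinM -EFinB.
have -> : 1 / (4 * b) = a by rewrite /b; field; rewrite ?gt_eqF.
have cs : c * Num.sqrt (pi / b) ^+ n.+1 = (2 * pi) ^+ n.+1.
  rewrite /c -exprMn -sqrtrM ?divr_ge0 ?pi_ge0 ?(ltW a0)//.
  rewrite (_ : pi / a * (pi / b) = (2 * pi) ^+ 2); last by rewrite /b; field; rewrite gt_eqF.
  by rewrite sqrtr_sqr ger0_norm// mulr_ge0// pi_ge0.
by congr EFin; rewrite mulrA cs; ring.
Qed.

(** Write riesz_const / |h|^(N+2s) as an integral over a and integrate in h first:
    by [gauss_defect] what remains is Bernstein's formula at l = 1. *)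
Lemma riesz_const_frac n (s G : R) : 0 < s < 1 -> 0 < G ->
  (forall l, 0 < l ->
    (\int[leb]_(x in `]0%R, +oo[) (x `^ (- s) * expR (- (x * l)))%:E
      = (G * l `^ (s - 1))%:E)%E) ->
  ((riesz_const n.+1 s)%:E * \int[B n.+1]_h
     ((1 - cos (h ord0 ord0)) / enorm h `^ (n.+1%:R + 2 * s))%:E =
   ((2 * pi) ^+ n.+1 * (G / s))%:E)%E.
Proof.
move=> s01 G0 HG.
have HB := bernstein_powR s01 G0 HG ler01.
have cos1 (x : R) : 0 <= 1 - cos x by rewrite subr_ge0 cos_le1.
have I0 : 0 <= riesz_const n.+1 s.
  rewrite -lee_fin -riesz_constE//; apply: integral_ge0 => a.
  by rewrite /= in_itv/= andbT => a0; rewrite lee_fin riesz_integrand_ge0.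
have mcos : measurable_fun setT (fun h : 'rV[R]_n.+1 => 1 - cos (h ord0 ord0)).
  by apply: measurable_funB => //; apply: measurable_fun_cos; exact: measurable_coord.
have mg : measurable_fun setT (fun p : 'rV[R]_n.+1 * measurableTypeR R =>
    gauss_hat n.+1 (dotr p.1 p.1 / 4) p.2).
  apply: measurable_funM.
    apply: measurable_funX; apply: (measurableT_comp (f := @Num.sqrt R)).
      by apply: continuous_measurable_fun; exact: sqrt_continuous.
    by apply: measurable_funM => //; apply: measurable_fun_inv; exact: measurable_snd.
  apply: measurable_fun_expR; apply: measurable_fun_opp; apply: measurable_funM.
    apply: measurable_funM => //.
    exact: (measurableT_comp (@measurable_fun_sqnorm R n.+1) measurable_fst).
  by apply: measurable_fun_inv; exact: measurable_snd.
rewrite -ge0_integralZl_EFin//; last 2 first.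
- by move=> h _; rewrite lee_fin divr_ge0// powR_ge0.
- apply/measurable_EFinP; apply: measurable_funM => //.
  by apply: measurable_fun_inv; apply: measurable_fun_powR; exact: measurable_enorm.
transitivity (\int[B n.+1]_h \int[leb]_(a in `]0%R, +oo[)
    ((1 - cos (h ord0 ord0)) * riesz_integrand n.+1 s (dotr h h / 4) a)%:E)%E.
  apply: eq_integral => h _.
  have [h0|h0] := leP (dotr h h) 0.
    have -> : h ord0 ord0 = 0.
      by apply: sqnorm_eq0; apply/eqP; rewrite eq_le h0 dotr_ge0.
    rewrite cos0 subrr mul0r mule0 integral0_eq// => a _.
    by rewrite mul0r.
  under eq_integral do rewrite EFinM.
  rewrite ge0_integralZl_EFin//.
  - by rewrite riesz_integral// -!EFinM; congr EFin; ring.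
  - by move=> a; rewrite /= in_itv/= andbT => a0; rewrite lee_fin riesz_integrand_ge0.
  - by apply/measurable_EFinP/measurable_funTS; exact: measurable_riesz_integrand.
have := @ge0_integral_swap _ _ _ (measurableTypeR R) R (B n.+1) leb setT [set` `]0%R, +oo[]
  (fun h a => (1 - cos (h ord0 ord0)) * riesz_integrand n.+1 s (dotr h h / 4) a).
move=> /(_ measurableT (measurable_itv _)) ->; first last.
- move=> h a _; rewrite /= in_itv/= andbT => a0.
  by rewrite mulr_ge0// riesz_integrand_ge0.
- apply: measurable_funM; first exact: (measurableT_comp mcos measurable_fst).
  apply: measurable_funM; first by apply: measurable_fun_powR; exact: measurable_snd.
  by apply: measurable_funM => //; apply: measurable_fun_inv; exact: measurable_snd.
transitivity (\int[leb]_(a in `]0%R, +oo[)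
   (((2 * pi) ^+ n.+1)%:E * ((1 - expR (- (a * 1))) * a `^ (- s - 1))%:E))%E.
  apply: eq_integral => a; rewrite inE/= in_itv/= andbT => a0.
  have w0 : 0 <= a `^ (- s - 1) by rewrite powR_ge0.
  have E (h : 'rV[R]_n.+1) :
      ((1 - cos (h ord0 ord0)) * riesz_integrand n.+1 s (dotr h h / 4) a)%:E =
      ((a `^ (- s - 1))%:E *
       ((1 - cos (h ord0 ord0)) * gauss_hat n.+1 (dotr h h / 4) a)%:E)%E.
    rewrite -EFinM; congr EFin; rewrite /riesz_integrand -(mul_powRB1 (- s) a0).
    by field; rewrite gt_eqF.
  under eq_integral do rewrite E.
  rewrite ge0_integralZl_EFin//.
  - by rewrite gauss_defect// -!EFinM mulr1; congr EFin; ring.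
  - by move=> h _; rewrite lee_fin mulr_ge0// gauss_hat_ge0.
  - apply/measurable_EFinP; apply: measurable_funM => //.
    exact: (measurableT_comp mg (pair2_measurable a)).
rewrite ge0_integralZl_EFin ?exprn_ge0 ?mulr_ge0 ?pi_ge0//.
- by rewrite HB powR1 mulr1 -EFinM.
- move=> a; rewrite /= in_itv/= andbT => a0; rewrite lee_fin mulr_ge0 ?powR_ge0//.
  by rewrite subr_ge0 -[leRHS]expR0 ler_expR oppr_le0 mulr1 ltW.
- apply/measurable_EFinP/measurable_funTS; apply: measurable_funM.
    by apply: measurable_funB => //; exact: measurable_expRN.
  exact: measurable_fun_powR.
Qed.

End heat_kernel_bounds.

Section heat_kernel_small_time.
Context {R : realType} (n : nat) (s : R).
Hypotheses (s0 : 0 < s) (s12 : s < 2^-1).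
Local Notation leb := (@lebesgue_measure R).
Local Notation B n := (@borel_lebesgue R n).

Let s01 : 0 < s < 1.
Proof. by rewrite s0 (lt_trans s12)// invf_lt1// ltr1n. Qed.

Definition riesz_kernel (n_gt0 : (0 < n.+2)%N) (z : 'rV[R]_n.+2) : R :=
  frac_const n_gt0 s / enorm z `^ (n.+2%:R + 2 * s).

(** Both the finiteness of the integral defining frac_const and the positivity of
    riesz_const are read off the identity of [riesz_const_frac], whose right-hand
    side is positive and finite. *)
Lemma frac_constE (n_gt0 : (0 < n.+2)%N) (G : R) : 0 < G ->
  (forall l, 0 < l ->
    (\int[leb]_(x in `]0%R, +oo[) (x `^ (- s) * expR (- (x * l)))%:E
      = (G * l `^ (s - 1))%:E)%E) ->
  0 < riesz_const n.+2 s /\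
  frac_const n_gt0 s = (2 * pi) ^- n.+2 * (s / G * riesz_const n.+2 s).
Proof.
move=> G0 HG; have h := riesz_const_frac n.+1 s01 G0 HG.
set r := riesz_const _ _ in h *; set I := integral _ _ _ in h.
have pi2 : 0 < 2 * pi :> R by rewrite mulr_gt0// pi_gt0.
have v0 : 0 < (2 * pi) ^+ n.+2 * (G / s).
  by rewrite mulr_gt0 ?exprn_gt0// divr_gt0.
have r_neq0 : r != 0.
  apply/eqP => r0; move: h v0; rewrite r0 mul0e => /(congr1 fine) /= <-.
  by rewrite ltxx.
have r0 : 0 < r.
  rewrite lt_def r_neq0 -lee_fin -riesz_constE//; apply: integral_ge0 => a.
  by rewrite /= in_itv/= andbT => a0; rewrite lee_fin riesz_integrand_ge0.
split=> //.
have IE : I = ((2 * pi) ^+ n.+2 * (G / s) / r)%:E.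
  by rewrite mulrC EFinM -h muleA -EFinM mulVf// mul1e.
rewrite /frac_const /Rintegral integral_lebesgue_rV; last first.
  apply/measurable_EFinP; apply: measurable_funM.
    by apply: measurable_funB => //; apply: measurable_fun_cos; exact: measurable_coord.
  by apply: measurable_fun_inv; apply: measurable_fun_powR; exact: measurable_enorm.
rewrite (_ : Ordinal n_gt0 = ord0); last exact/val_inj.
rewrite -/I IE /=; field.
by rewrite r_neq0 !gt_eqF ?pi_gt0 ?exprn_gt0 ?pi_gt0.
Qed.

Section off_hyperplane.
Variable z : 'rV[R]_n.+2.
Hypothesis z0 : z ord0 ord0 != 0.

Let K (t : R) := (\int[B n.+2]_v
  (coord_kernel z v * (dotr v v `^ (s - 1) * expR (- (t * dotr v v `^ s))))%:E)%E.

Let heat_kernel_coord t : 0 < t ->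
  heat_kernel s z t = (2 * pi) ^- n.+2 * (t * (s * fine (K t) / z ord0 ord0 ^+ 2)).
Proof.
move=> t0; rewrite heat_kernelE; congr (_ * _).
have := coord_kernel_stretched z s0 t0; rewrite -/(K t).
set J := integral _ _ _ => /(congr1 (fun x => ((z ord0 ord0 ^+ 2)^-1%:E * x)%E)).
rewrite muleA -EFinM mulVf ?expf_neq0// mul1e => ->.
have iK := integrable_coord_kernel_stretched z s0 t0.
rewrite -[K t]fineK ?(integrable_fin_num measurableT iK)//=.
by ring.
Qed.

Lemma heat_kernel_ge0 t : 0 < t -> 0 <= heat_kernel s z t.
Proof.
move=> t0; rewrite heat_kernel_coord//.
have [G G0 HG] := laplace_powR s01.
have K0 := coord_kernel_stretched_ge0 z s0 s12 G0 HG t0.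
rewrite mulr_ge0 ?invr_ge0 ?exprn_ge0 ?mulr_ge0 ?pi_ge0 ?(ltW t0) ?(ltW s0)//.
- exact: fine_ge0.
- by rewrite invr_ge0 sqr_ge0.
Qed.

Variable n_gt0 : (0 < n.+2)%N.

Let riesz_kernelE G : 0 < G ->
  (forall l, 0 < l ->
    (\int[leb]_(x in `]0%R, +oo[) (x `^ (- s) * expR (- (x * l)))%:E
      = (G * l `^ (s - 1))%:E)%E) ->
  (\int[leb]_(a in `]0%R, +oo[) (riesz_integrand n.+2 s (dotr z z / 4) a)%:E)%E =
  ((2 * pi) ^+ n.+2 * (G / s * riesz_kernel n_gt0 z))%:E.
Proof.
move=> G0 HG; rewrite riesz_integral//; last exact: sqnorm_gt0.
congr EFin; have [r0 cE] := frac_constE n_gt0 G0 HG.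
rewrite /riesz_kernel cE; field.
have e0 : 0 < enorm z by rewrite sqrtr_gt0 sqnorm_gt0.
by rewrite ?gt_eqF ?powR_gt0 ?exprn_gt0 ?mulr_gt0 ?pi_gt0.
Qed.

Lemma heat_kernel_le t : 0 < t -> heat_kernel s z t <= t * riesz_kernel n_gt0 z.
Proof.
move=> t0; rewrite heat_kernel_coord//.
have [G G0 HG] := laplace_powR s01.
have := coord_kernel_stretched_upper s0 s12 z0 G0 HG t0.
rewrite -/(K t) (riesz_kernelE G0 HG).
have iK := integrable_coord_kernel_stretched z s0 t0.
rewrite -[K t]fineK ?(integrable_fin_num measurableT iK)//.
rewrite -!EFinM lee_fin; set k := fine _; set c := riesz_kernel _ _ => kc.
have p0 : 0 < (2 * pi) ^+ n.+2 :> R by rewrite exprn_gt0 ?mulr_gt0 ?pi_gt0.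
have zz0 : 0 < z ord0 ord0 ^+ 2 by rewrite exprn_even_gt0.
rewrite /= ler_pdivrMl// [leRHS]mulrCA ler_pM2l// ler_pdivrMr//.
rewrite -(ler_pM2l G0) mulrCA.
rewrite [leRHS](_ : _ = s * (z ord0 ord0 ^+ 2 * ((2 * pi) ^+ n.+2 * (G / s * c)))).
  by rewrite ler_pM2l.
by field; rewrite gt_eqF.
Qed.

(** The upper bound holds for each t and the lower one in the limit, which together
    force convergence. *)
Lemma heat_kernel_cvg (t : nat -> R) : (forall i, 0 < t i) ->
  t i @[i --> \oo] --> (0 : R) ->
  (heat_kernel s z (t i) / t i) @[i --> \oo] --> riesz_kernel n_gt0 z.
Proof.
move=> t0 tcvg; have [G G0 HG] := laplace_powR s01.
have zz0 : 0 < z ord0 ord0 ^+ 2 by rewrite exprn_even_gt0.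
set c := riesz_kernel _ _.
set L := z ord0 ord0 ^+ 2 * ((2 * pi) ^+ n.+2 * (G / s * c)).
have IE := riesz_kernelE G0 HG.
have Kup i : (G%:E * K (t i) <= L%:E)%E.
  have := coord_kernel_stretched_upper s0 s12 z0 G0 HG (t0 i).
  by rewrite -/(K (t i)) IE -EFinM.
have Klow : (L%:E <= limn_einf (fun i => G%:E * K (t i)))%E.
  by have := coord_kernel_stretched_lower z s0 s12 HG t0 tcvg; rewrite IE -EFinM.
have cvgK : ((G%:E * K (t i)) @[i --> \oo] --> L%:E)%E.
  suff : ((- (G%:E * K (t i))) @[i --> \oo] --> - L%:E)%E.
    by move/cvgeN; under eq_fun do rewrite oppeK; rewrite oppeK.
  apply: limn_esup_le_cvg; last by move=> i; rewrite leeN2.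
  by rewrite -leeN2 oppeK.
have iK i := integrable_coord_kernel_stretched z s0 (t0 i).
have Kf i : K (t i) \is a fin_num by exact: integrable_fin_num (iK i).
have -> : (fun i => heat_kernel s z (t i) / t i) = (fun i =>
   ((2 * pi) ^- n.+2 * (s / (G * z ord0 ord0 ^+ 2))) * (fine \o (fun i => G%:E * K (t i))%E) i).
  apply/funext => i; rewrite heat_kernel_coord// /= fineM//=; field.
  by rewrite ?z0 ?gt_eqF ?exprn_gt0 ?mulr_gt0 ?pi_gt0.
have -> : c = ((2 * pi) ^- n.+2 * (s / (G * z ord0 ord0 ^+ 2))) * L.
  by rewrite /L; field; rewrite ?z0 ?gt_eqF ?exprn_gt0 ?mulr_gt0 ?pi_gt0.
apply: cvgM; first exact: cvg_cst.
exact: fine_cvg cvgK.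
Qed.

End off_hyperplane.
End heat_kernel_small_time.

(** * Lower and upper limits *)
Section lower_limits.
Context {R : realType}.
Implicit Types (u : (\bar R)^nat).

Lemma limn_esup_ub u (l : \bar R) :
  (forall k, u k <= l)%E -> (limn_esup u <= l)%E.
Proof.
move=> ul; rewrite limn_esup_lim; apply: lime_le; first exact: is_cvg_esups.
by apply: nearW => k; apply: ge_ereal_sup => _ [i _ <-].
Qed.

Lemma limn_einf_ub u (l : \bar R) : (forall k, u k <= l)%E -> (limn_einf u <= l)%E.
Proof.
move=> ul; rewrite limn_einf_lim; apply: lime_le; first exact: is_cvg_einfs.
apply: nearW => k; apply: le_trans (ul k); apply: ereal_inf_lbound.
by exists k => /=.
Qed.

Lemma limn_einf_ge0 u : (forall k, 0 <= u k)%E -> (0 <= limn_einf u)%E.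
Proof.
move=> u0; rewrite limn_einf_lim; apply: lime_ge; first exact: is_cvg_einfs.
by apply: nearW => k; apply: le_ereal_inf_tmp => _ [i _ <-].
Qed.

Lemma limn_einf_lt_frequently u (l : \bar R) : (limn_einf u < l)%E ->
  forall m, exists2 i, (m <= i)%N & (u i < l)%E.
Proof.
move=> ul m; have : (einfs u m < l)%E.
  apply: le_lt_trans ul; rewrite limn_einf_lim (cvg_lim _ (@cvg_einfs_sup _ u))//.
  by apply: ereal_sup_ubound; exists m.
by move=> /ereal_inf_lt[_ [i /= mi <-] uil]; exists i.
Qed.

Lemma lee_gtP (x y : \bar R) : (forall l, y < l -> x <= l)%E -> (x <= y)%E.
Proof.
case: y => [y||] xy; last 2 first.
- by rewrite leey.
- case: x xy => [x||] xy //; last by have := xy 0%E (ltNyr _).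
  by have := xy (x - 1)%:E (ltNyr _); rewrite lee_fin lerDl ler0N1.
apply/lee_addgt0Pr => e e0; apply: xy.
by rewrite -EFinD lte_fin ltrDl.
Qed.

(** Reindexing by some phi with phi k >= k loses nothing, even when phi k is
    confined to sets P k that contain all large indices: a lower limit below l is
    beaten by terms of arbitrarily large index. *)
Lemma le_limn_einf_subseq u (x : \bar R) (P : nat -> set nat) :
  (forall k, \forall i \near \oo, P k i) ->
  (forall phi : nat -> nat, (forall k, k <= phi k)%N -> (forall k, P k (phi k)) ->
    (x <= limn_einf (u \o phi))%E) ->
  (x <= limn_einf u)%E.
Proof.
move=> Pk H; apply: lee_gtP => l ul.
have ex k : exists i, [/\ (k <= i)%N, P k i & (u i < l)%E].
  have [N _ NP] := Pk k.
  have [i Ni uil] := limn_einf_lt_frequently ul (maxn k N).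
  exists i; split=> //; first by rewrite (leq_trans _ Ni)// leq_maxl.
  by apply: NP; rewrite /= (leq_trans _ Ni)// leq_maxr.
pose phi k := projT1 (cid (ex k)).
have phiP k : [/\ (k <= phi k)%N, P k (phi k) & (u (phi k) < l)%E].
  exact: (projT2 (cid (ex k))).
have : (x <= limn_einf (u \o phi))%E by apply: H => k; case: (phiP k).
move=> /le_trans; apply; apply: limn_einf_ub => k /=.
by case: (phiP k) => _ _ /ltW.
Qed.

Lemma measurable_fun_limn_einf d (T : measurableType d) (D : set T)
    (f : (T -> \bar R)^nat) : (forall k, measurable_fun D (f k)) ->
  measurable_fun D (fun x => limn_einf (f^~ x)).
Proof.
move=> mf; apply: measurableT_comp => //.
by apply: measurable_fun_limn_esup => k; exact: measurableT_comp.
Qed.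

End lower_limits.

(** * Nonlocal interaction energies *)
Section interaction.
Context d (X : measurableType d) (R : realType).
Variable mu : {sigma_finite_measure set X -> \bar R}.
Implicit Types (q nu : X * X -> R) (E : set X).

Definition interaction q E : \bar R :=
  (\int[mu]_(x in E) \int[mu]_(y in ~` E) (q (x, y))%:E)%E.

Let restricted q E (x y : X) : \bar R := (\1_E x * \1_(~` E) y * q (x, y))%:E.

Let interaction_restricted q E :
  interaction q E = (\int[mu]_x \int[mu]_y restricted q E x y)%E.
Proof.
rewrite /interaction integral_mkcond; apply: eq_integral => x _.
rewrite patchE /restricted indicE; case: ifPn => _.
  rewrite integral_mkcond; apply: eq_integral => y _.
  by rewrite patchE indicE mul1r; case: ifPn => _; rewrite ?mul1r ?mul0r.
by rewrite integral0_eq// => y _; rewrite !mul0r.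
Qed.

Let restricted_ge0 q E x y : (forall p, 0 <= q p) -> (0 <= restricted q E x y)%E.
Proof. by move=> q0; rewrite lee_fin !mulr_ge0. Qed.

Let measurable_restricted q E : measurable E -> measurable_fun setT q ->
  measurable_fun setT (fun p : X * X => restricted q E p.1 p.2).
Proof.
move=> mE mq; apply/measurable_EFinP.
have -> : (fun p : X * X => \1_E p.1 * \1_(~` E) p.2 * q (p.1, p.2)) =
    (fun p => \1_E p.1 * \1_(~` E) p.2 * q p) by apply/funext => -[].
apply: measurable_funM => //; apply: measurable_funM.
  exact: (measurableT_comp (measurable_indic mE) measurable_fst).
exact: (measurableT_comp (measurable_indic (measurableC mE)) measurable_snd).
Qed.

Let measurable_restricted_r q E x : measurable E -> measurable_fun setT q ->
  measurable_fun setT (restricted q E x).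
Proof.
move=> mE mq.
exact: (measurableT_comp (measurable_restricted mE mq) (pair1_measurable x)).
Qed.

Let measurable_restricted_l q E : measurable E -> measurable_fun setT q ->
  (forall p, 0 <= q p) ->
  measurable_fun setT (fun x => \int[mu]_y restricted q E x y)%E.
Proof.
move=> mE mq q0.
apply: (@measurable_fun_fubini_tonelli_F _ _ _ _ _ _ (fun p => restricted q E p.1 p.2)).
- exact: measurable_restricted.
- by move=> p; exact: restricted_ge0.
Qed.

Lemma interactionZ (c : R) q E : 0 <= c -> measurable E -> measurable_fun setT q ->
  (forall p, 0 <= q p) ->
  interaction (fun p => c * q p) E = (c%:E * interaction q E)%E.
Proof.
move=> c0 mE mq q0; rewrite !interaction_restricted.
rewrite -ge0_integralZl_EFin//; last 2 first.
- by move=> x _; apply: integral_ge0 => y _; exact: restricted_ge0.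
- exact: measurable_restricted_l.
apply: eq_integral => x _; rewrite -ge0_integralZl_EFin//; last 2 first.
- by move=> y _; exact: restricted_ge0.
- exact: measurable_restricted_r.
by apply: eq_integral => y _; rewrite /restricted -EFinM mulrCA.
Qed.

(** The comparison is asked for slice by slice, because kernels depending on
    x - y are controlled, for each x, off one hyperplane in y. *)
Lemma le_interaction q nu E : measurable E ->
  measurable_fun setT q -> (forall p, 0 <= q p) ->
  measurable_fun setT nu -> (forall p, 0 <= nu p) ->
  (forall x, {ae mu, forall y, q (x, y) <= nu (x, y)}) ->
  (interaction q E <= interaction nu E)%E.
Proof.
move=> mE mq q0 mnu nu0 qnu; rewrite !interaction_restricted.
apply: ge0_le_integral => //.
- by move=> x _; apply: integral_ge0 => y _; exact: restricted_ge0.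
- exact: measurable_restricted_l.
- exact: measurable_restricted_l.
move=> x _; apply: ae_ge0_le_integral => //.
- by move=> y _; exact: restricted_ge0.
- exact: measurable_restricted_r.
- by move=> y _; exact: restricted_ge0.
- exact: measurable_restricted_r.
by apply: filterS (qnu x) => y qy _; rewrite lee_fin ler_wpM2l.
Qed.

(** Borel-Cantelli lemma for the symmetric differences. *)
Lemma ae_eventually_mem (E : set X) (E_ : nat -> set X) :
  measurable E -> (forall k, measurable (E_ k)) ->
  (forall k, mu (E_ k `+` E) <= (1 / (2 ^ k.+1)%:R)%:E)%E ->
  {ae mu, forall x, \forall k \near \oo, E_ k x <-> E x}.
Proof.
move=> mE mE_ muE; pose D k := E_ k `+` E.
have mD k : measurable (D k).
  by rewrite /D setY_def; apply: measurableU; exact: measurableD.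
exists (lim_sup_set D); split.
- apply: bigcap_measurable => // k _; exact: bigcup_measurable.
- apply: lim_sup_set_cvg0 => //.
  have := @epsilon_trick R (fun=> 0%E) 1 xpredT (fun=> lexx _) ler01.
  rewrite [X in (_ <= X + _)%E]eseries0// add0e => h.
  apply: le_lt_trans (le_lt_trans h (ltry 1)); apply: lee_nneseries => // k _.
  by rewrite add0e; exact: muE.
- move=> x /= nx k _; apply: contrapT => h; apply: nx; exists k => // j /= kj.
  apply: contrapT => nE; apply: h; exists j => //; rewrite /D setY_def.
  have [xE|xE] := pselect (E x).
    by right; split=> // xEj; apply: nE.
  by left; split=> //; apply: contrapT => xEj; apply: nE.
Qed.

(** On a subsequence with summable measures of the symmetric differences, the
    indicators are almost everywhere eventually constant; Fatou's lemma then applies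
    to the inner integral and to the outer one. *)
Lemma interaction_lower_semicontinuous (q : nat -> X * X -> R) nu E
    (E_ : nat -> set X) : measurable E -> (forall i, measurable (E_ i)) ->
  (forall i, measurable_fun setT (q i)) -> (forall i p, 0 <= q i p) ->
  measurable_fun setT nu -> (forall p, 0 <= nu p) ->
  (forall x, {ae mu, forall y, q i (x, y) @[i --> \oo] --> nu (x, y)}) ->
  mu (E_ i `+` E) @[i --> \oo] --> 0%E ->
  (interaction nu E <= limn_einf (fun i => interaction (q i) (E_ i)))%E.
Proof.
move=> mE mE_ mq q0 mnu nu0 qnu muE.
pose e k : R := 1 / (2 ^ k.+1)%:R.
have e0 k : 0 < e k by rewrite divr_gt0// ltr0n expn_gt0.
apply: (@le_limn_einf_subseq _ _ _ (fun k i => mu (E_ i `+` E) <= (e k)%:E)%E).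
  move=> k; have : \forall i \near \oo, (mu (E_ i `+` E) < (e k)%:E)%E.
    exact: muE _ (@nbhs_open_ereal_lt _ 0 (fun=> e k) (e0 k)).
  by apply: filterS => i /ltW.
move=> phi kphi muphi.
have phioo : phi k @[k --> \oo] --> \oo.
  move=> A [N _ NA]; exists N => // k /= Nk; apply: NA => /=.
  exact: leq_trans (kphi k).
have aeE := ae_eventually_mem mE (fun k => mE_ (phi k)) muphi.
pose f k x y := restricted (q (phi k)) (E_ (phi k)) x y.
rewrite (_ : _ \o phi = fun k => (\int[mu]_x \int[mu]_y f k x y)%E); last first.
  by apply/funext => k /=; rewrite interaction_restricted.
have f0 k x y : (0 <= f k x y)%E by exact: restricted_ge0.
have If0 k x : (0 <= \int[mu]_y f k x y)%E by exact: integral_ge0.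
have mIf k : measurable_fun setT (fun x => \int[mu]_y f k x y)%E.
  exact: measurable_restricted_l.
have mf k x : measurable_fun setT (f k x) by exact: measurable_restricted_r.
apply: le_trans (fatou mu measurableT mIf (fun k x _ => If0 k x)).
rewrite interaction_restricted; apply: ae_ge0_le_integral => //.
- by move=> x _; apply: integral_ge0 => y _; exact: restricted_ge0.
- exact: measurable_restricted_l.
- by move=> x _; exact: limn_einf_ge0.
- exact: measurable_fun_limn_einf.
apply: filterS (aeE) => x Ex _.
apply: le_trans (fatou mu measurableT (mf^~ x) (fun k y _ => f0 k x y)).
apply: ae_ge0_le_integral => //.
- by move=> y _; exact: restricted_ge0.
- exact: measurable_restricted_r.
- by move=> y _; exact: limn_einf_ge0.
- exact: measurable_fun_limn_einf.
apply: filterS2 aeE (qnu x) => y Ey qxy _.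
suff /cvg_limn_einf_sup[-> _] : f k x y @[k --> \oo] --> restricted nu E x y by [].
apply: cvg_EFin; first exact: nearW.
have indic_cvg (z : X) (F : nat -> set X) (G : set X) :
    (\forall k \near \oo, F k z <-> G z) ->
    (\1_(F k) z : R) @[k --> \oo] --> (\1_G z : R).
  move=> FG; apply: cvg_near_cst; apply: filterS FG => k [FG GF].
  rewrite !indicE; congr (nat_of_bool _)%:R; apply/idP/idP => /set_mem h.
    by apply/mem_set/FG.
  by apply/mem_set/GF.
apply: cvgM; last exact: (cvg_comp _ _ phioo qxy).
apply: cvgM; first exact: indic_cvg.
apply: indic_cvg; apply: filterS Ey => k [EkE EEk].
by split=> /= h; [move=> /EEk|move=> /EkE].
Qed.

End interaction.

(** * Heat energy and perimeter as interaction energies *)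
Section heat_interaction.
Context {R : realType}.
Local Notation B n := (@borel_lebesgue R n).
Local Notation X n := (caratheodory_type (B n)^*%mu).
Local Notation mu n := (@lebesgue_rV R n).

Lemma measurable_heat_kernel n (s t : R) :
  measurable_fun setT (fun z : 'rV[R]_n => heat_kernel s z t).
Proof.
under eq_fun do rewrite heat_kernelE.
apply: measurable_funM => //; apply: measurableT_comp => //.
apply: (@measurable_param_integral _ _ _ _ R (B n)
  (fun p => expR (- (t * dotr p.1 p.1 `^ s)) * cos (dotr p.2 p.1))).
apply: measurable_funM.
  have me : measurable_fun setT (fun v : 'rV[R]_n => expR (- (t * dotr v v `^ s))).
    exact: measurable_stretched.
  exact: (measurableT_comp me measurable_fst).
apply: measurable_fun_cos.
by apply: measurable_fun_dotr; [exact: measurable_snd|exact: measurable_fst].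
Qed.

Lemma measurable_sub_rV n :
  measurable_fun setT (fun p : X n * X n => (to_borel p.1 - to_borel p.2)).
Proof.
apply: measurable_fun_rV => i; under eq_fun do rewrite !mxE.
have mc : measurable_fun setT (fun x : X n => to_borel x ord0 i).
  exact: (measurableT_comp (measurable_coord i) (@measurable_to_borel R n)).
apply: measurable_funB; first exact: (measurableT_comp mc measurable_fst).
exact: (measurableT_comp mc measurable_snd).
Qed.

(** The pointwise bounds on the heat kernel are available where the first
    coordinate of x - y does not vanish; the exceptional y form a null hyperplane. *)
Lemma ae_coord_sub_neq0 n (x : 'rV[R]_n.+1) :
  {ae mu n.+1, forall y, (x - y) ord0 ord0 != 0}.
Proof.
pose N := [set y : 'rV[R]_n.+1 | y ord0 ord0 = x ord0 ord0].
have mN : measurable N by exact: measurable_hyperplane.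
exists N; split.
- by have := @measurable_to_borel R n.+1 measurableT _ mN; rewrite setTI.
- have := @borel_lebesgue_hyperplane R n (x ord0 ord0).
  by rewrite -/N => <-; exact: measurable_mu_extE.
- move=> y /= /negP; rewrite negbK !mxE subr_eq0 => /eqP xy; exact: esym.
Qed.

Lemma indic_setY (T : Type) (A C : set T) (x : T) :
  `|\1_A x - \1_C x| = \1_(A `+` C) x :> R.
Proof.
rewrite !indicE setY_def in_setU !in_setD.
by case: (x \in A); case: (x \in C);
  rewrite /= ?subrr ?subr0 ?sub0r ?normrN ?normr0 ?normr1.
Qed.

Lemma L1_cvgE n (E_ : nat -> set 'rV[R]_n) (E : set 'rV[R]_n) :
  lebesgue_measurable E -> (forall i, lebesgue_measurable (E_ i)) ->
  L1_cvg E_ E -> mu n (E_ i `+` E) @[i --> \oo] --> 0%E.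
Proof.
move=> mE mE_; rewrite /L1_cvg.
have -> : (fun i => 'N[mu n]_1[EFin \o (\1_(E_ i) \- \1_E)%R])%E =
    (fun i => mu n (E_ i `+` E)) => //.
apply/funext => i; rewrite Lnorm1.
have mD : measurable (E_ i `+` E : set (X n)).
  have mEi : measurable (E_ i : set (X n)) := mE_ i.
  have mE' : measurable (E : set (X n)) := mE.
  rewrite setY_def; apply: measurableU.
    exact: (measurableD mEi mE').
  exact: (measurableD mE' mEi).
have := integral_indic (mu n) measurableT mD; rewrite setIT => <-.
apply: eq_integral => x _ /=; congr EFin; exact: indic_setY.
Qed.

Lemma L1_cvg_cst n (E : set 'rV[R]_n) : L1_cvg (fun=> E) E.
Proof.
rewrite /L1_cvg; apply: cvg_near_cst; apply: nearW => i.
by rewrite Lnorm1 integral0_eq// => x _; rewrite /= subrr normr0.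
Qed.

Lemma enorm_sub_sym n (x y : 'rV[R]_n) : enorm (x - y) = enorm (y - x).
Proof.
congr Num.sqrt; apply: eq_bigr => i _.
by rewrite -(opprB y x) !mxE mulrNN.
Qed.

Section fractional_range.
Variables (n : nat) (s : R).
Hypotheses (s0 : 0 < s) (s12 : s < 2^-1).

(** Off the hyperplane z_0 = 0 the heat kernel is nonnegative and the truncation
    has no effect; it makes the integrand nonnegative everywhere. *)
Definition heat_quotient (t : R) (p : X n.+2 * X n.+2) : R :=
  Num.max (heat_kernel s (to_borel p.1 - to_borel p.2) t) 0 / t.

Lemma heat_quotient_ge0 t p : 0 < t -> 0 <= heat_quotient t p.
Proof. by move=> t0; rewrite divr_ge0 ?(ltW t0)// le_max lexx orbT. Qed.

Lemma measurable_heat_quotient t : measurable_fun setT (heat_quotient t).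
Proof.
apply: measurable_funM => //; apply: measurable_maxr => //.
exact: (measurableT_comp (@measurable_heat_kernel n.+2 s t) (@measurable_sub_rV n.+2)).
Qed.

Lemma heat_kernel_inner (t : R) (x : 'rV[R]_n.+2) (E : set 'rV[R]_n.+2) :
  0 < t -> lebesgue_measurable E ->
  (\int[mu n.+2]_(y in E) (heat_kernel s (x - y) t)%:E =
   \int[mu n.+2]_(y in E) (t * heat_quotient t (x, y))%:E)%E.
Proof.
move=> t0 mE.
have mk : measurable_fun setT (fun p : X n.+2 * X n.+2 =>
      heat_kernel s (to_borel p.1 - to_borel p.2) t).
  exact: (measurableT_comp (@measurable_heat_kernel n.+2 s t) (@measurable_sub_rV n.+2)).
have mkx : measurable_fun setT (fun y : X n.+2 => heat_kernel s (x - y) t).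
  exact: (measurableT_comp mk (pair1_measurable (x : X n.+2))).
have mqx : measurable_fun setT (fun y : X n.+2 => heat_quotient t (x, y)).
  exact: (measurableT_comp (@measurable_heat_quotient t)
    (pair1_measurable (x : X n.+2))).
have mtq : measurable_fun setT (fun y : X n.+2 => t * heat_quotient t (x, y)).
  exact: (measurable_funM (measurable_cst t) mqx).
apply: ae_eq_integral.
- exact: mE.
- by apply/measurable_EFinP; apply: measurable_funTS; exact: mkx.
- by apply/measurable_EFinP; apply: measurable_funTS; exact: mtq.
have [N [mN N0 sN]] := ae_coord_sub_neq0 x; exists N; split=> // y.
apply: contra_notP => yN _; have xy : (x - y) ord0 ord0 != 0.
  by apply: contrapT => xy; apply: yN; exact: sN.
have k0 := heat_kernel_ge0 s0 s12 xy t0.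
by rewrite /heat_quotient /= mulrCA mulfV ?gt_eqF// mulr1 max_l.
Qed.

Lemma heat_energy_interaction (t : R) (E : set 'rV[R]_n.+2) :
  0 < t -> lebesgue_measurable E ->
  heat_energy s t E =
  interaction (mu n.+2) (fun p => t * heat_quotient t p)%R E.
Proof.
move=> t0 mE; have mE' : measurable (E : set (X n.+2)) := mE.
rewrite /heat_energy /interaction; apply: eq_integral => x _.
exact: (heat_kernel_inner x t0 (measurableC mE')).
Qed.

Lemma heat_energyE (t : R) (E : set 'rV[R]_n.+2) : 0 < t -> lebesgue_measurable E ->
  (heat_energy s t E / t%:E = interaction (mu n.+2) (heat_quotient t) E)%E.
Proof.
move=> t0 mE; have mE' : measurable (E : set (X n.+2)) := mE.
have qE := @interactionZ _ _ _ (mu n.+2) t (heat_quotient t) E (ltW t0) mE'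
  (@measurable_heat_quotient t) (fun p => heat_quotient_ge0 p t0).
rewrite heat_energy_interaction// qE; set J := interaction _ _ _.
by rewrite inver gt_eqF// muleAC -EFinM mulfV ?gt_eqF// mul1e.
Qed.

Variable n_gt0 : (0 < n.+2)%N.

Lemma frac_const_gt0 : 0 < frac_const n_gt0 s.
Proof.
have s01 : 0 < s < 1 by rewrite s0 (lt_trans s12)// invf_lt1// ltr1n.
have [G G0 HG] := laplace_powR s01; have [r0 ->] := frac_constE s0 s12 n_gt0 G0 HG.
by rewrite mulr_gt0 ?invr_gt0 ?exprn_gt0 ?mulr_gt0 ?pi_gt0 ?divr_gt0 ?invr_gt0.
Qed.

Definition riesz_interaction (p : X n.+2 * X n.+2) : R :=
  riesz_kernel s n_gt0 (to_borel p.1 - to_borel p.2).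

Lemma riesz_interaction_ge0 p : 0 <= riesz_interaction p.
Proof. by rewrite divr_ge0 ?powR_ge0// ltW// frac_const_gt0. Qed.

Lemma measurable_riesz_interaction : measurable_fun setT riesz_interaction.
Proof.
apply: measurable_funM => //; apply: measurable_fun_inv; apply: measurable_fun_powR.
exact: (measurableT_comp (@measurable_enorm R n.+2) (@measurable_sub_rV n.+2)).
Qed.

Let h (p : X n.+2 * X n.+2) : R :=
  (enorm (to_borel p.1 - to_borel p.2) `^ (n.+2%:R + 2 * s))^-1.

Lemma frac_perimeter_interaction (E : set 'rV[R]_n.+2) :
  frac_perimeter s E = interaction (mu n.+2) h E.
Proof.
rewrite /frac_perimeter /interaction.
apply: eq_integral => y _; apply: eq_integral => x _.
by rewrite /h /= /to_borel enorm_sub_sym.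
Qed.

Lemma frac_perimeterE (E : set 'rV[R]_n.+2) : lebesgue_measurable E ->
  ((frac_const n_gt0 s)%:E * frac_perimeter s E =
   interaction (mu n.+2) riesz_interaction E)%E.
Proof.
move=> mE; have c0 := ltW (frac_const_gt0).
have mh : measurable_fun setT h.
  apply: measurable_fun_inv; apply: measurable_fun_powR.
  exact: (measurableT_comp (@measurable_enorm R n.+2) (@measurable_sub_rV n.+2)).
rewrite frac_perimeter_interaction -interactionZ// => p.
by rewrite invr_ge0 powR_ge0.
Qed.



End fractional_range.

End heat_interaction.

Section heat_quotient_ae.
Context {R : realType} (n : nat) (s : R).
Hypotheses (s0 : 0 < s) (s12 : s < 2^-1).
Variable n_gt0 : (0 < n.+2)%N.
Local Notation X := (caratheodory_type (@borel_lebesgue R n.+2)^*%mu).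
Local Notation mu := (@lebesgue_rV R n.+2).

Let ae_off_hyperplane (x : X) (P : X -> Prop) :
  (forall y, (to_borel x - to_borel y) ord0 ord0 != 0 -> P y) -> {ae mu, forall y, P y}.
Proof.
move=> HP; have [N [mN N0 sN]] := ae_coord_sub_neq0 (to_borel x); exists N; split=> // y.
by apply: contra_notP => yN; apply: HP; apply: contrapT => xy; apply: yN; exact: sN.
Qed.

Lemma ae_heat_quotient_le (t : R) (x : X) : 0 < t ->
  {ae mu, forall y, heat_quotient s t (x, y) <= riesz_interaction s n_gt0 (x, y)}.
Proof.
move=> t0; apply: (@ae_off_hyperplane x) => y xy.
rewrite /heat_quotient max_l; last exact: (heat_kernel_ge0 s0 s12 xy t0).
by rewrite ler_pdivrMr// mulrC; exact: (heat_kernel_le s0 s12 xy n_gt0 t0).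
Qed.

Lemma ae_heat_quotient_cvg (t : nat -> R) (x : X) : (forall i, 0 < t i) ->
  t i @[i --> \oo] --> (0 : R) ->
  {ae mu, forall y, heat_quotient s (t i) (x, y) @[i --> \oo] -->
     riesz_interaction s n_gt0 (x, y)}.
Proof.
move=> t0 tcvg; apply: (@ae_off_hyperplane x) => y xy.
rewrite (_ : (fun i => heat_quotient s (t i) (x, y)) =
    (fun i => heat_kernel s (to_borel x - to_borel y) (t i) / t i)).
  exact: (@heat_kernel_cvg _ _ _ s0 s12 _ xy n_gt0 _ t0 tcvg).
apply/funext => i.
rewrite /heat_quotient max_l//; exact: (heat_kernel_ge0 s0 s12 xy (t0 i)).
Qed.

End heat_quotient_ae.

Theorem theorem3p1 (R : realType) (n : nat) (n_ge2 : (2 <= n)%N) (s : R)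
    (s_gt0 : 0 < s) (s_lt_half : s < 2^-1) (t : nat -> R)
    (t01 : forall i, 0 < t i < 1) (t_cvg0 : t i @[i --> \oo] --> (0 : R)) :
  (forall E : set 'rV[R]_n, lebesgue_measurable E ->
   forall E_ : nat -> set 'rV[R]_n, (forall i, lebesgue_measurable (E_ i)) ->
   L1_cvg E_ E ->
   ((frac_const (ltnW n_ge2) s)%:E * frac_perimeter s E <=
    limn_einf (fun i => heat_energy s (t i) (E_ i) / (g_s s (t i))%:E))%E)
  /\
  (forall E : set 'rV[R]_n, lebesgue_measurable E ->
   exists E_ : nat -> set 'rV[R]_n, [/\ forall i, lebesgue_measurable (E_ i),
     L1_cvg E_ E &
     ((frac_const (ltnW n_ge2) s)%:E * frac_perimeter s E >=
      limn_esup (fun i => heat_energy s (t i) (E_ i) / (g_s s (t i))%:E))%E]).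
Proof.
case: n n_ge2 => [|[|N]]// {}n_ge2; set n_gt0 := ltnW n_ge2.
have t0 i : 0 < t i by have /andP[] := t01 i.
have hE i (F : set 'rV[R]_N.+2) : lebesgue_measurable F ->
    (heat_energy s (t i) F / (g_s s (t i))%:E)%E =
    interaction (@lebesgue_rV R N.+2) (heat_quotient s (t i)) F.
  by move=> mF; exact: (heat_energyE s_gt0 s_lt_half (t0 i) mF).
have mq i := @measurable_heat_quotient R N s (t i).
have q0 i p := @heat_quotient_ge0 R N s (t i) p (t0 i).
have mnu := @measurable_riesz_interaction R N s n_gt0.
have nu0 p := @riesz_interaction_ge0 R N s s_gt0 s_lt_half n_gt0 p.
split=> E mE; rewrite (frac_perimeterE s_gt0 s_lt_half n_gt0 mE).
- move=> E_ mE_ EE.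
  rewrite (_ : (fun i => _)%E = (fun i =>
      interaction (@lebesgue_rV R N.+2) (heat_quotient s (t i)) (E_ i))); last first.
    by apply/funext => i; exact: hE.
  apply: (interaction_lower_semicontinuous mE mE_ mq q0 mnu nu0).
    by move=> x; exact: ae_heat_quotient_cvg.
  exact: L1_cvgE.
- exists (fun=> E); split=> //; first exact: L1_cvg_cst.
  apply: limn_esup_ub => i; rewrite hE//.
  apply: (le_interaction mE (mq i) (q0 i) mnu nu0) => x.
  exact: ae_heat_quotient_le.
Qed.
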